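(* The assignments $\mathbf{C} \mapsto \mathsf{GP}(\mathbf{C})$ and $\mathbf{D} \mapsto \mathbf{D}_{\mathbb{P}}$ give a one-to-one correspondence, up to monoidal equivalence, between monoidal categories - $\mathbf{C}$ with finite distributive phased biproducts; - $\mathbf{D}$ with finite distributive biproducts and a choice of global phases $\mathbb{P}$.
   Context: **Phased (co)products.** A phased coproduct of a family $(A_i)_{i \in J}$ of objects is an object $A$ with morphisms $\kappa_i \colon A_i \to A$ (coprojections) such that: (i) for every family $f_i \colon A_i \to B$ there is $f \colon A \to B$ with $f \circ \kappa_i = f_i$ for all $i$; (ii) any $f, f' \colon A \to B$ with $f \circ \kappa_i = f' \circ \kappa_i$ for all $i$ satisfy $f' = f \circ U$ for some endomorphism $U$ of $A$ with $U \circ \kappa_i = \kappa_i$ for all $i$. Any endomorphism $U$ with $U \circ \kappa_i = \kappa_i$ for all $i$ is called a phase. Binary: $A \mathbin{\dot{+}} B$. Phased products, with projections $\pi_i$, are defined dually. A morphism $f \colon A \mathbin{\dot{+}} B \to C \mathbin{\dot{+}} D$ is diagonal if $f \circ \kappa_A = \kappa_C \circ g$ and $f \circ \kappa_B = \kappa_D \circ h$ for some $g, h$. **Phased biproducts.** In a category with zero arrows (in the monoidal case one also requires $0 \otimes f = 0$ and $g \otimes 0 = 0$), a phased biproduct of $A_1,\dots,A_n$ is an object with morphisms $\kappa_i$ from and $\pi_i$ to each $A_i$ such that $\pi_i \circ \kappa_i = \mathrm{id}$, $\pi_i \circ \kappa_j = 0$ for $i \neq j$, $(\kappa_i)$ makes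 it a phased coproduct, $(\pi_i)$ makes it a phased product, and both have the same phases. An empty phased biproduct is a zero object. Finite phased biproducts: every finite (possibly empty) family has one. A biproduct is a phased biproduct whose only phase is the identity. **Distributivity.** Phased biproducts in a monoidal category are distributive if they are so as phased coproducts: for every object $A$ the functors $F = A \otimes (-)$ and $F = (-) \otimes A$ strongly preserve them, i.e. for every phased coproduct $B \mathbin{\dot{+}} C$, $F(B \mathbin{\dot{+}} C)$ with $F(\kappa_B), F(\kappa_C)$ is a phased coproduct of $F(B), F(C)$, all of whose phases have the form $F(U)$ for a phase $U$ of $B \mathbin{\dot{+}} C$. **Global phases.** A scalar in a monoidal category is a morphism $s \colon I \to I$; for $f \colon A \to B$ put $s \cdot f = \lambda_B \circ (s \otimes f) \circ \lambda_A^{-1}$ and $f \cdot s = \rho_B \circ (f \otimes s) \circ \rho_A^{-1}$. A scalar $s$ is central if $s \cdot f = f \cdot s$ for all $f$. A choice of global phases is a collection $\mathbb{P}$ of invertible central scalars closed under composition and inverses. $\mathbf{D}_{\mathbb{P}}$ is the quotient of $\mathbf{D}$ by the congruence $f \sim g$ iff $f = u \cdot g$ for some $u \in \mathbb{P}$, with the monoidal structure inherited from $\mathbf{D}$. **$\mathsf{GP}(\mathbf{C})$.** Objects are phased coproducts $\mathbf{A} = A \mathbin{\dot{+}} I$ in $\mathbf{C}$ ($I$ the monoidal unit; $A, I, \kappa_A,\kappa_I$ are part of the data); morphisms $\mathbf{A} \to \mathbf{B}$ are diagonal morphisms $f$ of $\mathbf{C}$ with $f \circ \kappa_I = \kappa_I$;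 composition as in $\mathbf{C}$. Monoidal structure: for each $\mathbf{A}, \mathbf{B}$ choose an object $\mathbf{A} \widehat{\otimes} \mathbf{B} = (A \otimes B) \mathbin{\dot{+}} I$ and a morphism $c_{\mathbf{A},\mathbf{B}} \colon \mathbf{A} \widehat{\otimes} \mathbf{B} \to \mathbf{A} \otimes \mathbf{B}$ of $\mathbf{C}$ with $c_{\mathbf{A},\mathbf{B}} \circ \kappa_{A \otimes B} = \kappa_A \otimes \kappa_B$ and $c_{\mathbf{A},\mathbf{B}} \circ \kappa_I = (\kappa_I \otimes \kappa_I) \circ \rho_I^{-1}$; $f \widehat{\otimes} g$ is the unique morphism with $c \circ (f \widehat{\otimes} g) = (f \otimes g) \circ c$; the associator $\boldsymbol{\alpha}$ is the unique morphism with $(\mathrm{id}_{\mathbf{A}} \otimes c_{\mathbf{B},\mathbf{E}}) \circ c_{\mathbf{A}, \mathbf{B} \widehat{\otimes} \mathbf{E}} \circ \boldsymbol{\alpha}_{\mathbf{A},\mathbf{B},\mathbf{E}} = \alpha_{\mathbf{A},\mathbf{B},\mathbf{E}} \circ (c_{\mathbf{A},\mathbf{B}} \otimes \mathrm{id}_{\mathbf{E}}) \circ c_{\mathbf{A} \widehat{\otimes} \mathbf{B}, \mathbf{E}}$; the unit is a chosen $\mathbf{I} = I \mathbin{\dot{+}} I$ with a chosen isomorphism $\beta \colon \mathbf{I} \widehat{\otimes} \mathbf{I} \to \mathbf{I}$ satisfying $\beta \circ \kappa_1 = \kappa_1 \circ \rho_I$, $\beta \circ \kappa_2 = \kappa_2$,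 the unitors being determined by $\boldsymbol{\rho}_{\mathbf{A}} \widehat{\otimes} \mathrm{id}_{\mathbf{I}} = (\mathrm{id}_{\mathbf{A}} \widehat{\otimes} \beta) \circ \boldsymbol{\alpha}_{\mathbf{A},\mathbf{I},\mathbf{I}}$ and $\mathrm{id}_{\mathbf{I}} \widehat{\otimes} \boldsymbol{\lambda}_{\mathbf{A}} = (\beta \widehat{\otimes} \mathrm{id}_{\mathbf{A}}) \circ \boldsymbol{\alpha}^{-1}_{\mathbf{I},\mathbf{I},\mathbf{A}}$. $\mathsf{GP}(\mathbf{C})$ carries the canonical choice of global phases $\mathbb{P} = \{u \colon \mathbf{I} \to \mathbf{I} \mid u \text{ is a phase of } I \mathbin{\dot{+}} I \text{ in } \mathbf{C}\}$. *)

(* Defs.v *)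
From Stdlib Require Import Setoid Morphisms.
From Stdlib Require Fin.

Set Implicit Arguments.
Unset Strict Implicit.
Unset Printing Implicit Defensive.

Declare Scope cat_scope.
Delimit Scope cat_scope with cat.
Open Scope cat_scope.

Reserved Notation "f ≈ g" (at level 70, no associativity).
Reserved Notation "g ∘ f" (at level 40, left associativity).
Reserved Notation "A ⊗ B" (at level 36, left associativity).
Reserved Notation "f ⊠ g" (at level 36, left associativity).

(** * Categories

    Equality of parallel morphisms is an equivalence relation [heq] carried by
    the category (hom-setoids); equality of objects is never used.  A quotient
    category is then obtained by coarsening [heq]. *)

Record Category := {
  Obj :> Type;
  Hom : Obj -> Obj -> Type;
  heq : forall A B, Hom A B -> Hom A B -> Prop;
  idm : forall A, Hom A A;
  comp : forall A B C, Hom B C -> Hom A B -> Hom A C;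
  heq_equiv : forall A B, Equivalence (@heq A B);
  comp_proper : forall A B C,
    Proper (@heq B C ==> @heq A B ==> @heq A C) (@comp A B C);
  comp_idl : forall A B (f : Hom A B), heq (comp (idm B) f) f;
  comp_idr : forall A B (f : Hom A B), heq (comp f (idm A)) f;
  compA : forall A B C D (h : Hom C D) (g : Hom B C) (f : Hom A B),
    heq (comp h (comp g f)) (comp (comp h g) f)
}.
Arguments Hom {_} _ _.
Arguments idm {_} _.
#[global] Existing Instances heq_equiv comp_proper.

Notation "f ≈ g" := (heq f g) : cat_scope.
Notation "g ∘ f" := (comp g f) : cat_scope.

Definition inverse_pair (C : Category) (A B : C) (f : Hom A B) (g : Hom B A) : Prop :=
  g ∘ f ≈ idm A /\ f ∘ g ≈ idm B.

Definition is_iso (C : Category) (A B : C) (f : Hom A B) : Prop :=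
  exists g : Hom B A, inverse_pair f g.

Record Functor (C D : Category) := {
  fobj :> C -> D;
  fmap : forall A B : C, Hom A B -> Hom (fobj A) (fobj B);
  fmap_proper : forall A B : C, Proper (@heq C A B ==> @heq D (fobj A) (fobj B)) (@fmap A B);
  fmap_id : forall A : C, fmap (idm A) ≈ idm (fobj A);
  fmap_comp : forall (A B E : C) (g : Hom B E) (f : Hom A B),
    fmap (g ∘ f) ≈ fmap g ∘ fmap f
}.
#[global] Existing Instance fmap_proper.

Definition is_equivalence (C D : Category) (F : Functor C D) : Prop :=
  exists G : Functor D C,
    (exists eta : forall A : C, Hom A (G (F A)),
       (forall A, is_iso (eta A)) /\
       (forall (A B : C) (f : Hom A B), eta B ∘ f ≈ fmap G (fmap F f) ∘ eta A)) /\
    (exists eps : forall B : D, Hom (F (G B)) B,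
       (forall B, is_iso (eps B)) /\
       (forall (A B : D) (f : Hom A B), f ∘ eps A ≈ eps B ∘ fmap F (fmap G f))).

(** * Monoidal categories *)

Record Monoidal (C : Category) (T : C -> C -> C) (I : C) := {
  tens : forall A A' B B' : C, Hom A A' -> Hom B B' -> Hom (T A B) (T A' B');
  asc : forall A B E : C, Hom (T (T A B) E) (T A (T B E));
  asc_inv : forall A B E : C, Hom (T A (T B E)) (T (T A B) E);
  lun : forall A : C, Hom (T I A) A;
  lun_inv : forall A : C, Hom A (T I A);
  run : forall A : C, Hom (T A I) A;
  run_inv : forall A : C, Hom A (T A I);
  tens_proper : forall A A' B B' : C,
    Proper (@heq C A A' ==> @heq C B B' ==> @heq C (T A B) (T A' B')) (@tens A A' B B');
  tens_id : forall A B : C, tens (idm A) (idm B) ≈ idm (T A B);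
  tens_comp : forall (A A' A'' B B' B'' : C)
      (g : Hom A' A'') (f : Hom A A') (k : Hom B' B'') (h : Hom B B'),
    tens (g ∘ f) (k ∘ h) ≈ tens g k ∘ tens f h;
  asc_iso : forall A B E : C, inverse_pair (asc A B E) (asc_inv A B E);
  lun_iso : forall A : C, inverse_pair (lun A) (lun_inv A);
  run_iso : forall A : C, inverse_pair (run A) (run_inv A);
  asc_nat : forall (A A' B B' E E' : C) (f : Hom A A') (g : Hom B B') (h : Hom E E'),
    asc A' B' E' ∘ tens (tens f g) h ≈ tens f (tens g h) ∘ asc A B E;
  lun_nat : forall (A B : C) (f : Hom A B), lun B ∘ tens (idm I) f ≈ f ∘ lun A;
  run_nat : forall (A B : C) (f : Hom A B), run B ∘ tens f (idm I) ≈ f ∘ run A;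
  triangle : forall A B : C,
    tens (idm A) (lun B) ∘ asc A I B ≈ tens (run A) (idm B);
  pentagon : forall A B E G : C,
    asc A B (T E G) ∘ asc (T A B) E G
    ≈ tens (idm A) (asc B E G) ∘ asc A (T B E) G ∘ tens (asc A B E) (idm G)
}.
#[global] Existing Instance tens_proper.

Record MonCat := {
  mcat :> Category;
  mtens : mcat -> mcat -> mcat;
  munit : mcat;
  mmon : Monoidal mtens munit
}.
Arguments munit {_}.
Arguments mtens {_} _ _.

Notation "A ⊗ B" := (mtens A B) : cat_scope.
Notation "f ⊠ g" := (tens (mmon _) f g) : cat_scope.

Definition alpha (M : MonCat) (A B E : M) : Hom (A ⊗ B ⊗ E) (A ⊗ (B ⊗ E)) := asc (mmon M) A B E.
Definition lam (M : MonCat) (A : M) : Hom (munit ⊗ A) A := lun (mmon M) A.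
Definition lam_inv (M : MonCat) (A : M) : Hom A (munit ⊗ A) := lun_inv (mmon M) A.
Definition rho (M : MonCat) (A : M) : Hom (A ⊗ munit) A := run (mmon M) A.
Definition rho_inv (M : MonCat) (A : M) : Hom A (A ⊗ munit) := run_inv (mmon M) A.

(** Strong monoidal functors *)
Record MonFunctor (M N : MonCat) := {
  mfun :> Functor M N;
  mu : forall A B : M, Hom (mfun A ⊗ mfun B) (mfun (A ⊗ B));
  ups : Hom munit (mfun munit);
  ups_inv : Hom (mfun munit) munit;
  mu_iso : forall A B : M, is_iso (mu A B);
  ups_iso : inverse_pair ups ups_inv;
  mu_nat : forall (A A' B B' : M) (f : Hom A A') (g : Hom B B'),
    mu A' B' ∘ (fmap mfun f ⊠ fmap mfun g) ≈ fmap mfun (f ⊠ g) ∘ mu A B;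
  mu_assoc : forall A B E : M,
    fmap mfun (alpha A B E) ∘ mu (A ⊗ B) E ∘ (mu A B ⊠ idm (mfun E))
    ≈ mu A (B ⊗ E) ∘ (idm (mfun A) ⊠ mu B E) ∘ alpha (mfun A) (mfun B) (mfun E);
  mu_lam : forall A : M,
    fmap mfun (lam A) ∘ mu munit A ∘ (ups ⊠ idm (mfun A)) ≈ lam (mfun A);
  mu_rho : forall A : M,
    fmap mfun (rho A) ∘ mu A munit ∘ (idm (mfun A) ⊠ ups) ≈ rho (mfun A)
}.

Definition monoidally_equivalent (M N : MonCat) : Prop :=
  exists F : MonFunctor M N, is_equivalence F.

(** * Phased coproducts, products and biproducts *)

Section Phased.
Variable C : Category.

Section Family.
Variables (J : Type) (X : J -> C) (A : C).

Definition is_phase (kappa : forall i, Hom (X i) A) (U : Hom A A) : Prop :=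
  forall i, U ∘ kappa i ≈ kappa i.

Definition is_phased_coproduct (kappa : forall i, Hom (X i) A) : Prop :=
  (forall (B : C) (f : forall i, Hom (X i) B),
     exists h : Hom A B, forall i, h ∘ kappa i ≈ f i) /\
  (forall (B : C) (h h' : Hom A B),
     (forall i, h ∘ kappa i ≈ h' ∘ kappa i) ->
     exists U : Hom A A, is_phase kappa U /\ h' ≈ h ∘ U).

Definition is_phase_of_product (pi : forall i, Hom A (X i)) (U : Hom A A) : Prop :=
  forall i, pi i ∘ U ≈ pi i.

Definition is_phased_product (pi : forall i, Hom A (X i)) : Prop :=
  (forall (B : C) (f : forall i, Hom B (X i)),
     exists h : Hom B A, forall i, pi i ∘ h ≈ f i) /\
  (forall (B : C) (h h' : Hom B A),
     (forall i, pi i ∘ h ≈ pi i ∘ h') ->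
     exists U : Hom A A, is_phase_of_product pi U /\ h' ≈ U ∘ h).

Definition is_phased_biproduct (zero : forall Y Z : C, Hom Y Z)
    (kappa : forall i, Hom (X i) A) (pi : forall i, Hom A (X i)) : Prop :=
  (forall i, pi i ∘ kappa i ≈ idm (X i)) /\
  (forall i j, i <> j -> pi i ∘ kappa j ≈ zero (X j) (X i)) /\
  is_phased_coproduct kappa /\
  is_phased_product pi /\
  (forall U : Hom A A, is_phase kappa U <-> is_phase_of_product pi U).

Definition is_biproduct (zero : forall Y Z : C, Hom Y Z)
    (kappa : forall i, Hom (X i) A) (pi : forall i, Hom A (X i)) : Prop :=
  is_phased_biproduct zero kappa pi /\
  (forall U : Hom A A, is_phase kappa U -> U ≈ idm A).

End Family.

(** Binary families are indexed by [bool]. *)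
Definition fam2 (A B : C) (b : bool) : C := if b then A else B.

Definition coproj2 (A B S : C) (kA : Hom A S) (kB : Hom B S) (b : bool) : Hom (fam2 A B b) S :=
  match b return Hom (fam2 A B b) S with true => kA | false => kB end.

Definition is_phase2 (A B S : C) (kA : Hom A S) (kB : Hom B S) : Hom S S -> Prop :=
  is_phase (coproj2 kA kB).

Definition is_phased_coproduct2 (A B S : C) (kA : Hom A S) (kB : Hom B S) : Prop :=
  is_phased_coproduct (coproj2 kA kB).

Definition is_diagonal (A B S A' B' S' : C) (kA : Hom A S) (kB : Hom B S)
    (kA' : Hom A' S') (kB' : Hom B' S') (f : Hom S S') : Prop :=
  (exists g : Hom A A', f ∘ kA ≈ kA' ∘ g) /\ (exists h : Hom B B', f ∘ kB ≈ kB' ∘ h).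

Definition is_zero_arrows (zero : forall A B : C, Hom A B) : Prop :=
  (forall (A B E : C) (f : Hom A B), zero B E ∘ f ≈ zero A E) /\
  (forall (A B E : C) (f : Hom B E), f ∘ zero A B ≈ zero A E).

End Phased.

Definition strongly_preserves_phased_coproducts (C D : Category) (F : Functor C D) : Prop :=
  forall (A B S : C) (kA : Hom A S) (kB : Hom B S), is_phased_coproduct2 kA kB ->
    is_phased_coproduct2 (fmap F kA) (fmap F kB) /\
    (forall V : Hom (F S) (F S), is_phase2 (fmap F kA) (fmap F kB) V ->
       exists U : Hom S S, is_phase2 kA kB U /\ V ≈ fmap F U).

Definition tensor_left (M : MonCat) (A : M) : Functor M M.
Proof.
refine {| fobj := fun B : M => A ⊗ B; fmap := fun B B' f => idm A ⊠ f |}.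
- intros B B' f g e. now rewrite e.
- intros B. apply tens_id.
- intros B B' B'' g f. now rewrite <- tens_comp, comp_idl.
Defined.

Definition tensor_right (M : MonCat) (A : M) : Functor M M.
Proof.
refine {| fobj := fun B : M => B ⊗ A; fmap := fun B B' f => f ⊠ idm A |}.
- intros B B' f g e. now rewrite e.
- intros B. apply tens_id.
- intros B B' B'' g f. now rewrite <- tens_comp, comp_idl.
Defined.

Section MonoidalPhased.
Variable M : MonCat.

Definition distributive : Prop :=
  forall A : M, strongly_preserves_phased_coproducts (tensor_left A) /\
                strongly_preserves_phased_coproducts (tensor_right A).

Definition is_monoidal_zero_arrows (zero : forall A B : M, Hom A B) : Prop :=
  is_zero_arrows zero /\
  (forall (A A' B B' : M) (f : Hom B B'), zero A A' ⊠ f ≈ zero (A ⊗ B) (A' ⊗ B')) /\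
  (forall (A A' B B' : M) (g : Hom A A'), g ⊠ zero B B' ≈ zero (A ⊗ B) (A' ⊗ B')).

(** Zero arrows are unique when they exist.  The case [n = 0] below says that
    there is a zero object. *)
Definition has_finite_distributive_phased_biproducts : Prop :=
  exists zero : forall A B : M, Hom A B,
    is_monoidal_zero_arrows zero /\
    (forall (n : nat) (X : Fin.t n -> M),
       exists (A : M) (kappa : forall i, Hom (X i) A) (pi : forall i, Hom A (X i)),
         is_phased_biproduct zero kappa pi) /\
    distributive.

Definition has_finite_distributive_biproducts : Prop :=
  exists zero : forall A B : M, Hom A B,
    is_monoidal_zero_arrows zero /\
    (forall (n : nat) (X : Fin.t n -> M),
       exists (A : M) (kappa : forall i, Hom (X i) A) (pi : forall i, Hom A (X i)),
         is_biproduct zero kappa pi) /\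
    distributive.

(** * Global phases *)

Definition scalar : Type := Hom (munit : M) munit.

Definition lscale (s : scalar) (A B : M) (f : Hom A B) : Hom A B :=
  lam B ∘ (s ⊠ f) ∘ lam_inv A.

Definition rscale (A B : M) (f : Hom A B) (s : scalar) : Hom A B :=
  rho B ∘ (f ⊠ s) ∘ rho_inv A.

Definition central (s : scalar) : Prop :=
  forall (A B : M) (f : Hom A B), lscale s f ≈ rscale f s.

(** [gph_id] only excludes the empty collection, for which the relation
    defining the quotient category is not reflexive. *)
Record is_global_phases (P : scalar -> Prop) : Prop := {
  gph_proper : Proper (@heq M munit munit ==> iff) P;
  gph_iso : forall u, P u -> is_iso u;
  gph_central : forall u, P u -> central u;
  gph_id : P (idm munit);
  gph_comp : forall u v, P u -> P v -> P (u ∘ v);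
  gph_inv : forall u v, P u -> inverse_pair u v -> P v
}.

End MonoidalPhased.

(** Equivalence of monoidal categories equipped with global phases: the functor
    identifies the two collections, along its unit isomorphism. *)
Definition global_phase_equivalent (M : MonCat) (P : scalar M -> Prop)
    (N : MonCat) (Q : scalar N -> Prop) : Prop :=
  exists F : MonFunctor M N, is_equivalence F /\
    forall u : scalar M, P u <-> Q (ups_inv F ∘ fmap F u ∘ ups F).

(** * The quotient of [D] by [P] *)

Section Quotient.
Variables (D : MonCat) (P : scalar D -> Prop) (HP : is_global_phases P).

Definition qeq (A B : D) (f g : Hom A B) : Prop :=
  exists u : scalar D, P u /\ f ≈ lscale u g.

Lemma lscale_ext (u v : scalar D) (A B : D) (f g : Hom A B) :
  u ≈ v -> f ≈ g -> lscale u f ≈ lscale v g.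
Proof. intros e e'. unfold lscale. now rewrite e, e'. Qed.

Lemma lscale_id (A B : D) (f : Hom A B) : lscale (idm munit) f ≈ f.
Proof.
unfold lscale, lam, lam_inv. rewrite lun_nat, <- compA.
now rewrite (proj2 (lun_iso _ _)), comp_idr.
Qed.

Lemma lscale_comp (u v : scalar D) (A B E : D) (g : Hom B E) (f : Hom A B) :
  lscale u g ∘ lscale v f ≈ lscale (u ∘ v) (g ∘ f).
Proof.
unfold lscale, lam, lam_inv. rewrite tens_comp, <- !compA.
apply comp_proper; [reflexivity|]. apply comp_proper; [reflexivity|].
now rewrite (compA (lun_inv _ B)), (proj1 (lun_iso _ _)), comp_idl.
Qed.

Lemma lscaleE (u : scalar D) (A B : D) (f : Hom A B) :
  lscale u f ≈ lscale u (idm B) ∘ f.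
Proof.
rewrite <- (lscale_id f) at 2. rewrite lscale_comp.
apply lscale_ext; symmetry; [apply comp_idr|apply comp_idl].
Qed.

Lemma lscale_lscale (u v : scalar D) (A B : D) (f : Hom A B) :
  lscale u (lscale v f) ≈ lscale (u ∘ v) f.
Proof.
rewrite lscaleE, lscale_comp. apply lscale_ext; [reflexivity|apply comp_idl].
Qed.

(** Kelly's unit coherence *)
Lemma lam_tens (A B : D) : lam (A ⊗ B) ∘ alpha munit A B ≈ lam A ⊠ idm B.
Proof.
assert (faithful : forall (X Y : D) (f g : Hom X Y),
          (idm munit ⊠ f : Hom (munit ⊗ X) (munit ⊗ Y)) ≈ idm munit ⊠ g -> f ≈ g).
{ intros X Y f g e. rewrite <- (lscale_id f), <- (lscale_id g).
  unfold lscale. now rewrite e. }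
assert (epi : forall (X Y Z : D) (k : Hom X Y) (l : Hom Y X) (f g : Hom Y Z),
          k ∘ l ≈ idm Y -> f ∘ k ≈ g ∘ k -> f ≈ g).
{ intros X Y Z k l f g kl e. rewrite <- (comp_idr f), <- (comp_idr g), <- kl.
  now rewrite !compA, e. }
apply faithful.
apply (epi _ _ _ (alpha munit (munit ⊗ A) B ∘ (alpha munit munit A ⊠ idm B))
         ((asc_inv (mmon D) munit munit A ⊠ idm B) ∘ asc_inv (mmon D) munit (munit ⊗ A) B)).
{ unfold alpha. rewrite <- compA, (compA (_ ⊠ _)), <- tens_comp.
  rewrite (proj2 (asc_iso _ _ _ _)), comp_idl, tens_id, comp_idl.
  apply (proj2 (asc_iso _ _ _ _)). }
unfold alpha, lam.
transitivity ((idm munit ⊠ lun (mmon D) (A ⊗ B)) ∘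
   (asc (mmon D) munit munit (A ⊗ B) ∘ asc (mmon D) (munit ⊗ munit) A B)).
{ rewrite pentagon.
  rewrite <- (comp_idl (idm munit)) at 1. rewrite tens_comp. now rewrite !compA. }
rewrite compA, triangle, <- (tens_id (mmon D) A B), <- asc_nat.
rewrite (compA (idm munit ⊠ _)), <- asc_nat, <- compA, <- tens_comp.
now rewrite triangle, comp_idl.
Qed.

Lemma lscale_tensl (u : scalar D) (A A' B B' : D) (f : Hom A A') (g : Hom B B') :
  lscale u f ⊠ g ≈ lscale u (f ⊠ g).
Proof.
assert (inv : lam_inv A ⊠ idm B ≈ asc_inv (mmon D) munit A B ∘ lam_inv (A ⊗ B)).
{ rewrite <- (comp_idl (lam_inv A ⊠ idm B)), <- (proj1 (asc_iso (mmon D) munit A B)).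
  rewrite <- (comp_idl (asc (mmon D) munit A B)).
  rewrite <- (proj1 (lun_iso (mmon D) (A ⊗ B))).
  rewrite <- (compA (lun_inv _ _)). change (asc (mmon D) munit A B) with (alpha munit A B) at 1.
  change (lun (mmon D) (A ⊗ B)) with (lam (A ⊗ B)). rewrite lam_tens.
  rewrite <- !compA, <- tens_comp. unfold lam, lam_inv.
  now rewrite (proj2 (lun_iso _ _)), comp_idl, tens_id, comp_idr. }
transitivity ((lam A' ∘ (u ⊠ f) ∘ lam_inv A) ⊠ (idm B' ∘ g ∘ idm B)).
{ rewrite comp_idr, comp_idl. reflexivity. }
rewrite !tens_comp, inv, <- lam_tens. unfold lscale, alpha.
rewrite <- (compA _ (asc _ _ _ _)), asc_nat.
rewrite <- !compA. rewrite (compA (asc _ _ _ _)).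
now rewrite (proj2 (asc_iso _ _ _ _)), comp_idl.
Qed.

Lemma lscale_tensr (v : scalar D) (A A' B B' : D) (f : Hom A A') (g : Hom B B') :
  f ⊠ lscale v g ≈ rscale f v ⊠ g.
Proof.
assert (inv : idm A ⊠ lam_inv B ≈ asc (mmon D) A munit B ∘ (rho_inv A ⊠ idm B)).
{ rewrite <- (comp_idl (asc _ _ _ _)), <- (tens_id (mmon D)).
  rewrite <- (proj1 (lun_iso (mmon D) B)), <- (comp_idl (idm A)), tens_comp.
  rewrite <- (compA (idm A ⊠ _)), triangle, <- compA, <- tens_comp. unfold rho_inv, lam_inv.
  rewrite !(proj2 (run_iso _ _)), !comp_idl, tens_id.
  now rewrite comp_idr. }
transitivity ((idm A' ∘ f ∘ idm A) ⊠ (lam B' ∘ (v ⊠ g) ∘ lam_inv B)).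
{ rewrite comp_idr, comp_idl. reflexivity. }
rewrite !tens_comp, inv.
transitivity ((rho A' ∘ (f ⊠ v) ∘ rho_inv A) ⊠ (idm B' ∘ g ∘ idm B)).
2: { rewrite comp_idr, comp_idl. reflexivity. }
rewrite !tens_comp. unfold rho at 1. rewrite <- triangle. unfold lam.
rewrite <- (compA _ (asc _ _ _ _)), asc_nat.
now rewrite <- !compA.
Qed.

Lemma qeq_heq (A B : D) (f g : Hom A B) : f ≈ g -> qeq f g.
Proof.
intros e. exists (idm munit). split; [apply (gph_id HP)|]. now rewrite lscale_id.
Qed.

Lemma qeq_equiv (A B : D) : Equivalence (@qeq A B).
Proof.
split.
- intros f. now apply qeq_heq.
- intros f g [u [Pu e]]. destruct (gph_iso HP Pu) as [v vu].
  exists v. split; [exact (gph_inv HP Pu vu)|].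
  rewrite <- (lscale_id g). transitivity (lscale v (lscale u g)).
  + rewrite lscale_lscale. apply lscale_ext; [symmetry; apply vu|reflexivity].
  + apply lscale_ext; [reflexivity|now symmetry].
- intros f g h [u [Pu e]] [v [Pv e']].
  exists (u ∘ v). split; [now apply (gph_comp HP)|].
  rewrite e, <- lscale_lscale. now apply lscale_ext.
Qed.

Lemma qeq_comp (A B E : D) : Proper (@qeq B E ==> @qeq A B ==> @qeq A E) (@comp D A B E).
Proof.
intros g g' [u [Pu e]] f f' [v [Pv e']].
exists (u ∘ v). split; [now apply (gph_comp HP)|].
rewrite e, e'. apply lscale_comp.
Qed.

Lemma qeq_tens (A A' B B' : D) :
  Proper (@qeq A A' ==> @qeq B B' ==> @qeq (A ⊗ B) (A' ⊗ B')) (@tens _ _ _ (mmon D) A A' B B').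
Proof.
intros f f' [u [Pu e]] g g' [v [Pv e']].
exists (u ∘ v). split; [now apply (gph_comp HP)|].
rewrite e, e', lscale_tensl, <- lscale_lscale. apply lscale_ext; [reflexivity|].
rewrite lscale_tensr, <- lscale_tensl. now rewrite (gph_central HP Pv).
Qed.

Definition quotient_cat : Category.
Proof.
refine {| Obj := D; Hom := @Hom D; heq := @qeq; idm := @idm D; comp := @comp D |}.
- exact qeq_equiv.
- exact qeq_comp.
- intros; apply qeq_heq, comp_idl.
- intros; apply qeq_heq, comp_idr.
- intros; apply qeq_heq, compA.
Defined.

Definition quotient_monoidal : Monoidal (C := quotient_cat) (@mtens D) munit.
Proof.
refine (@Build_Monoidal quotient_cat (@mtens D) munit (@tens _ _ _ (mmon D))
  (asc (mmon D)) (asc_inv (mmon D)) (lun (mmon D)) (lun_inv (mmon D))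
  (run (mmon D)) (run_inv (mmon D)) qeq_tens _ _ _ _ _ _ _ _ _ _); intros.
- exact (qeq_heq (tens_id (mmon D) _ _)).
- exact (qeq_heq (tens_comp (mmon D) _ _ _ _)).
- split; apply qeq_heq; apply (asc_iso (mmon D)).
- split; apply qeq_heq; apply (lun_iso (mmon D)).
- split; apply qeq_heq; apply (run_iso (mmon D)).
- exact (qeq_heq (asc_nat (mmon D) _ _ _)).
- exact (qeq_heq (lun_nat (mmon D) _)).
- exact (qeq_heq (run_nat (mmon D) _)).
- exact (qeq_heq (triangle (mmon D) _ _)).
- exact (qeq_heq (pentagon (mmon D) _ _ _ _)).
Defined.

Definition quotient : MonCat := {| mmon := quotient_monoidal |}.

End Quotient.

(** * The category [GP(C)] *)

Section GP.
Variable C : MonCat.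

Record SumWithUnit (A : C) := {
  stot :> C;
  sin : Hom A stot;
  sun : Hom munit stot;
  sum_pcoprod : is_phased_coproduct2 sin sun
}.

Record GPObj := { gbase : C; gsum :> SumWithUnit gbase }.

Definition kbase (A : GPObj) : Hom (gbase A) A := sin (gsum A).
Definition kunit (A : GPObj) : Hom munit (A : C) := sun (gsum A).

Record GPHom (A B : GPObj) := {
  gmor :> Hom (A : C) (B : C);
  gmor_diag : is_diagonal (kbase A) (kunit A) (kbase B) (kunit B) gmor;
  gmor_unit : gmor ∘ kunit A ≈ kunit B
}.

Definition gp_id (A : GPObj) : GPHom A A.
Proof.
refine {| gmor := idm (A : C) |}; [|apply comp_idl].
split; eexists; now rewrite comp_idl, comp_idr.
Defined.

Definition gp_comp (A B E : GPObj) (g : GPHom B E) (f : GPHom A B) : GPHom A E.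
Proof.
refine {| gmor := gmor g ∘ gmor f |}.
- destruct (gmor_diag f) as [[f1 e1] [f2 e2]], (gmor_diag g) as [[g1 d1] [g2 d2]]. split.
  + exists (g1 ∘ f1). now rewrite <- compA, e1, compA, d1, compA.
  + exists (g2 ∘ f2). now rewrite <- compA, e2, compA, d2, compA.
- now rewrite <- compA, !gmor_unit.
Defined.

Definition gp_cat : Category.
Proof.
refine {| Obj := GPObj; Hom := GPHom; heq := fun A B f g => gmor f ≈ gmor g;
          idm := gp_id; comp := gp_comp |}.
- intros A B. split.
  + intros f. reflexivity.
  + intros f g e. now symmetry.
  + intros f g h e e'. now transitivity (gmor g).
- intros A B E g g' e f f' e'. simpl. now rewrite e, e'.
- intros; apply comp_idl.
- intros; apply comp_idr.
- intros; apply compA.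
Defined.

(** The choices on which the monoidal structure of [GP(C)] depends. *)
Record GPChoice := {
  ch_sum : forall A B : GPObj, SumWithUnit (gbase A ⊗ gbase B);
  ch_tens := (fun A B => {| gsum := ch_sum A B |}) : GPObj -> GPObj -> GPObj;
  ch_c : forall A B : GPObj, Hom (ch_tens A B : C) ((A : C) ⊗ (B : C));
  ch_c_base : forall A B : GPObj, ch_c A B ∘ kbase (ch_tens A B) ≈ kbase A ⊠ kbase B;
  ch_c_unit : forall A B : GPObj,
    ch_c A B ∘ kunit (ch_tens A B) ≈ (kunit A ⊠ kunit B) ∘ rho_inv munit;
  ch_unit_sum : SumWithUnit (munit : C);
  ch_unit := {| gsum := ch_unit_sum |} : GPObj;
  ch_beta : @Hom gp_cat (ch_tens ch_unit ch_unit) ch_unit;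
  ch_beta_iso : is_iso ch_beta;
  ch_beta_base : gmor ch_beta ∘ kbase (ch_tens ch_unit ch_unit) ≈ kbase ch_unit ∘ rho munit;
  ch_beta_unit : gmor ch_beta ∘ kunit (ch_tens ch_unit ch_unit) ≈ kunit ch_unit
}.

(** The monoidal structure determined by the choices: each [<->] says that the
    morphism in question is the unique one satisfying the equation. *)
Record GPStructure (ch : GPChoice) := {
  gp_mon :> Monoidal (C := gp_cat) (ch_tens ch) (ch_unit ch);
  gp_tens_unique : forall (A A' B B' : gp_cat) (f : Hom A A') (g : Hom B B')
      (h : @Hom gp_cat (ch_tens ch A B) (ch_tens ch A' B')),
    ch_c ch A' B' ∘ gmor h ≈ (gmor f ⊠ gmor g) ∘ ch_c ch A B <-> h ≈ tens gp_mon f g;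
  gp_asc_unique : forall (A B E : GPObj)
      (h : @Hom gp_cat (ch_tens ch (ch_tens ch A B) E) (ch_tens ch A (ch_tens ch B E))),
    (idm (A : C) ⊠ ch_c ch B E) ∘ ch_c ch A (ch_tens ch B E) ∘ gmor h
    ≈ alpha (A : C) (B : C) (E : C) ∘ (ch_c ch A B ⊠ idm (E : C)) ∘ ch_c ch (ch_tens ch A B) E
    <-> h ≈ asc gp_mon A B E;
  gp_run_unique : forall (A : gp_cat) (h : @Hom gp_cat (ch_tens ch A (ch_unit ch)) A),
    tens gp_mon h (idm (ch_unit ch : gp_cat))
    ≈ tens gp_mon (idm A) (ch_beta ch) ∘ asc gp_mon A (ch_unit ch) (ch_unit ch)
    <-> h ≈ run gp_mon A;
  gp_lun_unique : forall (A : gp_cat) (h : @Hom gp_cat (ch_tens ch (ch_unit ch) A) A),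
    tens gp_mon (idm (ch_unit ch : gp_cat)) h
    ≈ tens gp_mon (ch_beta ch) (idm A) ∘ asc_inv gp_mon (ch_unit ch) (ch_unit ch) A
    <-> h ≈ lun gp_mon A
}.

Definition GP (ch : GPChoice) (S : GPStructure ch) : MonCat := {| mmon := gp_mon S |}.

Definition GP_phases (ch : GPChoice) (S : GPStructure ch) (u : scalar (GP S)) : Prop :=
  is_phase2 (kbase (ch_unit ch)) (kunit (ch_unit ch)) (gmor u).

End GP.

Arguments GP_phases {C ch} S u.

(* Main.v *)
Require Import Defs.
From Stdlib Require Import Setoid Morphisms IndefiniteDescription.
From Stdlib Require Fin.

(** Two morphisms that agree on coprojections differ by a phase of the domain, and this
    phase can be absorbed in a comparison morphism; so a family of morphisms defined up to
    phase lifts along any split monomorphism that is prescribed on coprojections.  The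
    morphism [c : A ⊗^ B -> A ⊗ B] is split by distributivity and zero arrows, hence
    everything in the monoidal structure of [GP(C)] is determined, and its axioms hold,
    after composing with [c].  The units come from [beta] as in the theory of Saavedra
    units, since [ρ (1 ⊠ ∇) c : A ⊗^ I -> A] is a natural isomorphism.

    In [GP(C)] phased coproducts become coproducts because every phase of [A ∔ B] is
    induced by a phase [u] of [I ∔ I] through [A ∔ B -> (I ∔ I) ⊗ (A ∔ B)], and tensoring
    with an object containing [I] as a summand shows that the effect of [u] is detected on
    each component [B ∔ I].  The same fact identifies the phases of [A ∔ I] with the
    multiples of the identity by global phases, so forgetting them recovers [C] through
    [A ∔ I |-> A].  Conversely [A |-> A ⊕ I] recovers [D] from [D_P], because a morphism of
    [D_P] that preserves [κ_I] has exactly one representative that does so in [D]. *)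

Set Implicit Arguments.
Unset Strict Implicit.
Unset Printing Implicit Defensive.

Open Scope cat_scope.

(** The obstacle throughout is that an extension along coprojections exists but is unique only up to
    a phase. Two hypotheses control the ambiguity. Since the phases of a biproduct are the same on
    the coproduct and on the product side, a phase can be moved across a diagonal morphism:
    [f ∘ U = V ∘ f] for some phase [V] of the target. The strong half of distributivity, that phases
    of [S ⊗ E] come from [S], is what turns a phase of [A ∔ I] into a scalar. The codiagonal [∇] of
    [I ∔ I] is itself only given up to a phase, so the isomorphisms built from it are natural but
    incoherent and cannot be taken as unitors; this is why the units go through [beta]. In the same
    spirit, strong monoidal functors are built from their comparison on tensors alone: any
    isomorphism of units can be rescaled to a coherent one, which avoids all computation with the
    unitors of [GP(C)]. *)

Lemma heq_trans (C : Category) (A B : C) (f g h : Hom A B) : f ≈ g -> g ≈ h -> f ≈ h.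
Proof. apply transitivity. Qed.

Lemma heq_sym (C : Category) (A B : C) (f g : Hom A B) : f ≈ g -> g ≈ f.
Proof. apply symmetry. Qed.

Lemma comp_pull (C : Category) (A B E X : C) (f : Hom B E) (g : Hom A B) (k : Hom A E) :
  f ∘ g ≈ k -> forall x : Hom X A, f ∘ (g ∘ x) ≈ k ∘ x.
Proof. intros e x. now rewrite compA, e. Qed.

Lemma comp_cancel (C : Category) (A B X : C) (f : Hom B A) (g : Hom A B) :
  f ∘ g ≈ idm A -> forall x : Hom X A, f ∘ (g ∘ x) ≈ x.
Proof. intros e x. now rewrite compA, e, comp_idl. Qed.

(** * Isomorphisms and split monomorphisms *)

Definition split_mono (C : Category) (A B : C) (f : Hom A B) : Prop :=
  exists r : Hom B A, r ∘ f ≈ idm A.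

Lemma split_mono_cancel (C : Category) (A B X : C) (f : Hom A B) (x y : Hom X A) :
  split_mono f -> f ∘ x ≈ f ∘ y -> x ≈ y.
Proof.
intros [r rf] e. rewrite <- (comp_idl x), <- (comp_idl y), <- rf, <- !compA.
now rewrite e.
Qed.

Lemma split_mono_comp (C : Category) (A B E : C) (g : Hom B E) (f : Hom A B) :
  split_mono g -> split_mono f -> split_mono (g ∘ f).
Proof.
intros [r rg] [s sf]. exists (s ∘ r). now rewrite <- compA, (comp_pull rg), comp_idl.
Qed.

Lemma iso_split_mono (C : Category) (A B : C) (f : Hom A B) : is_iso f -> split_mono f.
Proof. intros [g [gf _]]. now exists g. Qed.

Lemma split_mono_fmap (C D : Category) (F : Functor C D) (A B : C) (f : Hom A B) :
  split_mono f -> split_mono (fmap F f).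
Proof. intros [r rf]. exists (fmap F r). now rewrite <- fmap_comp, rf, fmap_id. Qed.

Lemma iso_id (C : Category) (A : C) : is_iso (idm A).
Proof. exists (idm A). split; apply comp_idl. Qed.

Lemma iso_comp (C : Category) (A B E : C) (g : Hom B E) (f : Hom A B) :
  is_iso g -> is_iso f -> is_iso (g ∘ f).
Proof.
intros [g' [g1 g2]] [f' [f1 f2]]. exists (f' ∘ g'). split.
- now rewrite <- compA, (comp_pull g1), comp_idl.
- now rewrite <- compA, (comp_pull f2), comp_idl.
Qed.

Lemma iso_fmap (C D : Category) (F : Functor C D) (A B : C) (f : Hom A B) :
  is_iso f -> is_iso (fmap F f).
Proof.
intros [g [e e']]. exists (fmap F g).
split; now rewrite <- fmap_comp, ?e, ?e', fmap_id.
Qed.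

(** Composites with a candidate inverse are typically known only to be phases, hence isomorphisms,
    not identities. The left inverse [l ∘ g] and the right inverse [g ∘ r] then coincide. *)
Lemma iso_of_both_composites (C : Category) (A B : C) (f : Hom A B) (g : Hom B A) :
  is_iso (f ∘ g) -> is_iso (g ∘ f) -> is_iso f.
Proof.
intros [r [_ e]] [l [e' _]].
assert (eq : l ∘ g ≈ g ∘ r).
{ rewrite <- (comp_idr (l ∘ g)), <- e, <- (comp_idl (g ∘ r)), <- e'.
  now rewrite !compA. }
exists (g ∘ r). split.
- rewrite <- eq, <- compA. exact e'.
- rewrite compA. exact e.
Qed.

Lemma iso_epi (C : Category) (A B X : C) (f : Hom A B) (x y : Hom B X) :
  is_iso f -> x ∘ f ≈ y ∘ f -> x ≈ y.
Proof.
intros [g [_ fg]] e. rewrite <- (comp_idr x), <- (comp_idr y), <- fg, !compA.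
now rewrite e.
Qed.

Lemma iso_proper (C : Category) (A B : C) (f g : Hom A B) : f ≈ g -> is_iso f -> is_iso g.
Proof. intros e [h [h1 h2]]. exists h. split; now rewrite <- e. Qed.

(** * Equivalences of categories *)

Definition full (C D : Category) (F : Functor C D) : Prop :=
  forall (A B : C) (g : Hom (F A) (F B)), exists f : Hom A B, fmap F f ≈ g.

Definition faithful (C D : Category) (F : Functor C D) : Prop :=
  forall (A B : C) (f g : Hom A B), fmap F f ≈ fmap F g -> f ≈ g.

Definition essentially_surjective (C D : Category) (F : Functor C D) : Prop :=
  forall B : D, exists (A : C) (f : Hom (F A) B), is_iso f.

(** A quasi-inverse is data, so preimages of objects and morphisms are selected by choice;
    faithfulness then reduces functoriality and naturality to identities between images. *)
Lemma equivalence_of_ff (C D : Category) (F : Functor C D) :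
  full F -> faithful F -> essentially_surjective F -> is_equivalence F.
Proof.
intros HF HF' HS.
pose (G0 := fun B : D => proj1_sig (constructive_indefinite_description _ (HS B))).
assert (eps0 : forall B : D, {e : Hom (F (G0 B)) B & {e' | inverse_pair e e'}}).
{ intros B. destruct (constructive_indefinite_description _
    (proj2_sig (constructive_indefinite_description _ (HS B)))) as [e He].
  destruct (constructive_indefinite_description _ He) as [e' He'].
  exists e. exists e'. exact He'. }
pose (eps := fun B => projT1 (eps0 B)).
pose (eps' := fun B => proj1_sig (projT2 (eps0 B))).
assert (epsP : forall B, inverse_pair (eps B) (eps' B)).
{ intros B. exact (proj2_sig (projT2 (eps0 B))). }
pose (lift := fun A B (g : Hom (F A) (F B)) =>
  proj1_sig (constructive_indefinite_description _ (HF A B g))).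
assert (liftP : forall A B (g : Hom (F A) (F B)), fmap F (lift A B g) ≈ g).
{ intros A B g. exact (proj2_sig (constructive_indefinite_description _ (HF A B g))). }
pose (Gm := fun (A B : D) (f : Hom A B) => lift (G0 A) (G0 B) (eps' B ∘ f ∘ eps A)).
assert (GmP : forall (A B : D) (f : Hom A B), fmap F (Gm A B f) ≈ eps' B ∘ f ∘ eps A).
{ intros. apply liftP. }
unshelve eexists.
{ refine {| fobj := G0; fmap := Gm |}.
  - intros A B f g e. apply HF'. now rewrite !GmP, e.
  - intros A. apply HF'. rewrite GmP, fmap_id, comp_idr. apply epsP.
  - intros A B E g f. apply HF'. rewrite fmap_comp, !GmP, <- !compA.
    now rewrite (comp_cancel (proj2 (epsP B))). }
split.
- exists (fun A => lift A (G0 (F A)) (eps' (F A))). split.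
  + intros A. exists (lift (G0 (F A)) A (eps (F A))). split; apply HF';
    rewrite fmap_comp, !liftP, fmap_id; apply epsP.
  + intros A B f. apply HF'. simpl. rewrite !fmap_comp, GmP, !liftP, <- !compA.
    rewrite (proj2 (epsP (F A))). now rewrite comp_idr.
- exists eps. split.
  + intros B. exists (eps' B). apply epsP.
  + intros A B f. simpl. rewrite GmP, <- !compA.
    now rewrite (comp_cancel (proj2 (epsP B))).
Qed.

Lemma equivalence_faithful (C D : Category) (F : Functor C D) : is_equivalence F -> faithful F.
Proof.
intros (G & (eta & etaI & etaN) & _) A B f g e.
apply (split_mono_cancel (iso_split_mono (etaI B))). now rewrite !etaN, e.
Qed.

Lemma equivalence_ess_surj (C D : Category) (F : Functor C D) :
  is_equivalence F -> essentially_surjective F.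
Proof.
intros (G & _ & (eps & epsI & _)) B. exists (G B), (eps B). apply epsI.
Qed.

(** The counit makes [G] faithful, and by naturality of [eta] the functor [G] cannot distinguish [g]
    from the image of [eta⁻¹ ∘ G g ∘ eta]. *)
Lemma equivalence_full (C D : Category) (F : Functor C D) : is_equivalence F -> full F.
Proof.
intros (G & (eta & etaI & etaN) & (eps & epsI & epsN)) A B g.
assert (GF : forall (X Y : D) (f f' : Hom X Y), fmap G f ≈ fmap G f' -> f ≈ f').
{ intros X Y f f' e. apply (iso_epi (epsI X)). now rewrite !epsN, e. }
destruct (etaI B) as [eta' [h1 h2]].
exists (eta' ∘ fmap G g ∘ eta A). apply GF.
apply (iso_epi (etaI A)). rewrite <- etaN, <- compA, (comp_cancel h2). reflexivity.
Qed.

(** * Binary phased coproducts *)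

Section BinaryPhased.
Variable C : Category.

Lemma is_phase2E (A B S : C) (kA : Hom A S) (kB : Hom B S) (U : Hom S S) :
  is_phase2 kA kB U <-> U ∘ kA ≈ kA /\ U ∘ kB ≈ kB.
Proof.
split.
- intros H. split; [exact (H true)|exact (H false)].
- intros [h h'] []; assumption.
Qed.

Lemma pcoprod2_ex (A B S : C) (kA : Hom A S) (kB : Hom B S) :
  is_phased_coproduct2 kA kB ->
  forall (X : C) (f : Hom A X) (g : Hom B X), exists h, h ∘ kA ≈ f /\ h ∘ kB ≈ g.
Proof.
intros [H _] X f g. destruct (H X (coproj2 f g)) as [h Hh].
exists h. split; [exact (Hh true)|exact (Hh false)].
Qed.

Lemma pcoprod2_uniq (A B S : C) (kA : Hom A S) (kB : Hom B S) :
  is_phased_coproduct2 kA kB ->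
  forall (X : C) (h h' : Hom S X), h ∘ kA ≈ h' ∘ kA -> h ∘ kB ≈ h' ∘ kB ->
  exists U, is_phase2 kA kB U /\ h' ≈ h ∘ U.
Proof. intros [_ H] X h h' e e'. apply H. now intros []. Qed.

Lemma pcoprod2_intro (A B S : C) (kA : Hom A S) (kB : Hom B S) :
  (forall (X : C) (f : Hom A X) (g : Hom B X), exists h, h ∘ kA ≈ f /\ h ∘ kB ≈ g) ->
  (forall (X : C) (h h' : Hom S X), h ∘ kA ≈ h' ∘ kA -> h ∘ kB ≈ h' ∘ kB ->
     exists U, U ∘ kA ≈ kA /\ U ∘ kB ≈ kB /\ h' ≈ h ∘ U) ->
  is_phased_coproduct2 kA kB.
Proof.
intros H H'. split.
- intros X f. destruct (H X (f true) (f false)) as [h [e e']].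
  exists h. now intros [].
- intros X h h' e. destruct (H' X h h' (e true) (e false)) as [U (u1 & u2 & u3)].
  exists U. split; [now apply is_phase2E|assumption].
Qed.

Lemma phase2_id (A B S : C) (kA : Hom A S) (kB : Hom B S) : is_phase2 kA kB (idm S).
Proof. apply is_phase2E. split; apply comp_idl. Qed.

(** Comparing the identity with a phase shows that every phase has a right inverse that is again a
    phase. This right inverse has one too, which must be [U]. *)
Lemma phase2_inverse (A B S : C) (kA : Hom A S) (kB : Hom B S) (U : Hom S S) :
  is_phased_coproduct2 kA kB -> is_phase2 kA kB U ->
  exists V, is_phase2 kA kB V /\ inverse_pair U V.
Proof.
intros HS HU.
assert (right : forall W, is_phase2 kA kB W -> exists V, is_phase2 kA kB V /\ idm S ≈ W ∘ V).
{ intros W HW. apply is_phase2E in HW as [w w'].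
  apply (pcoprod2_uniq HS); now rewrite comp_idl. }
destruct (right U HU) as [V [HV e]]. destruct (right V HV) as [W [HW e']].
exists V. split; [assumption|].
assert (UW : U ≈ W).
{ rewrite <- (comp_idr U), e', compA, <- e. apply comp_idl. }
split; [now rewrite UW|now symmetry].
Qed.

Lemma phase2_iso (A B S : C) (kA : Hom A S) (kB : Hom B S) (U : Hom S S) :
  is_phased_coproduct2 kA kB -> is_phase2 kA kB U -> is_iso U.
Proof. intros HS HU. destruct (phase2_inverse HS HU) as [V [_ H]]. now exists V. Qed.

(** Extending [g⁻¹] and [h⁻¹] gives a morphism backwards whose composites with [f] fix the
    coprojections: they are phases, thus invertible. *)
Lemma diag_iso (A B S A' B' S' : C) (kA : Hom A S) (kB : Hom B S) (kA' : Hom A' S')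
    (kB' : Hom B' S') (f : Hom S S') (g : Hom A A') (h : Hom B B') :
  is_phased_coproduct2 kA kB -> is_phased_coproduct2 kA' kB' ->
  f ∘ kA ≈ kA' ∘ g -> f ∘ kB ≈ kB' ∘ h -> is_iso g -> is_iso h -> is_iso f.
Proof.
intros HS HS' eA eB [g' [g1 g2]] [h' [h1 h2]].
destruct (pcoprod2_ex HS' (kA ∘ g') (kB ∘ h')) as [f' [eA' eB']].
apply (@iso_of_both_composites _ _ _ f f').
- apply (phase2_iso HS'). apply is_phase2E. split; rewrite <- compA.
  + now rewrite eA', (comp_pull eA), <- compA, g2, comp_idr.
  + now rewrite eB', (comp_pull eB), <- compA, h2, comp_idr.
- apply (phase2_iso HS). apply is_phase2E. split; rewrite <- compA.
  + now rewrite eA, (comp_pull eA'), <- compA, g1, comp_idr.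
  + now rewrite eB, (comp_pull eB'), <- compA, h1, comp_idr.
Qed.

Lemma pcoprod2_unique (A B S S' : C) (kA : Hom A S) (kB : Hom B S) (kA' : Hom A S')
    (kB' : Hom B S') :
  is_phased_coproduct2 kA kB -> is_phased_coproduct2 kA' kB' ->
  exists f : Hom S S', is_iso f /\ f ∘ kA ≈ kA' /\ f ∘ kB ≈ kB'.
Proof.
intros HS HS'. destruct (pcoprod2_ex HS kA' kB') as [f [e e']].
exists f. split; [|now split].
apply (diag_iso (f := f) (g := idm A) (h := idm B) HS HS'); rewrite ?comp_idr;
  trivial using iso_id.
Qed.

Lemma pcoprod2_transport (A B S A' B' S' : C) (kA : Hom A S) (kB : Hom B S) (kA' : Hom A' S')
    (kB' : Hom B' S') (f : Hom S S') (g : Hom A A') (h : Hom B B') :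
  is_phased_coproduct2 kA kB ->
  f ∘ kA ≈ kA' ∘ g -> f ∘ kB ≈ kB' ∘ h -> is_iso f -> is_iso g -> is_iso h ->
  is_phased_coproduct2 kA' kB'.
Proof.
intros HS eA eB [f' [f1 f2]] Hg Hh. pose proof Hg as [g' [g1 g2]]. pose proof Hh as [h' [h1 h2]].
assert (eA' : f' ∘ kA' ≈ kA ∘ g').
{ apply (iso_epi Hg). rewrite <- !compA, <- eA, (comp_cancel f1), g1. now rewrite comp_idr. }
assert (eB' : f' ∘ kB' ≈ kB ∘ h').
{ apply (iso_epi Hh). rewrite <- !compA, <- eB, (comp_cancel f1), h1. now rewrite comp_idr. }
apply pcoprod2_intro.
- intros X x y. destruct (pcoprod2_ex HS (x ∘ g) (y ∘ h)) as [t [tA tB]].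
  exists (t ∘ f'). rewrite <- !compA, eA', eB', (comp_pull tA), (comp_pull tB), <- !compA.
  now rewrite g2, h2, !comp_idr.
- intros X x y eqA eqB.
  destruct (@pcoprod2_uniq _ _ _ _ _ HS X (x ∘ f) (y ∘ f)) as [U [HU e]].
  + now rewrite <- !compA, eA, !compA, eqA.
  + now rewrite <- !compA, eB, !compA, eqB.
  + apply is_phase2E in HU as [U1 U2].
    exists (f ∘ U ∘ f'). repeat split.
    * now rewrite <- !compA, eA', (comp_pull U1), (comp_pull eA), <- compA, g2, comp_idr.
    * now rewrite <- !compA, eB', (comp_pull U2), (comp_pull eB), <- compA, h2, comp_idr.
    * rewrite !compA, <- e, <- compA, f2. now rewrite comp_idr.
Qed.

Lemma pcoprod2_proper (A B S : C) (kA kA' : Hom A S) (kB kB' : Hom B S) :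
  kA ≈ kA' -> kB ≈ kB' -> is_phased_coproduct2 kA kB -> is_phased_coproduct2 kA' kB'.
Proof.
intros e e' H.
apply (pcoprod2_transport (f := idm S) (g := idm A) (h := idm B) H);
  rewrite ?comp_idl, ?comp_idr; trivial using iso_id.
Qed.

Lemma pcoprod2_sym (A B S : C) (kA : Hom A S) (kB : Hom B S) :
  is_phased_coproduct2 kA kB -> is_phased_coproduct2 kB kA.
Proof.
intros H. apply pcoprod2_intro.
- intros X f g. destruct (pcoprod2_ex H g f) as [h [e e']]. now exists h.
- intros X h h' e e'. destruct (pcoprod2_uniq H e' e) as [U [HU e2]].
  apply is_phase2E in HU as [U1 U2]. now exists U.
Qed.

(* Two maps into [Z] agreeing on coprojections differ by a phase of the domain,
   which can be absorbed in the comparison map. *)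
Lemma pcoprod2_factor (A B S A' B' S' Z : C) (kA : Hom A S) (kB : Hom B S) (kA' : Hom A' S')
    (kB' : Hom B' S') (x : Hom S Z) (y : Hom S' Z) (g : Hom A A') (h : Hom B B') :
  is_phased_coproduct2 kA kB -> x ∘ kA ≈ y ∘ kA' ∘ g -> x ∘ kB ≈ y ∘ kB' ∘ h ->
  exists k : Hom S S', k ∘ kA ≈ kA' ∘ g /\ k ∘ kB ≈ kB' ∘ h /\ y ∘ k ≈ x.
Proof.
intros HS eA eB. destruct (pcoprod2_ex HS (kA' ∘ g) (kB' ∘ h)) as [k [e e']].
destruct (@pcoprod2_uniq _ _ _ _ _ HS Z (y ∘ k) x) as [U [HU e2]].
- now rewrite eA, <- compA, e, compA.
- now rewrite eB, <- compA, e', compA.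
- apply is_phase2E in HU as [U1 U2]. exists (k ∘ U).
  rewrite <- !compA, U1, U2, compA. repeat split; trivial. now symmetry.
Qed.

End BinaryPhased.

(** Phased coproducts of the same pair are isomorphic compatibly with coprojections, and conjugation
    by the isomorphism carries phases to phases. So strong preservation can be tested on one
    convenient sum for each pair. *)
Lemma strongly_preserves_of_one (C D : Category) (F : Functor C D) :
  (forall A B : C, exists (S : C) (kA : Hom A S) (kB : Hom B S),
     is_phased_coproduct2 kA kB /\ is_phased_coproduct2 (fmap F kA) (fmap F kB) /\
     forall V : Hom (F S) (F S), is_phase2 (fmap F kA) (fmap F kB) V ->
       exists U : Hom S S, is_phase2 kA kB U /\ V ≈ fmap F U) ->
  strongly_preserves_phased_coproducts F.
Proof.
intros H A B S' kA' kB' HS'.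
destruct (H A B) as (S & kA & kB & HS & HFS & HV).
destruct (pcoprod2_unique HS HS') as (f & [f' [f1 f2]] & eA & eB).
assert (eA' : f' ∘ kA' ≈ kA) by now rewrite <- eA, (comp_cancel f1).
assert (eB' : f' ∘ kB' ≈ kB) by now rewrite <- eB, (comp_cancel f1).
split.
- apply (pcoprod2_transport (f := fmap F f) (g := idm _) (h := idm _) HFS);
    rewrite ?comp_idr, <- ?fmap_comp, ?eA, ?eB; try reflexivity; try apply iso_id.
  apply iso_fmap. now exists f'.
- intros V HVp. apply is_phase2E in HVp as [V1 V2].
  destruct (HV (fmap F f' ∘ V ∘ fmap F f)) as (U & HU & e).
  + apply is_phase2E. split; rewrite <- !compA, <- fmap_comp.
    * now rewrite eA, V1, <- fmap_comp, eA'.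
    * now rewrite eB, V2, <- fmap_comp, eB'.
  + apply is_phase2E in HU as [U1 U2]. exists (f ∘ U ∘ f'). split.
    * apply is_phase2E.
      now rewrite <- !compA, eA', eB', U1, U2.
    * rewrite !fmap_comp, <- e, <- !compA, <- fmap_comp, f2, fmap_id, comp_idr.
      now rewrite compA, <- fmap_comp, f2, fmap_id, comp_idl.
Qed.

(** * Monoidal categories *)

Definition alpha_inv (M : MonCat) (A B E : M) : Hom (A ⊗ (B ⊗ E)) (A ⊗ B ⊗ E) :=
  asc_inv (mmon M) A B E.

Section MonoidalFacts.
Variable M : MonCat.
Implicit Types A B E X Y : M.

Lemma tensM A A' A'' B B' B'' (g : Hom A' A'') (f : Hom A A') (k : Hom B' B'') (h : Hom B B') :
  (g ⊠ k) ∘ (f ⊠ h) ≈ (g ∘ f) ⊠ (k ∘ h).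
Proof. symmetry. apply tens_comp. Qed.

Lemma tens_cong A A' B B' (f f' : Hom A A') (g g' : Hom B B') :
  f ≈ f' -> g ≈ g' -> f ⊠ g ≈ f' ⊠ g'.
Proof. intros e e'. now rewrite e, e'. Qed.

Lemma alphaK A B E : alpha_inv A B E ∘ alpha A B E ≈ idm _.
Proof. apply (asc_iso (mmon M)). Qed.

Lemma alpha_invK A B E : alpha A B E ∘ alpha_inv A B E ≈ idm _.
Proof. apply (asc_iso (mmon M)). Qed.

Lemma lamK A : lam_inv A ∘ lam A ≈ idm _.
Proof. apply (lun_iso (mmon M)). Qed.

Lemma lam_invK A : lam A ∘ lam_inv A ≈ idm _.
Proof. apply (lun_iso (mmon M)). Qed.

Lemma rhoK A : rho_inv A ∘ rho A ≈ idm _.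
Proof. apply (run_iso (mmon M)). Qed.

Lemma rho_invK A : rho A ∘ rho_inv A ≈ idm _.
Proof. apply (run_iso (mmon M)). Qed.

Lemma lam_iso A : is_iso (lam A).
Proof. exists (lam_inv A). split; [apply lamK|apply lam_invK]. Qed.

Lemma rho_iso A : is_iso (rho A).
Proof. exists (rho_inv A). split; [apply rhoK|apply rho_invK]. Qed.

Lemma alpha_iso A B E : is_iso (alpha A B E).
Proof. exists (alpha_inv A B E). split; [apply alphaK|apply alpha_invK]. Qed.

Lemma alpha_natural A A' B B' E E' (f : Hom A A') (g : Hom B B') (h : Hom E E') :
  alpha A' B' E' ∘ (f ⊠ g ⊠ h) ≈ (f ⊠ (g ⊠ h)) ∘ alpha A B E.
Proof. apply asc_nat. Qed.

Lemma lam_natural A B (f : Hom A B) : lam B ∘ (idm munit ⊠ f) ≈ f ∘ lam A.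
Proof. apply lun_nat. Qed.

Lemma rho_natural A B (f : Hom A B) : rho B ∘ (f ⊠ idm munit) ≈ f ∘ rho A.
Proof. apply run_nat. Qed.

Lemma lam_inv_natural A B (f : Hom A B) : lam_inv B ∘ f ≈ (idm munit ⊠ f) ∘ lam_inv A.
Proof.
apply (split_mono_cancel (iso_split_mono (lam_iso B))).
rewrite (comp_cancel (lam_invK B)), (comp_pull (lam_natural f)), <- compA, lam_invK.
now rewrite comp_idr.
Qed.

Lemma rho_inv_natural A B (f : Hom A B) : rho_inv B ∘ f ≈ (f ⊠ idm munit) ∘ rho_inv A.
Proof.
apply (split_mono_cancel (iso_split_mono (rho_iso B))).
rewrite (comp_cancel (rho_invK B)), (comp_pull (rho_natural f)), <- compA, rho_invK.
now rewrite comp_idr.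
Qed.

Lemma tens_unitl_faithful A B (f g : Hom A B) :
  (idm munit : Hom (munit : M) munit) ⊠ f ≈ idm munit ⊠ g -> f ≈ g.
Proof.
intros e. apply (iso_epi (lam_iso A)). now rewrite <- !lam_natural, e.
Qed.

Lemma tens_unitr_faithful A B (f g : Hom A B) :
  f ⊠ (idm munit : Hom (munit : M) munit) ≈ g ⊠ idm munit -> f ≈ g.
Proof.
intros e. apply (iso_epi (rho_iso A)). now rewrite <- !rho_natural, e.
Qed.

Lemma triangle_alpha A B : (idm A ⊠ lam B) ∘ alpha A munit B ≈ rho A ⊠ idm B.
Proof. apply triangle. Qed.

Lemma pentagon_alpha A B E G :
  alpha A B (E ⊗ G) ∘ alpha (A ⊗ B) E G
  ≈ (idm A ⊠ alpha B E G) ∘ alpha A (B ⊗ E) G ∘ (alpha A B E ⊠ idm G).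
Proof. apply pentagon. Qed.

Lemma lam_tens_unit A : lam (munit ⊗ A) ≈ idm munit ⊠ lam A.
Proof. apply (split_mono_cancel (iso_split_mono (lam_iso A))). now rewrite lam_natural. Qed.

(** Tensored with the unit, both sides become [lam ∘ alpha]: [rho] by the triangle and
    [lam_tens_unit], [lam] by Kelly's [lam_tens]. *)
Lemma lam_rho_unit : lam (munit : M) ≈ rho munit.
Proof.
apply tens_unitr_faithful.
now rewrite <- triangle_alpha, <- lam_tens, lam_tens_unit.
Qed.

Lemma lam_rho_inv_unit : lam_inv (munit : M) ≈ rho_inv munit.
Proof.
apply (split_mono_cancel (iso_split_mono (rho_iso munit))).
rewrite <- lam_rho_unit at 1. now rewrite lam_invK, rho_invK.
Qed.

Lemma iso_tens A A' B B' (f : Hom A A') (g : Hom B B') :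
  is_iso f -> is_iso g -> is_iso (f ⊠ g).
Proof.
intros [f' [f1 f2]] [g' [g1 g2]]. exists (f' ⊠ g').
split; now rewrite tensM, ?f1, ?g1, ?f2, ?g2, tens_id.
Qed.

Lemma split_mono_tens A A' B B' (f : Hom A A') (g : Hom B B') :
  split_mono f -> split_mono g -> split_mono (f ⊠ g).
Proof.
intros [f' f1] [g' g1]. exists (f' ⊠ g'). now rewrite tensM, f1, g1, tens_id.
Qed.

#[global] Instance lscale_proper (s : scalar M) A B : Proper (@heq M A B ==> @heq M A B) (@lscale M s A B).
Proof. intros f g e. now apply lscale_ext. Qed.

Lemma lscale_comp_idl (s : scalar M) A B (f : Hom A B) : lscale s f ≈ f ∘ lscale s (idm A).
Proof.
unfold lscale. rewrite !compA, <- lam_natural, <- (compA (lam B) (idm munit ⊠ f)), tensM.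
now rewrite comp_idl, comp_idr.
Qed.

Lemma rscale_comp_idr (s : scalar M) A B (f : Hom A B) : rscale f s ≈ rscale (idm B) s ∘ f.
Proof.
unfold rscale. rewrite <- !compA, rho_inv_natural, (comp_pull (tensM _ _ _ _)).
now rewrite comp_idl, comp_idr.
Qed.

Lemma rscale_comp_idl (s : scalar M) A B (f : Hom A B) : rscale f s ≈ f ∘ rscale (idm A) s.
Proof.
unfold rscale. rewrite !compA, <- rho_natural, <- (compA (rho B) (f ⊠ idm munit)), tensM.
now rewrite comp_idl, comp_idr.
Qed.

Lemma lscale_unit (s : scalar M) : lscale s (idm munit) ≈ s.
Proof.
unfold lscale. rewrite lam_rho_unit, lam_rho_inv_unit, rho_natural, <- compA, rho_invK.
apply comp_idr.
Qed.

Lemma rscale_unit (s : scalar M) : rscale (idm munit) s ≈ s.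
Proof.
unfold rscale. rewrite <- lam_rho_unit, <- lam_rho_inv_unit, lam_natural, <- compA, lam_invK.
apply comp_idr.
Qed.

Lemma lscale_comp_l (s : scalar M) A B E (g : Hom B E) (f : Hom A B) :
  lscale s g ∘ f ≈ lscale s (g ∘ f).
Proof. now rewrite lscaleE, (lscaleE s (g ∘ f)), compA. Qed.

Lemma lscale_comp_r (s : scalar M) A B E (g : Hom B E) (f : Hom A B) :
  g ∘ lscale s f ≈ lscale s (g ∘ f).
Proof. now rewrite lscale_comp_idl, (lscale_comp_idl s (g ∘ f)), compA. Qed.

(** The map [y] placed on the summand of [J ⊗ Y] selected by [k]. *)
Definition ins (J X Y : M) (k : Hom munit J) (y : Hom X Y) : Hom X (J ⊗ Y) :=
  (k ⊠ y) ∘ lam_inv X.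

#[global] Instance ins_proper (J X Y : M) :
  Proper (@heq M munit J ==> @heq M X Y ==> @heq M X (J ⊗ Y)) (@ins J X Y).
Proof. intros k k' e y y' e'. unfold ins. now rewrite e, e'. Qed.

Lemma ins_comp (J : M) (k : Hom munit J) X Y Z (y : Hom Y Z) (z : Hom X Y) :
  ins k y ∘ z ≈ ins k (y ∘ z).
Proof.
unfold ins. now rewrite <- compA, lam_inv_natural, compA, tensM, comp_idr.
Qed.

Lemma tens_ins (J J' : M) (k : Hom munit J) (u : Hom J J') X Y Z (w : Hom Y Z) (y : Hom X Y) :
  (u ⊠ w) ∘ ins k y ≈ ins (u ∘ k) (w ∘ y).
Proof. unfold ins. now rewrite compA, tensM. Qed.

Lemma alpha_ins (J : M) (k : Hom munit J) X Y Z W (y : Hom X Y) (z : Hom Z W) :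
  alpha J Y W ∘ (ins k y ⊠ z) ≈ ins k (y ⊠ z).
Proof.
unfold ins.
rewrite <- (comp_idr z) at 1. rewrite <- tensM, compA, alpha_natural, <- compA.
apply comp_proper; [reflexivity|].
apply (split_mono_cancel (iso_split_mono (lam_iso _))).
rewrite lam_invK, compA, lam_tens, tensM, lam_invK, comp_idr. apply tens_id.
Qed.

Lemma lam_ins (k : Hom (munit : M) munit) X Y (y : Hom X Y) :
  k ≈ idm munit -> lam Y ∘ ins k y ≈ y.
Proof.
intros e. unfold ins. rewrite e, compA, lam_natural, <- compA, lam_invK. apply comp_idr.
Qed.

End MonoidalFacts.

(** * Units from cancellable pseudo-idempotents *)

(* No coherence is asked of the natural isomorphisms [jr : X ⊗ I ≅ X] and
   [jl : I ⊗ X ≅ X]: they only make [- ⊗ I] and [I ⊗ -] fully faithful, so that [beta]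
   determines unitors, in the sense of Saavedra Rivano and Kock. *)

Section SaavedraUnit.
Variables (C : Category) (T : C -> C -> C) (I : C).
Variable tn : forall A A' B B' : C, Hom A A' -> Hom B B' -> Hom (T A B) (T A' B').
Variables (al : forall A B E : C, Hom (T (T A B) E) (T A (T B E)))
          (al' : forall A B E : C, Hom (T A (T B E)) (T (T A B) E)).
Hypothesis tn_proper : forall A A' B B' : C,
  Proper (@heq C A A' ==> @heq C B B' ==> @heq C (T A B) (T A' B')) (@tn A A' B B').
Hypothesis tn_id : forall A B : C, tn (idm A) (idm B) ≈ idm (T A B).
Hypothesis tn_comp : forall (A A' A'' B B' B'' : C)
    (g : Hom A' A'') (f : Hom A A') (k : Hom B' B'') (h : Hom B B'),
  tn (g ∘ f) (k ∘ h) ≈ tn g k ∘ tn f h.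
Hypothesis al_iso : forall A B E : C, inverse_pair (al A B E) (al' A B E).
Hypothesis al_nat : forall (A A' B B' E E' : C) (f : Hom A A') (g : Hom B B') (h : Hom E E'),
  al A' B' E' ∘ tn (tn f g) h ≈ tn f (tn g h) ∘ al A B E.
Hypothesis al_pentagon : forall A B E G : C,
  al A B (T E G) ∘ al (T A B) E G
  ≈ tn (idm A) (al B E G) ∘ al A (T B E) G ∘ tn (al A B E) (idm G).
Variables (beta : Hom (T I I) I) (beta' : Hom I (T I I)).
Hypothesis beta_iso : inverse_pair beta beta'.
Variables (jr : forall A, Hom (T A I) A) (jr' : forall A, Hom A (T A I))
          (jl : forall A, Hom (T I A) A) (jl' : forall A, Hom A (T I A)).
Hypothesis jr_iso : forall A, inverse_pair (jr A) (jr' A).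
Hypothesis jl_iso : forall A, inverse_pair (jl A) (jl' A).
Hypothesis jr_nat : forall A B (f : Hom A B), jr B ∘ tn f (idm I) ≈ f ∘ jr A.
Hypothesis jl_nat : forall A B (f : Hom A B), jl B ∘ tn (idm I) f ≈ f ∘ jl A.

#[local] Existing Instance tn_proper.

Let tnM A A' A'' B B' B'' (g : Hom A' A'') (f : Hom A A') (k : Hom B' B'') (h : Hom B B') :
  tn g k ∘ tn f h ≈ tn (g ∘ f) (k ∘ h).
Proof. symmetry. apply tn_comp. Qed.

Let jr_full A B (m : Hom (T A I) (T B I)) : tn (jr B ∘ m ∘ jr' A) (idm I) ≈ m.
Proof.
apply (split_mono_cancel (iso_split_mono (ex_intro _ _ (jr_iso B)))).
rewrite jr_nat, <- compA, (proj1 (jr_iso A)). apply comp_idr.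
Qed.

Let jl_full A B (m : Hom (T I A) (T I B)) : tn (idm I) (jl B ∘ m ∘ jl' A) ≈ m.
Proof.
apply (split_mono_cancel (iso_split_mono (ex_intro _ _ (jl_iso B)))).
rewrite jl_nat, <- compA, (proj1 (jl_iso A)). apply comp_idr.
Qed.

Let jr_faithful A B (f g : Hom A B) : tn f (idm I) ≈ tn g (idm I) -> f ≈ g.
Proof.
intros e. apply (iso_epi (ex_intro _ _ (jr_iso A))). now rewrite <- !jr_nat, e.
Qed.

Let jl_faithful A B (f g : Hom A B) : tn (idm I) f ≈ tn (idm I) g -> f ≈ g.
Proof.
intros e. apply (iso_epi (ex_intro _ _ (jl_iso A))). now rewrite <- !jl_nat, e.
Qed.

(** Naturality of [jr] makes [jr B ∘ m ∘ jr' A] the preimage of [m] under [- ⊗ I]. So [rn A] is the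
    only candidate for the right unitor of Saavedra, characterised by [rnE]; [ln] is its mirror
    image. *)
Let rn A : Hom (T A I) A := jr A ∘ (tn (idm A) beta ∘ al A I I) ∘ jr' (T A I).
Let rn' A : Hom A (T A I) := jr (T A I) ∘ (al' A I I ∘ tn (idm A) beta') ∘ jr' A.
Let ln A : Hom (T I A) A := jl A ∘ (tn beta (idm A) ∘ al' I I A) ∘ jl' (T I A).
Let ln' A : Hom A (T I A) := jl (T I A) ∘ (al I I A ∘ tn beta' (idm A)) ∘ jl' A.

Let rnE A : tn (rn A) (idm I) ≈ tn (idm A) beta ∘ al A I I.
Proof. apply jr_full. Qed.

Let lnE A : tn (idm I) (ln A) ≈ tn beta (idm A) ∘ al' I I A.
Proof. apply jl_full. Qed.

Let conj_inverse (X Y X' Y' : C) (j : Hom X X') (j' : Hom X' X) (l : Hom Y Y') (l' : Hom Y' Y)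
    (m : Hom X Y) (m' : Hom Y X) :
  inverse_pair j j' -> inverse_pair l l' -> inverse_pair m m' ->
  inverse_pair (l ∘ m ∘ j') (j ∘ m' ∘ l').
Proof.
intros [j1 j2] [l1 l2] [m1 m2]. split; rewrite <- !compA.
- rewrite (comp_cancel l1), (comp_cancel m1). exact j2.
- rewrite (comp_cancel j1), (comp_cancel m2). exact l2.
Qed.

Let rn_iso A : inverse_pair (rn A) (rn' A).
Proof.
apply conj_inverse; try apply jr_iso. destruct (al_iso A I I) as [a1 a2].
split; rewrite <- compA.
- rewrite (compA (tn _ _) (tn _ _)), tnM, comp_idl, (proj1 beta_iso), tn_id, comp_idl.
  exact a1.
- rewrite (comp_cancel a2), tnM, comp_idl, (proj2 beta_iso). apply tn_id.
Qed.

Let ln_iso A : inverse_pair (ln A) (ln' A).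
Proof.
apply conj_inverse; try apply jl_iso. destruct (al_iso I I A) as [a1 a2].
split; rewrite <- compA.
- rewrite (compA (tn _ _) (tn _ _)), tnM, comp_idl, (proj1 beta_iso), tn_id, comp_idl.
  exact a2.
- rewrite (comp_cancel a1), tnM, comp_idl, (proj2 beta_iso). apply tn_id.
Qed.

Let al'_nat (A A' B B' E E' : C) (f : Hom A A') (g : Hom B B') (h : Hom E E') :
  tn (tn f g) h ∘ al' A B E ≈ al' A' B' E' ∘ tn f (tn g h).
Proof.
apply (split_mono_cancel (iso_split_mono (ex_intro _ _ (al_iso A' B' E')))).
rewrite (comp_pull (al_nat f g h)), <- compA, (proj2 (al_iso A B E)), comp_idr.
now rewrite (comp_cancel (proj2 (al_iso A' B' E'))).
Qed.

Let rn_nat A B (f : Hom A B) : rn B ∘ tn f (idm I) ≈ f ∘ rn A.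
Proof.
apply jr_faithful.
rewrite <- (comp_idl (idm I)).
rewrite !tn_comp, (comp_idl (idm I)), !rnE, <- compA, al_nat, !compA, !tnM, tn_id.
now rewrite !comp_idl, !comp_idr.
Qed.

Let ln_nat A B (f : Hom A B) : ln B ∘ tn (idm I) f ≈ f ∘ ln A.
Proof.
apply jl_faithful.
rewrite <- (comp_idl (idm I)).
rewrite !tn_comp, (comp_idl (idm I)), !lnE, <- compA, <- al'_nat, !compA, !tnM, tn_id.
now rewrite !comp_idl, !comp_idr.
Qed.

(* [rn A] and [ln B] on [(A I) (I B)] both equal [beta] in the middle; the
   interchange law for [rn A] and [ln B] then gives the triangle. *)
Let rn_ln_triangle A B : tn (idm A) (ln B) ∘ al A I B ≈ tn (rn A) (idm B).
Proof.
pose (K := tn (idm A) (tn beta (idm B) ∘ al' I I B) ∘ al A I (T I B)).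
assert (K1 : al A I B ∘ tn (idm (T A I)) (ln B) ≈ K).
{ unfold K. now rewrite <- lnE, <- al_nat, tn_id. }
assert (K2 : tn (rn A) (idm (T I B)) ≈ K).
{ apply (iso_epi (ex_intro _ _ (al_iso (T A I) I B))).
  unfold K. rewrite <- tn_id, <- al_nat, rnE.
  rewrite <- (compA _ (al A I (T I B))), al_pentagon, !compA, tnM, comp_idl.
  rewrite <- (compA (tn beta (idm B))), (proj1 (al_iso I I B)), comp_idr.
  rewrite <- al_nat, <- !compA. apply comp_proper; [reflexivity|].
  now rewrite tnM, comp_idl. }
assert (HK : is_iso K).
{ apply (iso_proper K1). apply iso_comp.
  - exists (al' A I B). apply al_iso.
  - exists (tn (idm _) (ln' B)).
    split; rewrite tnM, comp_idl, ?(proj1 (ln_iso B)), ?(proj2 (ln_iso B)); apply tn_id. }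
apply (iso_epi (f := tn (idm (T A I)) (ln B))).
{ exists (tn (idm _) (ln' B)).
  split; rewrite tnM, comp_idl, ?(proj1 (ln_iso B)), ?(proj2 (ln_iso B)); apply tn_id. }
rewrite <- compA, K1, <- K2, !tnM. now rewrite !comp_idl, !comp_idr.
Qed.

Lemma saavedra_unit : exists m : Monoidal T I,
  (forall A A' B B' (f : Hom A A') (g : Hom B B'), tens m f g = tn f g) /\
  (forall A B E, asc m A B E = al A B E) /\
  (forall A B E, asc_inv m A B E = al' A B E) /\
  (forall A (h : Hom (T A I) A), tn h (idm I) ≈ tn (idm A) beta ∘ al A I I <-> h ≈ run m A) /\
  (forall A (h : Hom (T I A) A), tn (idm I) h ≈ tn beta (idm A) ∘ al' I I A <-> h ≈ lun m A).
Proof.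
unshelve eexists.
{ exact (@Build_Monoidal C T I tn al al' ln ln' rn rn' tn_proper tn_id tn_comp al_iso ln_iso
    rn_iso al_nat ln_nat rn_nat rn_ln_triangle al_pentagon). }
split; [reflexivity|]. split; [reflexivity|]. split; [reflexivity|].
cbn [run lun]. split; intros A h; split; intros e.
- apply jr_faithful. now rewrite e, rnE.
- now rewrite e, rnE.
- apply jl_faithful. now rewrite e, lnE.
- now rewrite e, lnE.
Qed.

End SaavedraUnit.

(** * Strong monoidal functors *)

Section MonoidalFunctors.
Variables (M N : MonCat) (F : Functor M N).
Variable m : forall A B : M, Hom (F A ⊗ F B) (F (A ⊗ B)).
Hypothesis m_iso : forall A B, is_iso (m A B).
Hypothesis m_nat : forall (A A' B B' : M) (f : Hom A A') (g : Hom B B'),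
  m A' B' ∘ (fmap F f ⊠ fmap F g) ≈ fmap F (f ⊠ g) ∘ m A B.
Hypothesis m_assoc : forall A B E : M,
  fmap F (alpha A B E) ∘ m (A ⊗ B) E ∘ (m A B ⊠ idm (F E))
  ≈ m A (B ⊗ E) ∘ (idm (F A) ⊠ m B E) ∘ alpha (F A) (F B) (F E).

Section Unit.
Variables (w : Hom munit (F munit)) (w' : Hom (F munit) munit).
Hypothesis w_iso : inverse_pair w w'.
Hypothesis w_unit : fmap F (lam munit) ∘ m munit munit ∘ (w ⊠ w) ≈ w ∘ lam munit.

Let Hw : is_iso w := ex_intro _ _ w_iso.

(** The single law [w_unit] at the unit object suffices. After tensoring with the unit and applying
    the invertible [m ∘ (w ⊠ 1)], associativity of [m] brings two copies of [w] together, where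
    [w_unit] applies. *)
Let unit_lam A : fmap F (lam A) ∘ m munit A ∘ (w ⊠ idm (F A)) ≈ lam (F A).
Proof.
apply tens_unitl_faithful.
apply (split_mono_cancel (f := m munit A ∘ (w ⊠ idm (F A)))).
{ apply iso_split_mono, iso_comp; [apply m_iso|]. apply iso_tens; [exact Hw|apply iso_id]. }
apply (iso_epi (alpha_iso munit munit (F A))).
set (t := fmap F (lam A) ∘ m munit A ∘ (w ⊠ idm (F A))).
assert (el : (w ⊠ idm (F A)) ∘ (idm munit ⊠ t) ≈ w ⊠ t) by now rewrite tensM, comp_idr, comp_idl.
assert (er : (w ⊠ idm (F A)) ∘ (rho munit ⊠ idm (F A)) ≈ (w ∘ lam munit) ⊠ idm (F A))
  by now rewrite tensM, comp_idl, lam_rho_unit.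
rewrite <- !compA, triangle_alpha, er, (comp_pull el).
transitivity (m munit A ∘ (idm (F munit) ⊠ fmap F (lam A)) ∘ (idm (F munit) ⊠ m munit A)
  ∘ (w ⊠ (w ⊠ idm (F A))) ∘ alpha munit munit (F A)).
{ rewrite <- !compA. apply comp_proper; [reflexivity|]. unfold t.
  rewrite !compA, !tensM, !comp_idl. reflexivity. }
rewrite <- (fmap_id F) at 1. rewrite m_nat, <- !compA, <- alpha_natural.
rewrite (compA (idm _ ⊠ m _ _)), (compA (m _ _)), (compA (m _ _)), <- m_assoc.
rewrite !compA, <- fmap_comp, triangle_alpha, <- lam_rho_unit.
rewrite <- m_nat, fmap_id, <- !compA, !tensM, !comp_idl.
now rewrite compA, w_unit.
Qed.

Let unit_rho A : fmap F (rho A) ∘ m A munit ∘ (idm (F A) ⊠ w) ≈ rho (F A).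
Proof.
apply tens_unitr_faithful.
apply (split_mono_cancel (f := m A munit ∘ (idm (F A) ⊠ w))).
{ apply iso_split_mono, iso_comp; [apply m_iso|]. apply iso_tens; [apply iso_id|exact Hw]. }
set (t := fmap F (rho A) ∘ m A munit ∘ (idm (F A) ⊠ w)).
assert (el : (idm (F A) ⊠ w) ∘ (t ⊠ idm munit) ≈ t ⊠ w) by now rewrite tensM, comp_idr, comp_idl.
assert (er : (idm (F A) ⊠ w) ∘ (idm (F A) ⊠ lam munit) ≈ idm (F A) ⊠ (w ∘ lam munit))
  by now rewrite tensM, comp_idl.
rewrite <- triangle_alpha, <- !compA, (comp_pull er), el.
transitivity (m A munit ∘ (fmap F (rho A) ⊠ fmap F (idm munit)) ∘ (m A munit ⊠ idm _)
  ∘ ((idm (F A) ⊠ w) ⊠ w)).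
{ rewrite <- !compA. apply comp_proper; [reflexivity|]. unfold t.
  rewrite fmap_id, !tensM, !comp_idl, compA. reflexivity. }
rewrite m_nat, <- triangle_alpha, fmap_comp, <- !compA.
rewrite (compA (m _ _) (_ ⊠ _)), (compA (fmap F (alpha _ _ _))), (compA (fmap F (alpha _ _ _))).
rewrite m_assoc, <- !compA, alpha_natural, !compA, <- m_nat, fmap_id, <- !compA.
apply comp_proper; [reflexivity|].
rewrite !compA, !tensM, !comp_idl.
now rewrite w_unit.
Qed.

Definition monfunctor_of_unit : MonFunctor M N :=
  {| mfun := F; mu_iso := m_iso; ups_iso := w_iso; mu_nat := m_nat; mu_assoc := m_assoc;
     mu_lam := unit_lam; mu_rho := unit_rho |}.

End Unit.

(* An arbitrary isomorphism [v : I -> F I] satisfies the unit law up to an invertible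
   scalar [x]; dividing [v] by [x] repairs it. *)
Lemma monfunctor_of_semi :
  (exists v : Hom munit (F munit), is_iso v) -> exists G : MonFunctor M N, mfun G = F.
Proof.
intros (v & v' & v1 & v2).
pose (x := v' ∘ (fmap F (lam munit) ∘ m munit munit ∘ (v ⊠ v)) ∘ lam_inv munit : scalar N).
assert (Hx : is_iso x).
{ apply iso_comp; [apply iso_comp|].
  - exists v. now split.
  - apply iso_comp; [apply iso_comp|].
    + apply iso_fmap, lam_iso.
    + apply m_iso.
    + apply iso_tens; now exists v'.
  - exists (lam munit). split; [apply lam_invK|apply lamK]. }
destruct Hx as (y & xy & yx).
assert (e : fmap F (lam munit) ∘ m munit munit ∘ (v ⊠ v) ≈ v ∘ x ∘ lam munit).
{ unfold x. rewrite <- !compA, lamK, comp_idr. now rewrite (comp_cancel v2). }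
unshelve eexists (@monfunctor_of_unit (v ∘ y) (x ∘ v') _ _); [| |reflexivity].
- split; rewrite <- compA.
  + now rewrite (comp_cancel v1).
  + now rewrite (comp_cancel xy).
(* The corrected unit [v ∘ y] occurs twice in the law and contributes [y] twice: one factor cancels
   [x], the other stays on the right-hand side. *)
- assert (ey : lam munit ∘ (y ⊠ y) ≈ y ∘ (y ∘ lam (munit : N))).
  { transitivity (lam munit ∘ ((idm munit ⊠ y) ∘ (y ⊠ idm munit))).
    { now rewrite tensM, comp_idl, comp_idr. }
    rewrite (comp_pull (lam_natural _)), <- compA, lam_rho_unit. now rewrite rho_natural. }
  rewrite <- tensM, compA, e, <- !compA, ey.
  now rewrite (comp_cancel yx).
Qed.

End MonoidalFunctors.

(** * Binary phased biproducts *)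

(** Bridge from the finite biproducts of the hypotheses, indexed by [Fin.t n], to the binary sums,
    indexed by [bool]. *)
Definition fin2 (C : Type) (A B : C) (i : Fin.t 2) : C := Fin.caseS' i (fun _ => C) A (fun _ => B).

Definition fin2_rect (C : Type) (A B : C) (P : forall X : C, Type) (f : P A) (g : P B) (i : Fin.t 2) :
  P (fin2 A B i) :=
  Fin.caseS' i (fun i => P (fin2 A B i)) f
    (fun j => Fin.caseS' j (fun j => P (fin2 A B (Fin.FS j))) g
      (fun l => Fin.case0 (fun l => P (fin2 A B (Fin.FS (Fin.FS l)))) l)).

Lemma fin2_ind (P : Fin.t 2 -> Prop) : P Fin.F1 -> P (Fin.FS Fin.F1) -> forall i, P i.
Proof.
intros p q i. pattern i. apply (Fin.caseS' i); [exact p|].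
intros j. pattern j. apply (Fin.caseS' j); [exact q|]. intros l. now apply Fin.case0.
Qed.

Section PhasedBiproducts.
Variables (C : Category) (zero : forall A B : C, Hom A B).

(** The product half of a phased biproduct on a given cospan. Its uniqueness clause already speaks
    of coproduct phases; applied to the identity and a product phase, it shows that the latter is a
    coproduct phase, so both inclusions between the two kinds of phases are encoded. *)
Record biprod2 (A B S : C) (kA : Hom A S) (kB : Hom B S) (pA : Hom S A) (pB : Hom S B) : Prop := {
  bip_AA : pA ∘ kA ≈ idm A;
  bip_AB : pA ∘ kB ≈ zero B A;
  bip_BA : pB ∘ kA ≈ zero A B;
  bip_BB : pB ∘ kB ≈ idm B;
  bip_phase : forall U, is_phase2 kA kB U -> pA ∘ U ≈ pA /\ pB ∘ U ≈ pB;
  bip_pair : forall (X : C) (f : Hom X A) (g : Hom X B), exists h, pA ∘ h ≈ f /\ pB ∘ h ≈ g;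
  bip_uniq : forall (X : C) (h h' : Hom X S), pA ∘ h ≈ pA ∘ h' -> pB ∘ h ≈ pB ∘ h' ->
    exists U, is_phase2 kA kB U /\ h' ≈ U ∘ h
}.

Hypothesis zeroP : is_zero_arrows zero.

Lemma zero_l (A B E : C) (f : Hom A B) : zero B E ∘ f ≈ zero A E.
Proof. apply zeroP. Qed.

Lemma zero_r (A B E : C) (f : Hom B E) : f ∘ zero A B ≈ zero A E.
Proof. apply zeroP. Qed.

Hypothesis bipP : forall (n : nat) (X : Fin.t n -> C),
  exists (A : C) (kappa : forall i, Hom (X i) A) (pi : forall i, Hom A (X i)),
    is_phased_biproduct zero kappa pi.

Lemma biprod2_ex (A B : C) : exists (S : C) (kA : Hom A S) (kB : Hom B S) pA pB,
  is_phased_coproduct2 kA kB /\ biprod2 kA kB pA pB.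
Proof.
destruct (bipP (fin2 A B)) as (S & k & p & b1 & b2 & [b3 b3'] & [b4 b4'] & b5).
pose (F1 := Fin.F1 : Fin.t 2). pose (F2 := Fin.FS Fin.F1 : Fin.t 2).
exists S, (k F1), (k F2), (p F1), (p F2).
assert (ph : forall U, is_phase2 (k F1) (k F2) U <-> is_phase k U).
{ intros U. rewrite is_phase2E. split.
  - intros [u u'] i. revert i. now apply fin2_ind.
  - intros H. split; apply H. }
split; [|split].
- apply pcoprod2_intro.
  + intros X f g. destruct (b3 X (fin2_rect (P := fun Y => Hom Y X) f g)) as [h Hh].
    exists h. split; [exact (Hh F1)|exact (Hh F2)].
  + intros X h h' e e'. destruct (b3' X h h') as [U [HU eU]].
    { now apply fin2_ind. }
    exists U. split; [exact (HU F1)|]. split; [exact (HU F2)|assumption].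
- exact (b1 F1).
- now apply (b2 F1 F2).
- now apply (b2 F2 F1).
- exact (b1 F2).
- intros U HU. apply ph, b5 in HU. split; [exact (HU F1)|exact (HU F2)].
- intros X f g. destruct (b4 X (fin2_rect (P := fun Y => Hom X Y) f g)) as [h Hh].
  exists h. split; [exact (Hh F1)|exact (Hh F2)].
- intros X h h' e e'. destruct (b4' X h h') as [U [HU eU]].
  { now apply fin2_ind. }
  exists U. split; [|assumption]. now apply ph, b5.
Qed.

(** All phased coproducts of [A] and [B] are isomorphic, so each inherits projections, and the
    coincidence of phases, from the one underlying a phased biproduct. *)
Lemma pcoprod2_biprod2 (A B S : C) (kA : Hom A S) (kB : Hom B S) :
  is_phased_coproduct2 kA kB -> exists pA pB, biprod2 kA kB pA pB.
Proof.
intros HS. destruct (biprod2_ex A B) as (S' & kA' & kB' & pA & pB & HS' & H).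
destruct (pcoprod2_unique HS HS') as (f & [f' [f1 f2]] & eA & eB).
assert (eA' : f' ∘ kA' ≈ kA) by now rewrite <- eA, (comp_cancel f1).
assert (eB' : f' ∘ kB' ≈ kB) by now rewrite <- eB, (comp_cancel f1).
exists (pA ∘ f), (pB ∘ f). split.
- rewrite <- compA, eA. apply H.
- rewrite <- compA, eB. apply H.
- rewrite <- compA, eA. apply H.
- rewrite <- compA, eB. apply H.
- intros U HU. apply is_phase2E in HU as [U1 U2].
  destruct (@bip_phase _ _ _ _ _ _ _ H (f ∘ U ∘ f')) as [e e'].
  { apply is_phase2E. now rewrite <- !compA, eA', eB', U1, U2. }
  rewrite !compA in e, e'.
  rewrite <- e at 2. rewrite <- e' at 2. rewrite <- !compA, f1, comp_idr. now split.
- intros X x y. destruct (bip_pair H x y) as [h [e e']].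
  exists (f' ∘ h). now rewrite <- !compA, !(comp_cancel f2).
- intros X x y e e'. rewrite <- !compA in e, e'.
  destruct (bip_uniq H e e') as [U [HU eU]]. apply is_phase2E in HU as [U1 U2].
  exists (f' ∘ U ∘ f). split.
  + apply is_phase2E. now rewrite <- !compA, eA, eB, U1, U2.
  + rewrite <- !compA, <- eU. now rewrite (comp_cancel f1).
Qed.

Lemma coproj_split_mono (A B S : C) (kA : Hom A S) (kB : Hom B S) :
  is_phased_coproduct2 kA kB -> split_mono kA /\ split_mono kB.
Proof.
intros HS. destruct (pcoprod2_biprod2 HS) as (pA & pB & H).
split; [exists pA|exists pB]; apply H.
Qed.

(* [f U] and [f] agree after both projections, by the equality of the phases of the
   coproduct and of the product. *)
Lemma phase2_transitive (A B S A' B' S' : C) (kA : Hom A S) (kB : Hom B S) (kA' : Hom A' S')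
    (kB' : Hom B' S') (f : Hom S S') (g : Hom A A') (h : Hom B B') (U : Hom S S) :
  is_phased_coproduct2 kA kB -> is_phased_coproduct2 kA' kB' ->
  f ∘ kA ≈ kA' ∘ g -> f ∘ kB ≈ kB' ∘ h -> is_phase2 kA kB U ->
  exists V, is_phase2 kA' kB' V /\ f ∘ U ≈ V ∘ f.
Proof.
intros HS HS' eA eB HU.
destruct (pcoprod2_biprod2 HS) as (pA & pB & H).
destruct (pcoprod2_biprod2 HS') as (pA' & pB' & H').
assert (key : forall W, is_phase2 kA kB W -> pA' ∘ (f ∘ W) ≈ pA' ∘ f /\ pB' ∘ (f ∘ W) ≈ pB' ∘ f).
{ assert (dA : exists V, is_phase2 kA kB V /\ pA' ∘ f ≈ g ∘ pA ∘ V).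
  { apply (pcoprod2_uniq HS); rewrite <- !compA, ?eA, ?eB, ?(bip_AA H), ?(bip_AB H).
    - now rewrite (comp_cancel (bip_AA H')), comp_idr.
    - now rewrite (comp_pull (bip_AB H')), zero_l, zero_r. }
  assert (dB : exists V, is_phase2 kA kB V /\ pB' ∘ f ≈ h ∘ pB ∘ V).
  { apply (pcoprod2_uniq HS); rewrite <- !compA, ?eA, ?eB, ?(bip_BA H), ?(bip_BB H).
    - now rewrite (comp_pull (bip_BA H')), zero_l, zero_r.
    - now rewrite (comp_cancel (bip_BB H')), comp_idr. }
  destruct dA as [V [HV e]], dB as [V' [HV' e']].
  rewrite <- compA, (proj1 (bip_phase H HV)) in e.
  rewrite <- compA, (proj2 (bip_phase H HV')) in e'.
  intros W HW. destruct (bip_phase H HW) as [w w'].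
  rewrite !compA, e, e', <- !compA, w, w'. now split. }
destruct (key U HU) as [e e']. symmetry in e, e'.
exact (bip_uniq H' e e').
Qed.

(* Both [T] and a phased coproduct of [TA] and [B] are phased coproducts of [A], [B]
   and [I], hence isomorphic. *)
Lemma pcoprod2_assoc (A B I T0 T TA : C) (k1 : Hom A T0) (k2 : Hom B T0) (kT : Hom T0 T)
    (kI : Hom I T) (kA : Hom A TA) (kI' : Hom I TA) (m : Hom TA T) :
  is_phased_coproduct2 k1 k2 -> is_phased_coproduct2 kT kI -> is_phased_coproduct2 kA kI' ->
  m ∘ kA ≈ kT ∘ k1 -> m ∘ kI' ≈ kI -> is_phased_coproduct2 m (kT ∘ k2).
Proof.
intros H0 HT HA mA mI.
destruct (biprod2_ex TA B) as (S & a & b & _ & _ & HS & _).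
destruct (pcoprod2_ex H0 (a ∘ kA) b) as [t0 [e1 e2]].
destruct (pcoprod2_ex HT t0 (a ∘ kI')) as [x [e3 e4]].
destruct (pcoprod2_ex HS m (kT ∘ k2)) as [y [e5 e6]].
assert (yiso : is_iso y).
{ apply (@iso_of_both_composites _ _ _ y x).
  - destruct (@pcoprod2_uniq _ _ _ _ _ _ H0 T kT (y ∘ t0)) as [W [HW eW]].
    + now rewrite <- compA, e1, compA, e5.
    + now rewrite <- compA, e2.
    + apply (diag_iso (g := W) (h := idm I) HT HT).
      * now rewrite <- compA, e3.
      * now rewrite <- compA, e4, compA, e5, comp_idr.
      * exact (phase2_iso H0 HW).
      * apply iso_id.
  - destruct (@pcoprod2_uniq _ _ _ _ _ _ HA S a (x ∘ m)) as [W [HW eW]].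
    + now rewrite <- compA, mA, compA, e3.
    + now rewrite <- compA, mI, e4.
    + apply (diag_iso (g := W) (h := idm B) HS HS).
      * now rewrite <- compA, e5.
      * now rewrite <- compA, e6, compA, e3, e2, comp_idr.
      * exact (phase2_iso HA HW).
      * apply iso_id. }
apply (pcoprod2_transport (f := y) (g := idm TA) (h := idm B) HS);
  rewrite ?comp_idr; trivial using iso_id.
Qed.

(** Over the empty family any two morphisms agree on coprojections, so the identity is a zero arrow
    composed with a phase. *)
Lemma zero_object_ex : exists Z : C, idm Z ≈ zero Z Z.
Proof.
destruct (bipP (fun i : Fin.t 0 => Fin.case0 (fun _ => C : Type) i)) as (Z & k & p & _ & _ & [_ H] & _).
destruct (H Z (idm Z) (zero Z Z)) as [U [_ e]].
{ intros i. now apply Fin.case0. }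
destruct (H Z (zero Z Z) (idm Z)) as [V [_ e']].
{ intros i. now apply Fin.case0. }
exists Z. now rewrite e', zero_l.
Qed.

End PhasedBiproducts.

Ltac gp_cbn := cbn [gmor gp_comp gp_id comp idm heq gp_cat].

(** * Distributive phased biproducts *)

Section DistributivePhasedBiproducts.
Variable C : MonCat.
Hypothesis HC : has_finite_distributive_phased_biproducts C.

Lemma dist_l (E A B S : C) (kA : Hom A S) (kB : Hom B S) :
  is_phased_coproduct2 kA kB -> is_phased_coproduct2 (idm E ⊠ kA) (idm E ⊠ kB).
Proof. intros H. destruct HC as (zero & _ & _ & HD). exact (proj1 (proj1 (HD E) A B S kA kB H)). Qed.

Lemma dist_r (E A B S : C) (kA : Hom A S) (kB : Hom B S) :
  is_phased_coproduct2 kA kB -> is_phased_coproduct2 (kA ⊠ idm E) (kB ⊠ idm E).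
Proof. intros H. destruct HC as (zero & _ & _ & HD). exact (proj1 (proj2 (HD E) A B S kA kB H)). Qed.

Lemma dist_r_phase (E A B S : C) (kA : Hom A S) (kB : Hom B S) (V : Hom (S ⊗ E) (S ⊗ E)) :
  is_phased_coproduct2 kA kB -> is_phase2 (kA ⊠ idm E) (kB ⊠ idm E) V ->
  exists U, is_phase2 kA kB U /\ V ≈ U ⊠ idm E.
Proof.
intros H. destruct HC as (zero & _ & _ & HD).
exact (proj2 (proj2 (HD E) A B S kA kB H) V).
Qed.

Lemma dist_l_phase (E A B S : C) (kA : Hom A S) (kB : Hom B S) (V : Hom (E ⊗ S) (E ⊗ S)) :
  is_phased_coproduct2 kA kB -> is_phase2 (idm E ⊠ kA) (idm E ⊠ kB) V ->
  exists U, is_phase2 kA kB U /\ V ≈ idm E ⊠ U.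
Proof.
intros H. destruct HC as (zero & _ & _ & HD).
exact (proj2 (proj1 (HD E) A B S kA kB H) V).
Qed.

Lemma sum_ex (A B : C) : exists (S : C) (kA : Hom A S) (kB : Hom B S), is_phased_coproduct2 kA kB.
Proof.
destruct HC as (zero & [zP _] & bP & _).
destruct (biprod2_ex bP A B) as (S & kA & kB & _ & _ & H & _). now exists S, kA, kB.
Qed.

Lemma coproj_split (A B S : C) (kA : Hom A S) (kB : Hom B S) :
  is_phased_coproduct2 kA kB -> split_mono kA /\ split_mono kB.
Proof. destruct HC as (zero & [zP _] & bP & _). apply (coproj_split_mono bP). Qed.

Lemma phase_transport (A B S A' B' S' : C) (kA : Hom A S) (kB : Hom B S) (kA' : Hom A' S')
    (kB' : Hom B' S') (f : Hom S S') (g : Hom A A') (h : Hom B B') (U : Hom S S) :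
  is_phased_coproduct2 kA kB -> is_phased_coproduct2 kA' kB' ->
  f ∘ kA ≈ kA' ∘ g -> f ∘ kB ≈ kB' ∘ h -> is_phase2 kA kB U ->
  exists V, is_phase2 kA' kB' V /\ f ∘ U ≈ V ∘ f.
Proof. destruct HC as (zero & [zP _] & bP & _). apply (phase2_transitive zP bP). Qed.

(** * Objects and morphisms of [GP(C)] *)

Definition gp_mk (A B : GPObj C) (f : Hom (A : C) (B : C)) (g : Hom (gbase A) (gbase B))
    (e : f ∘ kbase A ≈ kbase B ∘ g) (e' : f ∘ kunit A ≈ kunit B) : GPHom A B :=
  {| gmor := f;
     gmor_diag := conj (ex_intro _ g e)
       (ex_intro _ (idm munit) (transitivity e' (symmetry (comp_idr (kunit B)))));
     gmor_unit := e' |}.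

(** Choice only names a witness that is unique, [kbase B] being a split monomorphism. On the
    quotient by global phases this component becomes the equivalence with [C]. *)
Definition gp_base (A B : GPObj C) (f : GPHom A B) : Hom (gbase A) (gbase B) :=
  proj1_sig (constructive_indefinite_description _ (proj1 (gmor_diag f))).

Lemma gp_baseE (A B : GPObj C) (f : GPHom A B) : gmor f ∘ kbase A ≈ kbase B ∘ gp_base f.
Proof. exact (proj2_sig (constructive_indefinite_description _ (proj1 (gmor_diag f)))). Qed.

Lemma gp_pcoprod (A : GPObj C) : is_phased_coproduct2 (kbase A) (kunit A).
Proof. exact (sum_pcoprod (gsum A)). Qed.

Lemma gp_base_eq (A B : GPObj C) (f : GPHom A B) g :
  gmor f ∘ kbase A ≈ kbase B ∘ g -> gp_base f ≈ g.
Proof.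
intros e. apply (split_mono_cancel (proj1 (coproj_split (gp_pcoprod B)))).
now rewrite <- gp_baseE.
Qed.

Lemma gp_base_proper (A B : GPObj C) (f g : GPHom A B) :
  gmor f ≈ gmor g -> gp_base f ≈ gp_base g.
Proof. intros e. apply gp_base_eq. now rewrite e, gp_baseE. Qed.

Lemma gp_base_id (A : GPObj C) : gp_base (gp_id A) ≈ idm (gbase A).
Proof. apply gp_base_eq. simpl. now rewrite comp_idl, comp_idr. Qed.

Lemma gp_base_comp (A B E : GPObj C) (g : GPHom B E) (f : GPHom A B) :
  gp_base (gp_comp g f) ≈ gp_base g ∘ gp_base f.
Proof.
apply gp_base_eq. simpl. now rewrite <- compA, gp_baseE, compA, gp_baseE, compA.
Qed.

Lemma gp_ex (A B : GPObj C) (g : Hom (gbase A) (gbase B)) :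
  exists f : GPHom A B, gp_base f ≈ g.
Proof.
destruct (pcoprod2_ex (gp_pcoprod A) (kbase B ∘ g) (kunit B)) as [f [e e']].
exists (gp_mk e e'). now apply gp_base_eq.
Qed.

Lemma gp_phase (A B : GPObj C) (f g : GPHom A B) :
  gp_base f ≈ gp_base g -> exists U : GPHom A A,
    is_phase2 (kbase A) (kunit A) (gmor U) /\ gmor g ≈ gmor f ∘ gmor U.
Proof.
intros e. destruct (@pcoprod2_uniq _ _ _ _ _ _ (gp_pcoprod A) B f g) as [U [HU eU]].
- now rewrite !gp_baseE, e.
- now rewrite !gmor_unit.
- pose proof (proj1 (is_phase2E _ _ _) HU) as [u u'].
  assert (u2 : U ∘ kbase A ≈ kbase A ∘ idm _) by now rewrite u, comp_idr.
  now exists (gp_mk u2 u').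
Qed.

Lemma gp_base_phase (A : GPObj C) (U : GPHom A A) :
  is_phase2 (kbase A) (kunit A) (gmor U) <-> gp_base U ≈ idm (gbase A).
Proof.
rewrite is_phase2E. split.
- intros [u _]. apply gp_base_eq. now rewrite u, comp_idr.
- intros e. now rewrite gp_baseE, e, comp_idr, gmor_unit.
Qed.

(** Invertibility in [C] comes from [diag_iso]; what remains is that the inverse is again diagonal
    and preserves the unit coprojection. *)
Lemma gp_iso (A B : GPObj C) (f : GPHom A B) :
  is_iso (gp_base f) -> @is_iso (gp_cat C) A B f.
Proof.
intros [g [g1 g2]].
assert (If : is_iso (gmor f)).
{ apply (diag_iso (g := gp_base f) (h := idm munit) (gp_pcoprod A) (gp_pcoprod B)).
  - apply gp_baseE.
  - now rewrite gmor_unit, comp_idr.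
  - now exists g.
  - apply iso_id. }
destruct If as [f' [f1 f2]].
assert (e : f' ∘ kbase B ≈ kbase A ∘ g).
{ apply (split_mono_cancel (f := gmor f)); [now exists f'|].
  now rewrite (comp_cancel f2), (comp_pull (gp_baseE f)), <- compA, g2, comp_idr. }
assert (e' : f' ∘ kunit B ≈ kunit A).
{ now rewrite <- (gmor_unit f), (comp_cancel f1). }
exists (gp_mk e e'). now split.
Qed.

Lemma gp_iso_ex (A B : GPObj C) (g : Hom (gbase A) (gbase B)) :
  is_iso g -> exists f : GPHom A B, @is_iso (gp_cat C) A B f /\ gp_base f ≈ g.
Proof.
intros Hg. destruct (gp_ex g) as [f e]. exists f. split; [|assumption].
apply gp_iso. apply (iso_proper (symmetry e) Hg).
Qed.

(** In the applications [y] is a comparison built from [c]. It is a split monomorphism, so the lift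
    is unique, although its values on coprojections alone would leave a phase undetermined. *)
Lemma gp_lift (X Y : GPObj C) (Z : C) (x : Hom (X : C) Z) (y : Hom (Y : C) Z)
    (g : Hom (gbase X) (gbase Y)) :
  x ∘ kbase X ≈ y ∘ kbase Y ∘ g -> x ∘ kunit X ≈ y ∘ kunit Y ->
  exists h : GPHom X Y, y ∘ gmor h ≈ x.
Proof.
intros e e'.
destruct (@pcoprod2_factor _ _ _ _ _ _ _ _ (kbase X) (kunit X) (kbase Y) (kunit Y) x y g
  (idm munit) (gp_pcoprod X)) as (k & k1 & k2 & k3).
- assumption.
- now rewrite e', comp_idr.
- rewrite comp_idr in k2. now exists (gp_mk k1 k2).
Qed.

(** * The monoidal structure of [GP(C)] *)

Lemma GPChoice_inhabited : inhabited (GPChoice C).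
Proof.
assert (sumP : forall A : C, inhabited (SumWithUnit A)).
{ intros A. destruct (sum_ex A munit) as (S & kA & kI & H).
  exact (inhabits (Build_SumWithUnit H)). }
assert (sumD : forall A : C, SumWithUnit A).
{ intros A. refine (proj1_sig (constructive_indefinite_description (fun _ => True) _)).
  destruct (sumP A) as [s]. now exists s. }
pose (tns := fun A B : GPObj C => {| gsum := sumD (gbase A ⊗ gbase B) |} : GPObj C).
assert (cP : forall A B : GPObj C, {c : Hom (tns A B : C) ((A : C) ⊗ (B : C)) |
  c ∘ kbase (tns A B) ≈ kbase A ⊠ kbase B /\
  c ∘ kunit (tns A B) ≈ (kunit A ⊠ kunit B) ∘ rho_inv munit}).
{ intros A B. apply constructive_indefinite_description.
  apply (pcoprod2_ex (gp_pcoprod (tns A B))). }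
pose (un := {| gsum := sumD munit |} : GPObj C).
destruct (@gp_iso_ex (tns un un) un (rho munit) (rho_iso munit)) as [b [b1 b2]].
apply inhabits.
refine (@Build_GPChoice C (fun A B => sumD (gbase A ⊗ gbase B))
  (fun A B => proj1_sig (cP A B)) (fun A B => proj1 (proj2_sig (cP A B)))
  (fun A B => proj2 (proj2_sig (cP A B))) (sumD munit) b b1 _ _).
- refine (transitivity (gp_baseE b) _). now rewrite b2.
- apply gmor_unit.
Qed.

(** Compatibility with base coprojections for a tensor of morphisms. This and [alpha_square] serve
    twice: to construct the structure of [GP(C)], and to compute base components in an arbitrary
    [GPStructure]. *)
Lemma tens_square (X X' Y Y' A A' B B' P P' : C) (kA : Hom X A) (kB : Hom Y B)
    (kA' : Hom X' A') (kB' : Hom Y' B') (f : Hom A A') (g : Hom B B') (f0 : Hom X X')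
    (g0 : Hom Y Y') (c : Hom P (A ⊗ B)) (k : Hom (X ⊗ Y) P) (c' : Hom P' (A' ⊗ B'))
    (k' : Hom (X' ⊗ Y') P') :
  f ∘ kA ≈ kA' ∘ f0 -> g ∘ kB ≈ kB' ∘ g0 -> c ∘ k ≈ kA ⊠ kB -> c' ∘ k' ≈ kA' ⊠ kB' ->
  (f ⊠ g) ∘ c ∘ k ≈ c' ∘ k' ∘ (f0 ⊠ g0).
Proof. intros e1 e2 e3 e4. now rewrite <- compA, e3, e4, !tensM, e1, e2. Qed.

Lemma alpha_square (X Y Z A B E P Q R S : C) (kA : Hom X A) (kB : Hom Y B) (kE : Hom Z E)
    (c : Hom P (A ⊗ B)) (k : Hom (X ⊗ Y) P) (d : Hom Q (B ⊗ E)) (l : Hom (Y ⊗ Z) Q)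
    (c' : Hom R (P ⊗ E)) (k' : Hom (X ⊗ Y ⊗ Z) R) (d' : Hom S (A ⊗ Q))
    (l' : Hom (X ⊗ (Y ⊗ Z)) S) :
  c ∘ k ≈ kA ⊠ kB -> d ∘ l ≈ kB ⊠ kE -> c' ∘ k' ≈ k ⊠ kE -> d' ∘ l' ≈ kA ⊠ l ->
  alpha A B E ∘ (c ⊠ idm E) ∘ c' ∘ k' ≈ (idm A ⊠ d) ∘ d' ∘ l' ∘ alpha X Y Z.
Proof.
intros e1 e2 e3 e4.
rewrite <- !compA, e3, (comp_pull e4), (compA (idm A ⊠ d)), !tensM, e1, e2, !comp_idl.
apply alpha_natural.
Qed.

Lemma rho_square (X A J P : C) (kA : Hom X A) (k1 : Hom munit J) (n : Hom J munit)
    (c : Hom P (A ⊗ J)) (k : Hom (X ⊗ munit) P) :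
  n ∘ k1 ≈ idm munit -> c ∘ k ≈ kA ⊠ k1 -> rho A ∘ (idm A ⊠ n) ∘ c ∘ k ≈ kA ∘ rho X.
Proof.
intros e e'. rewrite <- !compA, e', tensM, comp_idl, e. apply rho_natural.
Qed.

Lemma lam_square (X A J P : C) (kA : Hom X A) (k1 : Hom munit J) (n : Hom J munit)
    (c : Hom P (J ⊗ A)) (k : Hom (munit ⊗ X) P) :
  n ∘ k1 ≈ idm munit -> c ∘ k ≈ k1 ⊠ kA -> lam A ∘ (n ⊠ idm A) ∘ c ∘ k ≈ kA ∘ lam X.
Proof.
intros e e'. rewrite <- !compA, e', tensM, comp_idl, e. apply lam_natural.
Qed.

Section Structure.
Variable ch : GPChoice C.
#[local] Notation T := (ch_tens ch).
#[local] Notation c := (ch_c ch).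

Lemma ch_c_unit_ins (A B : GPObj C) : c A B ∘ kunit (T A B) ≈ ins (kunit A) (kunit B).
Proof. rewrite ch_c_unit. unfold ins. now rewrite lam_rho_inv_unit. Qed.

(** By distributivity the target decomposes into four summands: [p] keeps the tensor of the bases
    and [I ⊗ I], and kills the two mixed ones with zero arrows. Then [p ∘ c] fixes the
    coprojections, so it is an invertible phase. *)
Lemma ch_c_split (A B : GPObj C) : split_mono (c A B).
Proof.
destruct HC as (zero & _ & _ & _).
destruct (pcoprod2_ex (dist_l (gbase A) (gp_pcoprod B)) (kbase (T A B)) (zero _ _))
  as [p1 [e1 _]].
destruct (pcoprod2_ex (dist_l munit (gp_pcoprod B)) (zero _ _) (kunit (T A B) ∘ rho munit))
  as [p2 [_ e2]].
destruct (pcoprod2_ex (dist_r (B : C) (gp_pcoprod A)) p1 p2) as [p [f1 f2]].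
assert (h1 : p ∘ c A B ∘ kbase (T A B) ≈ kbase (T A B)).
{ rewrite <- compA. rewrite ch_c_base.
  rewrite <- (comp_idr (kbase A)), <- (comp_idl (kbase B)), <- tensM, compA, f1. exact e1. }
assert (h2 : p ∘ c A B ∘ kunit (T A B) ≈ kunit (T A B)).
{ rewrite <- compA. rewrite ch_c_unit.
  rewrite <- (comp_idr (kunit A)), <- (comp_idl (kunit B)), <- tensM, !compA, f2, e2.
  now rewrite <- compA, rho_invK, comp_idr. }
destruct (phase2_inverse (gp_pcoprod (T A B)) (U := p ∘ c A B)) as (W & _ & e' & _).
{ now apply is_phase2E. }
exists (W ∘ p). now rewrite <- compA.
Qed.

Lemma ch_c_cancel (A B : GPObj C) (X : C) (x y : Hom X (T A B : C)) :
  c A B ∘ x ≈ c A B ∘ y -> x ≈ y.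
Proof. apply split_mono_cancel, ch_c_split. Qed.

Lemma ch_c_assoc_split (A B E : GPObj C) : split_mono ((idm (A : C) ⊠ c B E) ∘ c A (T B E)).
Proof.
apply split_mono_comp; [|apply ch_c_split].
apply split_mono_tens; [exists (idm _); apply comp_idl|apply ch_c_split].
Qed.

Lemma gp_tens_ex (A A' B B' : GPObj C) (f : GPHom A A') (g : GPHom B B') :
  exists h : GPHom (T A B) (T A' B'), c A' B' ∘ gmor h ≈ (gmor f ⊠ gmor g) ∘ c A B.
Proof.
apply gp_lift with (g := gp_base f ⊠ gp_base g).
- refine (tens_square _ _ _ _); apply gp_baseE || apply ch_c_base.
- rewrite <- (compA (_ ⊠ _)), !ch_c_unit_ins, tens_ins. now rewrite !gmor_unit.
Qed.

Lemma gp_alpha_ex (A B E : GPObj C) : exists h : GPHom (T (T A B) E) (T A (T B E)),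
  (idm (A : C) ⊠ c B E) ∘ c A (T B E) ∘ gmor h
  ≈ alpha (A : C) (B : C) (E : C) ∘ (c A B ⊠ idm (E : C)) ∘ c (T A B) E.
Proof.
apply gp_lift with (g := alpha (gbase A) (gbase B) (gbase E)).
- exact (alpha_square (ch_c_base ch A B) (ch_c_base ch B E) (ch_c_base ch (T A B) E)
    (ch_c_base ch A (T B E))).
- rewrite <- !compA, !ch_c_unit_ins, !tens_ins, !comp_idl, !ch_c_unit_ins.
  unfold ins at 1. now rewrite compA, alpha_ins, ins_comp.
Qed.

Let tn A A' B B' f g : GPHom (T A B) (T A' B') :=
  proj1_sig (constructive_indefinite_description _ (@gp_tens_ex A A' B B' f g)).

Let tnE A A' B B' (f : GPHom A A') (g : GPHom B B') :
  c A' B' ∘ gmor (tn f g) ≈ (gmor f ⊠ gmor g) ∘ c A B.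
Proof. exact (proj2_sig (constructive_indefinite_description _ (@gp_tens_ex A A' B B' f g))). Qed.

Let al (A B E : GPObj C) : GPHom (T (T A B) E) (T A (T B E)) :=
  proj1_sig (constructive_indefinite_description _ (@gp_alpha_ex A B E)).

Let alE (A B E : GPObj C) : (idm (A : C) ⊠ c B E) ∘ c A (T B E) ∘ gmor (al A B E)
  ≈ alpha (A : C) (B : C) (E : C) ∘ (c A B ⊠ idm (E : C)) ∘ c (T A B) E.
Proof. exact (proj2_sig (constructive_indefinite_description _ (@gp_alpha_ex A B E))). Qed.

Let al_base (A B E : GPObj C) : gp_base (al A B E) ≈ alpha (gbase A) (gbase B) (gbase E).
Proof.
apply gp_base_eq. apply (split_mono_cancel (ch_c_assoc_split A B E)).
refine (transitivity _ (transitivity (alpha_square (ch_c_base ch A B) (ch_c_base ch B E)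
  (ch_c_base ch (T A B) E) (ch_c_base ch A (T B E))) _)).
- now rewrite compA, alE.
- now rewrite !compA.
Qed.

Let al_is_iso (A B E : GPObj C) : @is_iso (gp_cat C) _ _ (al A B E).
Proof. apply gp_iso. apply (iso_proper (symmetry (al_base A B E))), alpha_iso. Qed.

Let al' (A B E : GPObj C) : GPHom (T A (T B E)) (T (T A B) E) :=
  proj1_sig (constructive_indefinite_description _ (al_is_iso A B E)).

Let al'P (A B E : GPObj C) : @inverse_pair (gp_cat C) _ _ (al A B E) (al' A B E).
Proof. exact (proj2_sig (constructive_indefinite_description _ (al_is_iso A B E))). Qed.

(** A codiagonal of [I ∔ I], one among many that differ by phases. Collapsing the unit factor with
    it gives the natural isomorphisms [jr_ex] and [jl_ex], whose base components are the unitors of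
    [C]. *)
Let nabla_ex : exists n : Hom (ch_unit ch : C) munit,
  n ∘ kbase (ch_unit ch) ≈ idm munit /\ n ∘ kunit (ch_unit ch) ≈ idm munit.
Proof. exact (pcoprod2_ex (gp_pcoprod (ch_unit ch)) (idm munit) (idm munit)). Qed.

Let jr_ex (A : GPObj C) (n : Hom (ch_unit ch : C) munit) :
  n ∘ kbase (ch_unit ch) ≈ idm munit -> n ∘ kunit (ch_unit ch) ≈ idm munit ->
  exists j : GPHom (T A (ch_unit ch)) A,
    gmor j ≈ rho (A : C) ∘ (idm (A : C) ⊠ n) ∘ c A (ch_unit ch) /\ @is_iso (gp_cat C) _ _ j.
Proof.
intros n1 n2.
assert (e : rho (A : C) ∘ (idm (A : C) ⊠ n) ∘ c A (ch_unit ch) ∘ kbase (T A (ch_unit ch))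
  ≈ kbase A ∘ rho (gbase A)).
{ exact (@rho_square (gbase A) A (ch_unit ch) _ (kbase A) (kbase (ch_unit ch)) n _ _ n1 (ch_c_base ch A (ch_unit ch))). }
assert (e' : rho (A : C) ∘ (idm (A : C) ⊠ n) ∘ c A (ch_unit ch) ∘ kunit (T A (ch_unit ch))
  ≈ kunit A).
{ rewrite <- !compA. rewrite ch_c_unit, (comp_pull (tensM _ _ _ _)), comp_idl, n2.
  rewrite (comp_pull (rho_natural _)), <- compA, rho_invK. apply comp_idr. }
exists (gp_mk e e'). split; [reflexivity|]. apply gp_iso.
apply (iso_proper (f := rho (gbase A))); [|apply rho_iso]. symmetry. exact (gp_base_eq (f := gp_mk e e') e).
Qed.

Let jl_ex (A : GPObj C) (n : Hom (ch_unit ch : C) munit) :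
  n ∘ kbase (ch_unit ch) ≈ idm munit -> n ∘ kunit (ch_unit ch) ≈ idm munit ->
  exists j : GPHom (T (ch_unit ch) A) A,
    gmor j ≈ lam (A : C) ∘ (n ⊠ idm (A : C)) ∘ c (ch_unit ch) A /\ @is_iso (gp_cat C) _ _ j.
Proof.
intros n1 n2.
assert (e : lam (A : C) ∘ (n ⊠ idm (A : C)) ∘ c (ch_unit ch) A ∘ kbase (T (ch_unit ch) A)
  ≈ kbase A ∘ lam (gbase A)).
{ exact (@lam_square (gbase A) A (ch_unit ch) _ (kbase A) (kbase (ch_unit ch)) n _ _ n1 (ch_c_base ch (ch_unit ch) A)). }
assert (e' : lam (A : C) ∘ (n ⊠ idm (A : C)) ∘ c (ch_unit ch) A ∘ kunit (T (ch_unit ch) A)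
  ≈ kunit A).
{ rewrite <- !compA, ch_c_unit_ins, tens_ins, comp_idl. now apply lam_ins. }
exists (gp_mk e e'). split; [reflexivity|]. apply gp_iso.
apply (iso_proper (f := lam (gbase A))); [|apply lam_iso]. symmetry. exact (gp_base_eq (f := gp_mk e e') e).
Qed.

Let tn_proper (A A' B B' : gp_cat C) :
  Proper (@heq (gp_cat C) A A' ==> @heq (gp_cat C) B B' ==> @heq (gp_cat C) (T A B) (T A' B'))
    (@tn A A' B B').
Proof.
intros f f' e g g' e'. apply (ch_c_cancel (A := A') (B := B')). rewrite !tnE.
cbn [heq gp_cat] in e, e'. now rewrite e, e'.
Qed.

Let tn_id (A B : gp_cat C) : @heq (gp_cat C) _ _ (tn (gp_id A) (gp_id B)) (gp_id (T A B)).
Proof.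
apply (ch_c_cancel (A := A) (B := B)). rewrite tnE. gp_cbn.
now rewrite tens_id, comp_idl, comp_idr.
Qed.

Let tn_comp (A A' A'' B B' B'' : gp_cat C)
    (g : GPHom A' A'') (f : GPHom A A') (k : GPHom B' B'') (h : GPHom B B') :
  @heq (gp_cat C) _ _ (tn (gp_comp g f) (gp_comp k h)) (gp_comp (tn g k) (tn f h)).
Proof.
apply (ch_c_cancel (A := A'') (B := B'')). rewrite tnE. gp_cbn.
rewrite compA, tnE, <- compA, tnE. now rewrite compA, tensM.
Qed.

Let al_nat (A A' B B' E E' : gp_cat C) (f : GPHom A A') (g : GPHom B B') (h : GPHom E E') :
  @heq (gp_cat C) _ _ (gp_comp (al A' B' E') (tn (tn f g) h))
    (gp_comp (tn f (tn g h)) (al A B E)).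
Proof.
apply (split_mono_cancel (ch_c_assoc_split A' B' E')). gp_cbn.
rewrite compA, alE, <- !compA, tnE.
rewrite (compA (c A' (T B' E'))), tnE, (compA (idm _ ⊠ _)), (compA (idm _ ⊠ _)), tensM.
rewrite comp_idl, tnE.
rewrite (compA (_ ⊠ idm _)), tensM, tnE, comp_idl.
transitivity ((gmor f ⊠ (gmor g ⊠ gmor h)) ∘
  ((idm (A : C) ⊠ c B E) ∘ c A (T B E) ∘ gmor (al A B E))).
- rewrite alE, <- !compA, (compA (_ ⊠ (_ ⊠ _)) (alpha _ _ _)), <- alpha_natural, <- !compA.
  now rewrite (comp_pull (tensM (gmor f ⊠ gmor g) _ _ _)), comp_idr.
- now rewrite !compA, tensM, comp_idr.
Qed.

Let al_pentagon (A B E G : gp_cat C) :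
  @heq (gp_cat C) _ _ (gp_comp (al A B (T E G)) (al (T A B) E G))
    (gp_comp (gp_comp (tn (gp_id A) (al B E G)) (al A (T B E) G)) (tn (al A B E) (gp_id G))).
Proof.
apply (split_mono_cancel
  (f := (idm (A : C) ⊠ (idm (B : C) ⊠ c E G)) ∘ ((idm (A : C) ⊠ c B (T E G)) ∘ c A (T B (T E G))))).
{ apply split_mono_comp; [|apply ch_c_assoc_split].
  apply split_mono_tens; [exists (idm _); apply comp_idl|].
  apply split_mono_tens; [exists (idm _); apply comp_idl|apply ch_c_split]. }
gp_cbn.
(* Common normal form of both sides: the nested comparisons [c], followed by the side of the
   pentagon of [C] that consists of two associators. *)
transitivity (alpha (A : C) (B : C) ((E : C) ⊗ (G : C)) ∘ alpha ((A : C) ⊗ (B : C)) (E : C) (G : C)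
  ∘ ((c A B ⊠ idm (E : C)) ⊠ idm (G : C)) ∘ (c (T A B) E ⊠ idm (G : C)) ∘ c (T (T A B) E) G).
- transitivity ((idm (A : C) ⊠ (idm (B : C) ⊠ c E G)) ∘
    ((idm (A : C) ⊠ c B (T E G)) ∘ c A (T B (T E G)) ∘ gmor (al A B (T E G))) ∘ gmor (al (T A B) E G)).
  { now rewrite !compA. }
  rewrite alE, !compA, <- alpha_natural, tens_id.
  rewrite <- (compA (alpha _ _ _) (_ ⊠ _) (_ ⊠ _)), tensM, comp_idl, comp_idr.
  transitivity (alpha (A : C) (B : C) ((E : C) ⊗ (G : C)) ∘ (c A B ⊠ idm ((E : C) ⊗ (G : C))) ∘
    ((idm (T A B : C) ⊠ c E G) ∘ c (T A B) (T E G) ∘ gmor (al (T A B) E G))).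
  { now rewrite !compA, <- (compA (alpha _ _ _) (_ ⊠ _) (_ ⊠ _)), tensM, comp_idl, comp_idr. }
  rewrite alE, !compA, <- (tens_id (mmon C)).
  now rewrite <- (compA (alpha _ _ _) (c A B ⊠ _)), <- alpha_natural, !compA.
- rewrite pentagon_alpha.
  symmetry.
  transitivity ((idm (A : C) ⊠ (idm (B : C) ⊠ c E G)) ∘ (idm (A : C) ⊠ c B (T E G)) ∘
    (c A (T B (T E G)) ∘ gmor (tn (gp_id A) (al B E G))) ∘ gmor (al A (T B E) G) ∘
    gmor (tn (al A B E) (gp_id G))).
  { now rewrite !compA. }
  rewrite tnE. gp_cbn.
  rewrite !compA, !tensM, !comp_idl, alE.
  transitivity ((idm (A : C) ⊠ (alpha (B : C) (E : C) (G : C) ∘ (c B E ⊠ idm (G : C)))) ∘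
    ((idm (A : C) ⊠ c (T B E) G) ∘ c A (T (T B E) G) ∘ gmor (al A (T B E) G)) ∘
    gmor (tn (al A B E) (gp_id G))).
  { now rewrite !compA, tensM, comp_idl. }
  rewrite alE, <- (comp_idl (idm (A : C))) at 1. rewrite <- tensM.
  rewrite <- !compA, tnE. gp_cbn.
  rewrite (compA (idm _ ⊠ (_ ⊠ _))), <- alpha_natural, <- !compA.
  apply comp_proper; [reflexivity|]. apply comp_proper; [reflexivity|].
  rewrite !compA, !tensM, !comp_idl, alE. reflexivity.
Qed.

Lemma GPStructure_inhabited : inhabited (GPStructure ch).
Proof.
destruct nabla_ex as (n & n1 & n2).
pose (jr := fun A => constructive_indefinite_description _ (@jr_ex A n n1 n2)).
pose (jl := fun A => constructive_indefinite_description _ (@jl_ex A n n1 n2)).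
pose (jr' := fun A => constructive_indefinite_description _ (proj2 (proj2_sig (jr A)))).
pose (jl' := fun A => constructive_indefinite_description _ (proj2 (proj2_sig (jl A)))).
destruct (ch_beta_iso ch) as [b' Hb].
destruct (@saavedra_unit (gp_cat C) T (ch_unit ch) tn al al' tn_proper tn_id tn_comp al'P
  al_nat al_pentagon (ch_beta ch) b' Hb
  (fun A => proj1_sig (jr A)) (fun A => proj1_sig (jr' A))
  (fun A => proj1_sig (jl A)) (fun A => proj1_sig (jl' A))
  (fun A => proj2_sig (jr' A)) (fun A => proj2_sig (jl' A)))
  as (m & m1 & m2 & m3 & m4 & m5).
- intros A B f. gp_cbn.
  rewrite (proj1 (proj2_sig (jr A))), (proj1 (proj2_sig (jr B))), <- !compA, tnE. gp_cbn.
  rewrite (compA (idm _ ⊠ n)), tensM, comp_idl, comp_idr.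
  rewrite !compA, <- rho_natural, <- (compA (rho _) (_ ⊠ idm munit)), tensM.
  now rewrite comp_idl, comp_idr.
- intros A B f. gp_cbn.
  rewrite (proj1 (proj2_sig (jl A))), (proj1 (proj2_sig (jl B))), <- !compA, tnE. gp_cbn.
  rewrite (compA (n ⊠ idm _)), tensM, comp_idl, comp_idr.
  rewrite !compA, <- lam_natural, <- (compA (lam _) (idm munit ⊠ _)), tensM.
  now rewrite comp_idl, comp_idr.
- apply inhabits. refine (@Build_GPStructure C ch m _ _ _ _).
  + intros A A' B B' f g h. rewrite m1. split; intros e.
    * apply (ch_c_cancel (A := A') (B := B')). now rewrite tnE.
    * cbn [heq gp_cat] in e. rewrite e. apply tnE.
  + intros A B E h. rewrite m2. split; intros e.
    * apply (split_mono_cancel (ch_c_assoc_split A B E)). rewrite alE. exact e.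
    * cbn [heq gp_cat] in e. rewrite e. apply alE.
  + intros A h. rewrite !m1, m2. apply m4.
  + intros A h. rewrite !m1, m3. apply m5.
Qed.

End Structure.
End DistributivePhasedBiproducts.

(** * Coproducts in [GP(C)] *)

Lemma alpha_tens_ins (M : MonCat) (J R D Q X Y W : M) (j : Hom munit J) (G : Hom (D ⊗ R) Q)
    (E : Hom W (J ⊗ D)) (x : Hom X W) (y : Hom Y R) (z : Hom X D) :
  E ∘ x ≈ ins j z ->
  (idm J ⊠ G) ∘ alpha J D R ∘ (E ⊠ idm R) ∘ (x ⊠ y) ≈ ins j (G ∘ (z ⊠ y)).
Proof.
intros e. rewrite <- !compA, tensM, e, comp_idl, alpha_ins, tens_ins.
now rewrite comp_idl.
Qed.

Section GPCoproducts.
Variable C : MonCat.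
Hypothesis HC : has_finite_distributive_phased_biproducts C.

Section Cospan.
Variables (A B T : GPObj C) (k1 : GPHom A T) (k2 : GPHom B T).
Hypothesis HT : is_phased_coproduct2 (gp_base k1) (gp_base k2).

Let b : Hom (gbase B) (T : C) := kbase T ∘ gp_base k2.

Let k2_base : gmor k2 ∘ kbase B ≈ b.
Proof. apply gp_baseE. Qed.

(** The carrier [(A ∔ B) ∔ I] regrouped as [(A ∔ I) ∔ B]. Both [k1] and [k2] contain the unit
    summand, which must be counted once, here with [A]. *)
Let HS : is_phased_coproduct2 (gmor k1) b.
Proof.
destruct HC as (zero & [zP _] & bP & _).
exact (pcoprod2_assoc bP HT (gp_pcoprod T) (gp_pcoprod A) (gp_baseE k1) (gmor_unit k1)).
Qed.

(** Extending [f] and the base of [g] gives [h0], which agrees with [g] along [k2] only up to a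
    phase [U] of [B ∔ I]. This phase moves across [k2] to some [V] on [T] that fixes [k1], and
    [h0 ∘ V] has both required restrictions. *)
Lemma gp_coprod_ex (D : GPObj C) (f : GPHom A D) (g : GPHom B D) :
  exists h : GPHom T D, gmor h ∘ gmor k1 ≈ gmor f /\ gmor h ∘ gmor k2 ≈ gmor g.
Proof.
destruct (pcoprod2_ex HS (gmor f) (kbase D ∘ gp_base g)) as [h0 [e1 e2]].
destruct (@pcoprod2_uniq _ _ _ _ _ _ (gp_pcoprod B) D (h0 ∘ gmor k2) (gmor g)) as [U [HU eU]].
{ now rewrite <- compA, k2_base, e2, gp_baseE. }
{ now rewrite <- compA, gmor_unit, <- (gmor_unit k1), compA, e1, !gmor_unit. }
destruct (@phase_transport C HC _ _ _ _ _ _ (kbase B) (kunit B) b (gmor k1) (gmor k2) (idm _)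
  (kunit A) U (gp_pcoprod B) (pcoprod2_sym HS)) as [V [HV eV]].
{ now rewrite k2_base, comp_idr. }
{ now rewrite !gmor_unit. }
{ assumption. }
apply is_phase2E in HV as [V1 V2].
assert (h1 : h0 ∘ V ∘ gmor k1 ≈ gmor f) by now rewrite <- compA, V2.
assert (h2 : h0 ∘ V ∘ gmor k2 ≈ gmor g) by now rewrite <- compA, <- eV, compA.
(* Diagonality: on [A ∔ B] the morphism agrees with [kbase D ∘ t0] up to a phase [W] of that sum, so
   its base component is [t0 ∘ W]. *)
destruct (pcoprod2_ex HT (gp_base f) (gp_base g)) as [t0 [t1 t2]].
destruct (@pcoprod2_uniq _ _ _ _ _ _ HT D (kbase D ∘ t0) (h0 ∘ V ∘ kbase T)) as [W [_ eW]].
{ now rewrite <- !compA, t1, <- !gp_baseE, <- h1, !compA. }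
{ now rewrite <- !compA, t2, <- !gp_baseE, <- h2, !compA. }
assert (hu : h0 ∘ V ∘ kunit T ≈ kunit D).
{ now rewrite <- (gmor_unit k1), compA, h1, gmor_unit. }
rewrite <- (compA (kbase D)) in eW.
now exists (@gp_mk C T D _ _ eW hu).
Qed.

(* [h] and [h'] differ by an endomorphism [Z] of [T] fixing [k1] and [b].  Seen
   inside [J ⊗ T] with [J = I ∔ I], through [e] which puts [k1] in the first and
   [b] in the second copy of [T], it is induced by a phase [u] of [J].  Since [u]
   does not affect [(1 ⊠ h) e k2], tensoring the latter with [A ∔ I] shows that it
   does not affect [(1 ⊠ h) e] either, and folding the two copies gives [h Z ≈ h]. *)
Lemma gp_coprod_uniq (D : GPObj C) (h h' : GPHom T D) :
  gmor h ∘ gmor k1 ≈ gmor h' ∘ gmor k1 -> gmor h ∘ gmor k2 ≈ gmor h' ∘ gmor k2 ->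
  gmor h ≈ gmor h'.
Proof.
intros e1 e2.
destruct (@pcoprod2_uniq _ _ _ _ _ _ HS D (gmor h) (gmor h')) as [Z [HZ eZ]].
{ assumption. }
{ unfold b. now rewrite <- !gp_baseE, !compA, e2. }
rewrite eZ. pose proof (proj1 (is_phase2E _ _ _) HZ) as [Z1 Z2].
destruct (sum_ex HC munit munit) as (J & j1 & j2 & HJ).
destruct (pcoprod2_ex HJ (idm munit) (idm munit)) as (n & n1 & n2).
assert (HJS : is_phased_coproduct2 (j1 ⊠ idm (T : C)) (j2 ⊠ idm (T : C))).
{ exact (dist_r HC T HJ). }
(* Folding the first choice of [e] gives only a phase of [T]; composing [e] with the inverse phase
   makes the fold the identity. *)
assert (exe : exists e : Hom (T : C) (J ⊗ (T : C)),
  e ∘ gmor k1 ≈ ins j1 (gmor k1) /\ e ∘ b ≈ ins j2 b /\ lam (T : C) ∘ (n ⊠ idm (T : C)) ∘ e ≈ idm _).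
{ destruct (pcoprod2_ex HS (ins j1 (gmor k1)) (ins j2 b)) as (e & ea & eb).
  destruct (phase2_inverse HS (U := lam (T : C) ∘ (n ⊠ idm (T : C)) ∘ e)) as (Y & HY & _ & eY).
  { apply is_phase2E. rewrite <- !compA, ea, eb, !tens_ins, !comp_idl. split; now apply lam_ins. }
  apply is_phase2E in HY as [Y1 Y2].
  exists (e ∘ Y). split; [|split].
  - now rewrite <- compA, Y1.
  - now rewrite <- compA, Y2.
  - now rewrite compA. }
destruct exe as (e & ea & eb & en).
destruct (phase_transport HC (f := e) (g := lam_inv (T : C) ∘ gmor k1) (h := lam_inv (T : C) ∘ b)
  (U := Z) HS HJS) as [W [HW eW]].
{ rewrite ea. unfold ins. now rewrite lam_inv_natural, compA, tensM, comp_idl, comp_idr. }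
{ rewrite eb. unfold ins. now rewrite lam_inv_natural, compA, tensM, comp_idl, comp_idr. }
{ assumption. }
(* Strong distributivity: the phase of [J ⊗ T] corresponding to [Z] comes from [J]. *)
destruct (dist_r_phase HC HJ HW) as [u [Hu eu]]. apply is_phase2E in Hu as [u1 u2].
rewrite eu in eW.
pose (he := (idm J ⊠ gmor h) ∘ e).
assert (uhe : (u ⊠ idm (D : C)) ∘ he ≈ he ∘ Z).
{ unfold he. rewrite compA, tensM, comp_idl, comp_idr, <- compA, eW, compA, tensM.
  now rewrite comp_idl, comp_idr. }
destruct (@pcoprod2_uniq _ _ _ _ _ _ (gp_pcoprod B) T (gmor k2) (Z ∘ gmor k2)) as [V [HV eV]].
{ now rewrite <- compA, k2_base, Z2. }
{ now rewrite <- compA, gmor_unit, <- (gmor_unit k1), compA, Z1. }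
pose (g := gp_comp h k2). assert (gV : gmor g ∘ V ≈ gmor g).
{ simpl. now rewrite <- compA, <- eV, compA, <- eZ. }
(* Through [e'], the morphism [he ∘ k2] factors over [g] up to a phase, which moves across [g]. As
   [g] is invariant under [V], so is [he ∘ k2], and this yields [uE]. *)
destruct (pcoprod2_ex (gp_pcoprod D) (ins j2 (kbase D)) (ins j1 (kunit D))) as (e' & ea' & eb').
assert (Ea : he ∘ gmor k2 ∘ kbase B ≈ ins j2 (gmor h ∘ b)).
{ unfold he. now rewrite <- !compA, k2_base, eb, tens_ins, comp_idl. }
assert (Eb : he ∘ gmor k2 ∘ kunit B ≈ ins j1 (kunit D)).
{ unfold he. rewrite <- !compA, gmor_unit, <- (gmor_unit k1), (compA e), ea, ins_comp, tens_ins.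
  now rewrite comp_idl, gmor_unit, gmor_unit. }
assert (hb : gmor h ∘ b ≈ kbase D ∘ gp_base g).
{ unfold b. rewrite <- (gp_baseE k2), compA. exact (gp_baseE g). }
destruct (@pcoprod2_uniq _ _ _ _ _ _ (gp_pcoprod B) _ (e' ∘ gmor g) (he ∘ gmor k2))
  as [V2 [HV2 eV2]].
{ now rewrite Ea, hb, <- compA, gp_baseE, compA, ea', ins_comp. }
{ now rewrite Eb, <- compA, gmor_unit, eb'. }
destruct (phase_transport HC (f := gmor g) (g := gp_base g) (h := idm munit) (U := V2)
  (gp_pcoprod B) (gp_pcoprod D)) as [G2 [_ eG2]].
{ apply gp_baseE. }
{ now rewrite gmor_unit, comp_idr. }
{ assumption. }
assert (uE : (u ⊠ idm (D : C)) ∘ (he ∘ gmor k2) ≈ he ∘ gmor k2).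
{ rewrite compA, uhe, <- compA, eV, compA, eV2, <- (compA e'), eG2, <- !compA, gV. reflexivity. }
(* [m] maps into [(B ∔ I) ⊗ (A ∔ I)]: on [k1] it puts the unit summand of the first factor beside
   the identity of the second, on [b] the base of the first beside the unit summand of the second.
   [G] collapses the extra factor so that [F] agrees with [he] on both summands, while [u] acts on
   [F] only through [he ∘ k2]. *)
destruct (pcoprod2_ex HS (ins (kunit B) (idm (A : C))) ((kbase B ⊠ kunit A) ∘ rho_inv (gbase B)))
  as (m & m1 & m2).
destruct (coproj_split HC (gp_pcoprod A)) as [_ [pI epI]].
destruct (pcoprod2_ex (dist_r HC (A : C) (gp_pcoprod D)) (kbase D ∘ rho (gbase D) ∘ (idm (gbase D) ⊠ pI))
  (gmor h ∘ gmor k1 ∘ lam (A : C))) as (G & G1 & G2').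
pose (F := (idm J ⊠ G) ∘ alpha J D (A : C) ∘ ((he ∘ gmor k2) ⊠ idm (A : C)) ∘ m).
assert (uF : (u ⊠ idm (D : C)) ∘ F ≈ F).
{ unfold F. rewrite !compA, tensM, comp_idl, comp_idr.
  transitivity ((idm J ⊠ G) ∘ (u ⊠ idm ((D : C) ⊗ (A : C))) ∘ alpha J D (A : C) ∘ ((he ∘ gmor k2) ⊠ idm (A : C)) ∘ m).
  { now rewrite tensM, comp_idl, comp_idr. }
  rewrite <- (compA (idm J ⊠ G)), <- (tens_id (mmon C)), <- alpha_natural.
  rewrite <- !compA, (comp_pull (tensM _ _ _ _)), uE, comp_idl. reflexivity. }
assert (uhe' : (u ⊠ idm (D : C)) ∘ he ≈ he).
{ destruct (@pcoprod2_uniq _ _ _ _ _ _ HS _ F he) as [X [_ eX]].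
  - unfold F. rewrite <- compA, m1. unfold ins at 1.
    rewrite compA, (alpha_tens_ins _ _ Eb), ins_comp, G2', <- compA, lam_invK, comp_idr.
    unfold he. now rewrite <- compA, ea, tens_ins, comp_idl.
  - unfold F. rewrite <- compA, m2, compA, (alpha_tens_ins _ _ Ea), ins_comp, hb.
    rewrite <- (comp_idl (kunit A)), <- tensM, compA, G1.
    rewrite <- !compA, (compA (idm _ ⊠ pI)), !tensM, !comp_idl, epI.
    rewrite (comp_pull (rho_natural _)), <- compA, rho_invK, comp_idr.
    unfold he. now rewrite <- compA, eb, tens_ins, comp_idl, hb.
  - rewrite eX, compA, uF. reflexivity. }
rewrite uhe' in uhe.
assert (fold_he : lam (D : C) ∘ (n ⊠ idm (D : C)) ∘ he ≈ gmor h).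
{ unfold he. rewrite <- (compA (lam _)), (compA (n ⊠ _)), tensM, comp_idl, comp_idr.
  rewrite <- (comp_idl n), <- (comp_idr (gmor h)), <- tensM, !compA, lam_natural.
  rewrite <- !compA, (compA (lam _)), en. reflexivity. }
rewrite <- fold_he at 1. rewrite uhe, compA, fold_he. reflexivity.
Qed.

End Cospan.
End GPCoproducts.

(** * Finite biproducts from binary ones *)

Section FiniteBiproducts.
Variables (C : Category) (zero : forall A B : C, Hom A B).
Hypothesis zeroP : is_zero_arrows zero.

Record strict_biprod2 (A B S : C) (kA : Hom A S) (kB : Hom B S) (pA : Hom S A) (pB : Hom S B) : Prop := {
  sb_AA : pA ∘ kA ≈ idm A;
  sb_AB : pA ∘ kB ≈ zero B A;
  sb_BA : pB ∘ kA ≈ zero A B;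
  sb_BB : pB ∘ kB ≈ idm B;
  sb_copair : forall (X : C) (f : Hom A X) (g : Hom B X), exists h, h ∘ kA ≈ f /\ h ∘ kB ≈ g;
  sb_epi : forall (X : C) (h h' : Hom S X), h ∘ kA ≈ h' ∘ kA -> h ∘ kB ≈ h' ∘ kB -> h ≈ h';
  sb_pair : forall (X : C) (f : Hom X A) (g : Hom X B), exists h, pA ∘ h ≈ f /\ pB ∘ h ≈ g;
  sb_mono : forall (X : C) (h h' : Hom X S), pA ∘ h ≈ pA ∘ h' -> pB ∘ h ≈ pB ∘ h' -> h ≈ h'
}.

Record strict_biprod (J : Type) (X : J -> C) (A : C) (k : forall i, Hom (X i) A)
    (p : forall i, Hom A (X i)) : Prop := {
  sbn_id : forall i, p i ∘ k i ≈ idm (X i);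
  sbn_zero : forall i j, i <> j -> p i ∘ k j ≈ zero (X j) (X i);
  sbn_copair : forall (B : C) (f : forall i, Hom (X i) B), exists h, forall i, h ∘ k i ≈ f i;
  sbn_epi : forall (B : C) (h h' : Hom A B), (forall i, h ∘ k i ≈ h' ∘ k i) -> h ≈ h';
  sbn_pair : forall (B : C) (f : forall i, Hom B (X i)), exists h, forall i, p i ∘ h ≈ f i;
  sbn_mono : forall (B : C) (h h' : Hom B A), (forall i, p i ∘ h ≈ p i ∘ h') -> h ≈ h'
}.

Lemma strict_biprod_is_biproduct (J : Type) (X : J -> C) (A : C) (k : forall i, Hom (X i) A)
    (p : forall i, Hom A (X i)) :
  strict_biprod k p -> is_biproduct zero k p.
Proof.
intros H.
assert (kid : forall U, is_phase k U -> U ≈ idm A).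
{ intros U HU. apply (sbn_epi H). intros i. now rewrite HU, comp_idl. }
assert (pid : forall U, is_phase_of_product p U -> U ≈ idm A).
{ intros U HU. apply (sbn_mono H). intros i. now rewrite HU, comp_idr. }
split; [|exact kid].
split; [apply H|]. split; [apply H|]. split; [|split].
- split; [apply H|]. intros B h h' e. exists (idm A). split.
  + intros i. apply comp_idl.
  + rewrite comp_idr. symmetry. now apply (sbn_epi H).
- split; [apply H|]. intros B h h' e. exists (idm A). split.
  + intros i. apply comp_idr.
  + rewrite comp_idl. symmetry. now apply (sbn_mono H).
- intros U. split; intros HU i.
  + now rewrite (kid U HU), comp_idr.
  + now rewrite (pid U HU), comp_idl.
Qed.

Lemma is_biproduct_strict (J : Type) (X : J -> C) (A : C) (k : forall i, Hom (X i) A)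
    (p : forall i, Hom A (X i)) :
  is_biproduct zero k p -> strict_biprod k p.
Proof.
intros ((b1 & b2 & [b3 b3'] & [b4 b4'] & b5) & b6). split; try assumption.
- intros B h h' e. destruct (b3' B h h' e) as [U [HU eU]].
  now rewrite eU, (b6 U HU), comp_idr.
- intros B h h' e. destruct (b4' B h h' e) as [U [HU eU]].
  apply b5 in HU. now rewrite eU, (b6 U HU), comp_idl.
Qed.

Lemma finite_biproducts :
  (exists Z : C, idm Z ≈ zero Z Z) ->
  (forall A B : C, exists (S : C) (kA : Hom A S) (kB : Hom B S) (pA : Hom S A) (pB : Hom S B),
     strict_biprod2 kA kB pA pB) ->
  forall (n : nat) (X : Fin.t n -> C),
    exists (A : C) (k : forall i, Hom (X i) A) (p : forall i, Hom A (X i)), strict_biprod k p.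
Proof.
intros [Z HZ] H2. induction n as [|n IH]; intros X.
- exists Z, (fun i => Fin.case0 (fun i => Hom (X i) Z) i),
    (fun i => Fin.case0 (fun i => Hom Z (X i)) i).
  split; try (intros i; now apply Fin.case0).
  + intros B f. exists (zero Z B). intros i. now apply Fin.case0.
  + intros B h h' _. rewrite <- (comp_idr h), <- (comp_idr h'), HZ.
    now rewrite !(zero_r zeroP).
  + intros B f. exists (zero B Z). intros i. now apply Fin.case0.
  + intros B h h' _. rewrite <- (comp_idl h), <- (comp_idl h'), HZ.
    now rewrite !(zero_l zeroP).
- destruct (IH (fun i => X (Fin.FS i))) as (A & k & p & H).
  destruct (H2 (X Fin.F1) A) as (S & kA & kB & pA & pB & HS).
  exists S, (fun i => Fin.caseS' i (fun i => Hom (X i) S) kA (fun j => kB ∘ k j)),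
    (fun i => Fin.caseS' i (fun i => Hom S (X i)) pA (fun j => p j ∘ pB)).
  split.
  + intros i. apply (Fin.caseS' i); simpl; [apply HS|]. intros j.
    now rewrite <- compA, (comp_cancel (sb_BB HS)), (sbn_id H).
  + intros i. apply (Fin.caseS' i); simpl.
    * intros j. apply (Fin.caseS' j); simpl; [now intros []|]. intros l _.
      now rewrite compA, (sb_AB HS), (zero_l zeroP).
    * intros i' j. apply (Fin.caseS' j); simpl.
      -- intros _. now rewrite <- compA, (sb_BA HS), (zero_r zeroP).
      -- intros l ne. rewrite <- compA, (comp_cancel (sb_BB HS)).
         apply (sbn_zero H). congruence.
  + intros B f. destruct (sbn_copair H (fun j => f (Fin.FS j))) as [t Ht].
    destruct (sb_copair HS (f Fin.F1) t) as [h [h1 h2]].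
    exists h. intros i. pattern i. apply (Fin.caseS' i); simpl; [assumption|].
    intros j. now rewrite compA, h2.
  + intros B h h' e. apply (sb_epi HS).
    * exact (e Fin.F1).
    * apply (sbn_epi H). intros i. rewrite <- !compA. exact (e (Fin.FS i)).
  + intros B f. destruct (sbn_pair H (fun j => f (Fin.FS j))) as [t Ht].
    destruct (sb_pair HS (f Fin.F1) t) as [h [h1 h2]].
    exists h. intros i. pattern i. apply (Fin.caseS' i); simpl; [assumption|].
    intros j. now rewrite <- compA, h2.
  + intros B h h' e. apply (sb_mono HS).
    * exact (e Fin.F1).
    * apply (sbn_mono H). intros i. rewrite !compA. exact (e (Fin.FS i)).
Qed.

Lemma pcoprod2_of_coproduct (A B S : C) (kA : Hom A S) (kB : Hom B S) :
  (forall (X : C) (f : Hom A X) (g : Hom B X), exists h, h ∘ kA ≈ f /\ h ∘ kB ≈ g) ->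
  (forall (X : C) (h h' : Hom S X), h ∘ kA ≈ h' ∘ kA -> h ∘ kB ≈ h' ∘ kB -> h ≈ h') ->
  is_phased_coproduct2 kA kB.
Proof.
intros H H'. apply pcoprod2_intro; [assumption|].
intros X h h' e e'. exists (idm S). rewrite !comp_idl, comp_idr.
repeat split; try reflexivity. symmetry. now apply H'.
Qed.

End FiniteBiproducts.

(** * Biproducts in [GP(C)] *)

Section GPBiproducts.
Variable C : MonCat.
Hypothesis HC : has_finite_distributive_phased_biproducts C.

#[local] Notation N := (gp_cat C).

Lemma gp_base_compN (A B E : N) (g : Hom B E) (f : Hom A B) :
  gp_base (g ∘ f) ≈ gp_base g ∘ gp_base f.
Proof. exact (gp_base_comp HC g f). Qed.

Lemma gp_base_idN (A : N) : gp_base (idm A : Hom A A) ≈ idm (gbase A).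
Proof. exact (gp_base_id HC A). Qed.

#[local] Instance gp_base_properN (A B : N) :
  Proper (@heq N A B ==> @heq C (gbase A) (gbase B)) (@gp_base C A B).
Proof. intros f g e. exact (gp_base_proper HC e). Qed.

Lemma gp_phaseN (A B : N) (f g : Hom A B) :
  gp_base f ≈ gp_base g -> exists U : Hom A A, gp_base U ≈ idm (gbase A) /\ g ≈ f ∘ U.
Proof.
intros e. destruct (gp_phase e) as [U [HU eU]].
exists U. split; [|exact eU]. now apply (gp_base_phase HC).
Qed.

Lemma gp_transitive (A B : N) (f : Hom A B) (U : Hom A A) :
  gp_base U ≈ idm (gbase A) ->
  exists V : Hom B B, gp_base V ≈ idm (gbase B) /\ f ∘ U ≈ V ∘ f.
Proof.
intros HU. apply (gp_base_phase HC) in HU.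
destruct (phase_transport HC (f := gmor f) (g := gp_base f) (h := idm munit) (U := gmor U)
  (gp_pcoprod A) (gp_pcoprod B)) as [V [HV eV]].
- apply gp_baseE.
- now rewrite gmor_unit, comp_idr.
- assumption.
- pose proof (proj1 (is_phase2E _ _ _) HV) as [v v'].
  rewrite <- (comp_idr (kbase B)) in v at 2.
  exists (@gp_mk C B B V _ v v'). split; [|exact eV].
  exact (gp_base_eq HC (f := @gp_mk C B B V _ v v') v).
Qed.

Lemma gp_cospan_copair (A B T D : N) (k1 : Hom A T) (k2 : Hom B T) (f : Hom A D) (g : Hom B D) :
  is_phased_coproduct2 (gp_base k1) (gp_base k2) -> exists h : Hom T D, h ∘ k1 ≈ f /\ h ∘ k2 ≈ g.
Proof. intros H. exact (gp_coprod_ex HC H f g). Qed.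

Lemma gp_cospan_epi (A B T D : N) (k1 : Hom A T) (k2 : Hom B T) (h h' : Hom T D) :
  is_phased_coproduct2 (gp_base k1) (gp_base k2) ->
  h ∘ k1 ≈ h' ∘ k1 -> h ∘ k2 ≈ h' ∘ k2 -> h ≈ h'.
Proof. intros H e e'. exact (gp_coprod_uniq HC H e e'). Qed.

Lemma gp_sum_ex (A : C) : exists T : N, gbase T = A.
Proof.
destruct (sum_ex HC A munit) as (S & kA & kI & H).
now exists {| gsum := Build_SumWithUnit H |}.
Qed.

Lemma gp_cospan_ex (A B : N) : exists (T : N) (k1 : Hom A T) (k2 : Hom B T),
  is_phased_coproduct2 (gp_base k1) (gp_base k2).
Proof.
destruct (sum_ex HC (gbase A) (gbase B)) as (S & kA & kB & H).
destruct (sum_ex HC S munit) as (S' & kS & kI & H').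
pose (T := {| gsum := Build_SumWithUnit H' |} : GPObj C).
destruct (@gp_ex C HC A T kA) as [k1 e1]. destruct (@gp_ex C HC B T kB) as [k2 e2].
exists T, k1, k2. exact (pcoprod2_proper (symmetry e1) (symmetry e2) H).
Qed.

(** A morphism with zero base agrees with [kunit B ∘ pI] up to a phase of the domain, and [pI]
    absorbs phases. So here the base determines the morphism exactly. *)
Lemma gp_zero_unique (zero : forall A B : C, Hom A B) (A B : N) (f g : Hom A B) :
  is_zero_arrows zero ->
  (forall (n : nat) (X : Fin.t n -> C),
     exists (A : C) (kappa : forall i, Hom (X i) A) (pi : forall i, Hom A (X i)),
       is_phased_biproduct zero kappa pi) ->
  gp_base f ≈ zero _ _ -> gp_base g ≈ zero _ _ -> f ≈ g.
Proof.
intros zP bP.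
destruct (pcoprod2_biprod2 bP (gp_pcoprod A)) as (pA & pI & H).
assert (key : forall h : GPHom A B, gp_base h ≈ zero _ _ -> gmor h ≈ kunit B ∘ pI).
{ intros h e. destruct (@pcoprod2_uniq _ _ _ _ _ _ (gp_pcoprod A) B (kunit B ∘ pI) (gmor h))
    as [U [HU eU]].
  - rewrite gp_baseE, e, <- compA, (bip_BA H). now rewrite !(zero_r zP).
  - now rewrite gmor_unit, <- compA, (bip_BB H), comp_idr.
  - now rewrite eU, <- compA, (proj2 (bip_phase H HU)). }
intros ef eg. apply key in ef, eg.
exact (transitivity ef (symmetry eg)).
Qed.

Section Zero.
Variable zero : forall A B : C, Hom A B.
Hypothesis zP : is_zero_arrows zero.
Hypothesis bP : forall (n : nat) (X : Fin.t n -> C),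
  exists (A : C) (kappa : forall i, Hom (X i) A) (pi : forall i, Hom A (X i)),
    is_phased_biproduct zero kappa pi.

Definition gp_zero (A B : N) : Hom A B :=
  proj1_sig (constructive_indefinite_description _ (@gp_ex C HC A B (zero _ _))).

Lemma gp_zero_base (A B : N) : gp_base (gp_zero A B) ≈ zero _ _.
Proof. exact (proj2_sig (constructive_indefinite_description _ (@gp_ex C HC A B (zero _ _)))). Qed.

Lemma gp_zeroE (A B : N) (f : Hom A B) : gp_base f ≈ zero _ _ -> f ≈ gp_zero A B.
Proof. intros e. exact (gp_zero_unique zP bP e (gp_zero_base A B)). Qed.

Lemma gp_zero_arrows : is_zero_arrows gp_zero.
Proof.
split; intros A B E f; apply gp_zeroE; rewrite gp_base_compN, gp_zero_base.
- apply (zero_l zP).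
- apply (zero_r zP).
Qed.

(* A pair of phases of [A] and [B] acts on [T]; it suffices to correct weak pairings
   by such actions, and a morphism into [T] is recovered from its components as
   [[k1 p1 h, k2 p2 h] Δ]. *)
Lemma gp_strict_biprod2 (A B T : N) (k1 : Hom A T) (k2 : Hom B T) :
  is_phased_coproduct2 (gp_base k1) (gp_base k2) ->
  exists (p1 : Hom T A) (p2 : Hom T B),
    p1 ∘ k1 ≈ idm A /\ p1 ∘ k2 ≈ gp_zero B A /\ p2 ∘ k1 ≈ gp_zero A B /\ p2 ∘ k2 ≈ idm B /\
    (forall (X : N) (f : Hom X A) (g : Hom X B), exists h, p1 ∘ h ≈ f /\ p2 ∘ h ≈ g) /\
    (forall (X : N) (h h' : Hom X T), gp_base p1 ∘ gp_base h ≈ gp_base p1 ∘ gp_base h' ->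
       gp_base p2 ∘ gp_base h ≈ gp_base p2 ∘ gp_base h' ->
       exists Z : Hom T T, gp_base Z ∘ gp_base k1 ≈ gp_base k1 /\
         gp_base Z ∘ gp_base k2 ≈ gp_base k2 /\ h' ≈ Z ∘ h).
Proof.
intros HT.
destruct (gp_cospan_copair (idm A) (gp_zero B A) HT) as (p1 & e11 & e12).
destruct (gp_cospan_copair (gp_zero A B) (idm B) HT) as (p2 & e21 & e22).
exists p1, p2. do 4 (split; [assumption|]).
destruct (pcoprod2_biprod2 bP HT) as (q1 & q2 & H).
(* Projections absorb phases and are therefore determined by their values on coprojections; hence
   the base of [p1] is the projection in [C]. *)
assert (q1E : gp_base p1 ≈ q1).
{ destruct (@pcoprod2_uniq _ _ _ _ _ _ HT _ q1 (gp_base p1)) as [U [HU eU]].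
  - now rewrite (bip_AA H), <- gp_base_compN, e11, gp_base_idN.
  - now rewrite (bip_AB H), <- gp_base_compN, e12, gp_zero_base.
  - now rewrite eU, (proj1 (bip_phase H HU)). }
assert (q2E : gp_base p2 ≈ q2).
{ destruct (@pcoprod2_uniq _ _ _ _ _ _ HT _ q2 (gp_base p2)) as [U [HU eU]].
  - now rewrite (bip_BA H), <- gp_base_compN, e21, gp_zero_base.
  - now rewrite (bip_BB H), <- gp_base_compN, e22, gp_base_idN.
  - now rewrite eU, (proj2 (bip_phase H HU)). }
split.
- intros X f g. destruct (bip_pair H (gp_base f) (gp_base g)) as (h0 & h1 & h2).
  destruct (@gp_ex C HC X T h0) as [h eh].
  destruct (@gp_phaseN X A (p1 ∘ (h : Hom X T)) f) as (U & HU & eU).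
  { now rewrite gp_base_compN, q1E, eh. }
  destruct (@gp_phaseN X B (p2 ∘ (h : Hom X T)) g) as (V & HV & eV).
  { now rewrite gp_base_compN, q2E, eh. }
  destruct (@gp_transitive _ _ (p1 ∘ (h : Hom X T)) U HU) as (U' & _ & eU').
  destruct (@gp_transitive _ _ (p2 ∘ (h : Hom X T)) V HV) as (V' & _ & eV').
  destruct (gp_cospan_copair (k1 ∘ U') (k2 ∘ V') HT) as (Z & z1 & z2).
  assert (pz1 : p1 ∘ Z ≈ U' ∘ p1).
  { apply (gp_cospan_epi HT); rewrite <- !compA.
    - now rewrite z1, e11, (comp_cancel e11), comp_idr.
    - rewrite z2, e12, (comp_pull e12).
      now rewrite (zero_l gp_zero_arrows), (zero_r gp_zero_arrows). }
  assert (pz2 : p2 ∘ Z ≈ V' ∘ p2).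
  { apply (gp_cospan_epi HT); rewrite <- !compA.
    - rewrite z1, e21, (comp_pull e21).
      now rewrite (zero_l gp_zero_arrows), (zero_r gp_zero_arrows).
    - now rewrite z2, e22, (comp_cancel e22), comp_idr. }
  exists (Z ∘ (h : Hom X T)). split.
  + now rewrite compA, pz1, eU, eU', compA.
  + now rewrite compA, pz2, eV, eV', compA.
- intros X h h' e e'. rewrite q1E in e. rewrite q2E in e'.
  destruct (bip_uniq H e e') as (W & HW & eW). apply is_phase2E in HW as [W1 W2].
  destruct (@gp_ex C HC T T W) as [Z0 eZ0].
  destruct (@gp_phaseN X T ((Z0 : Hom T T) ∘ h) h') as (U & HU & eU).
  { now rewrite gp_base_compN, eZ0, eW. }
  destruct (@gp_transitive _ _ h U HU) as (U' & HU' & eU').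
  exists ((Z0 : Hom T T) ∘ U').
  rewrite gp_base_compN, eZ0, HU', comp_idr. split; [assumption|]. split; [assumption|].
  now rewrite eU, <- !compA, eU'.
Qed.

Lemma gp_strict_biprod2_ex (A B T : N) (k1 : Hom A T) (k2 : Hom B T) :
  is_phased_coproduct2 (gp_base k1) (gp_base k2) ->
  exists (p1 : Hom T A) (p2 : Hom T B), strict_biprod2 gp_zero k1 k2 p1 p2.
Proof.
intros HT.
destruct (gp_strict_biprod2 HT) as (p1 & p2 & e11 & e12 & e21 & e22 & pair & weak).
exists p1, p2. split; try assumption.
- intros X f g. now apply gp_cospan_copair.
- intros X h h'. now apply gp_cospan_epi.
(* One has [h = Z ∘ s ∘ d] for an endomorphism [Z] that acts on the summands by [V1] and [V2]. These
   fix the components of [h], because [s ∘ d] has the same components; therefore [Z ∘ s = s]. *)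
- assert (recover : forall (X : N) (D : N) (l1 l2 : Hom X D) (d : Hom X D) (r1 r2 : Hom D X),
    is_phased_coproduct2 (gp_base l1) (gp_base l2) -> r1 ∘ l1 ≈ idm X -> r1 ∘ l2 ≈ gp_zero X X ->
    r2 ∘ l1 ≈ gp_zero X X -> r2 ∘ l2 ≈ idm X -> r1 ∘ d ≈ idm X -> r2 ∘ d ≈ idm X ->
    forall (h : Hom X T) (s : Hom D T), s ∘ l1 ≈ k1 ∘ (p1 ∘ h) -> s ∘ l2 ≈ k2 ∘ (p2 ∘ h) ->
    h ≈ s ∘ d).
  { intros X D l1 l2 d r1 r2 HD r11 r12 r21 r22 d1 d2 h s s1 s2.
    assert (ps1 : p1 ∘ s ≈ p1 ∘ h ∘ r1).
    { apply (gp_cospan_epi HD); rewrite <- !compA.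
      - now rewrite s1, (comp_cancel e11), r11, comp_idr.
      - rewrite s2, (comp_pull e12), r12.
        now rewrite (zero_l gp_zero_arrows), !(zero_r gp_zero_arrows). }
    assert (ps2 : p2 ∘ s ≈ p2 ∘ h ∘ r2).
    { apply (gp_cospan_epi HD); rewrite <- !compA.
      - rewrite s1, (comp_pull e21), r21.
        now rewrite (zero_l gp_zero_arrows), !(zero_r gp_zero_arrows).
      - now rewrite s2, (comp_cancel e22), r22, comp_idr. }
    assert (psd1 : p1 ∘ (s ∘ d) ≈ p1 ∘ h).
    { now rewrite compA, ps1, <- compA, d1, comp_idr. }
    assert (psd2 : p2 ∘ (s ∘ d) ≈ p2 ∘ h).
    { now rewrite compA, ps2, <- compA, d2, comp_idr. }
    destruct (weak X (s ∘ d) h) as (Z & Z1 & Z2 & eZ).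
    { now rewrite <- !gp_base_compN, psd1. }
    { now rewrite <- !gp_base_compN, psd2. }
    destruct (@gp_phaseN A T k1 (Z ∘ k1)) as (V1 & _ & eV1).
    { now rewrite gp_base_compN, Z1. }
    destruct (@gp_phaseN B T k2 (Z ∘ k2)) as (V2 & _ & eV2).
    { now rewrite gp_base_compN, Z2. }
    assert (pZ1 : p1 ∘ Z ≈ V1 ∘ p1).
    { apply (gp_cospan_epi HT); rewrite <- !compA.
      - now rewrite eV1, e11, (comp_cancel e11), comp_idr.
      - rewrite eV2, e12, (comp_pull e12).
        now rewrite (zero_l gp_zero_arrows), (zero_r gp_zero_arrows). }
    assert (pZ2 : p2 ∘ Z ≈ V2 ∘ p2).
    { apply (gp_cospan_epi HT); rewrite <- !compA.
      - rewrite eV1, e21, (comp_pull e21).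
        now rewrite (zero_l gp_zero_arrows), (zero_r gp_zero_arrows).
      - now rewrite eV2, e22, (comp_cancel e22), comp_idr. }
    assert (f1 : V1 ∘ (p1 ∘ h) ≈ p1 ∘ h).
    { rewrite <- psd1 at 1. rewrite compA, <- pZ1, <- compA, <- eZ. reflexivity. }
    assert (f2 : V2 ∘ (p2 ∘ h) ≈ p2 ∘ h).
    { rewrite <- psd2 at 1. rewrite compA, <- pZ2, <- compA, <- eZ. reflexivity. }
    rewrite eZ, compA. apply comp_proper; [|reflexivity].
    apply (gp_cospan_epi HD); rewrite <- compA.
    - now rewrite s1, (comp_pull eV1), <- compA, f1.
    - now rewrite s2, (comp_pull eV2), <- compA, f2. }
  intros X h h' e e'.
  destruct (gp_cospan_ex X X) as (D & l1 & l2 & HD).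
  destruct (gp_strict_biprod2 HD) as (r1 & r2 & r11 & r12 & r21 & r22 & rpair & _).
  destruct (rpair X (idm X) (idm X)) as (d & d1 & d2).
  destruct (gp_cospan_copair (k1 ∘ (p1 ∘ h)) (k2 ∘ (p2 ∘ h)) HD) as (s & s1 & s2).
  rewrite (recover X D l1 l2 d r1 r2 HD r11 r12 r21 r22 d1 d2 h s s1 s2).
  symmetry. apply (recover X D l1 l2 d r1 r2 HD r11 r12 r21 r22 d1 d2 h' s).
  + now rewrite s1, e.
  + now rewrite s2, e'.
Qed.

Lemma gp_finite_biproducts (n : nat) (X : Fin.t n -> N) :
  exists (A : N) (k : forall i, Hom (X i) A) (p : forall i, Hom A (X i)),
    is_biproduct gp_zero k p.
Proof.
destruct (@finite_biproducts N gp_zero gp_zero_arrows) with (n := n) (X := X)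
  as (A & k & p & H).
- destruct (zero_object_ex zP bP) as [Z0 HZ]. destruct (gp_sum_ex Z0) as [Z <-].
  exists Z. apply gp_zeroE. now rewrite gp_base_idN.
- intros A B. destruct (gp_cospan_ex A B) as (T & k1 & k2 & H).
  destruct (gp_strict_biprod2_ex H) as (p1 & p2 & H'). now exists T, k1, k2, p1, p2.
- exists A, k, p. now apply strict_biprod_is_biproduct.
Qed.

End Zero.
End GPBiproducts.

(** * [GP(C)] as a monoidal category with global phases *)

(** Whether a cospan of [GP(C)] is a coproduct can be read off its base components, and coproducts
    have no phase but the identity, so the lifting of phases is immediate. *)
Lemma gp_strongly_preserves (C : MonCat) (F : Functor (gp_cat C) (gp_cat C)) :
  has_finite_distributive_phased_biproducts C ->
  (forall (A B T : gp_cat C) (k1 : Hom A T) (k2 : Hom B T),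
     is_phased_coproduct2 (gp_base k1) (gp_base k2) ->
     is_phased_coproduct2 (gp_base (fmap F k1)) (gp_base (fmap F k2))) ->
  strongly_preserves_phased_coproducts F.
Proof.
intros HC HF. apply strongly_preserves_of_one. intros A B.
destruct (gp_cospan_ex HC A B) as (T & k1 & k2 & HT). exists T, k1, k2.
specialize (HF A B T k1 k2 HT). split; [|split].
- apply pcoprod2_of_coproduct.
  + intros X f g. exact (gp_cospan_copair HC f g HT).
  + intros X h h'. exact (gp_cospan_epi HC HT).
- apply pcoprod2_of_coproduct.
  + intros X f g. exact (gp_cospan_copair HC f g HF).
  + intros X h h'. exact (gp_cospan_epi HC HF).
- intros V HV. apply is_phase2E in HV as [V1 V2].
  exists (idm T). split; [apply phase2_id|]. rewrite fmap_id.
  apply (gp_cospan_epi HC HF); rewrite comp_idl; assumption.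
Qed.

Section GPMonoidal.
Variables (C : MonCat) (ch : GPChoice C) (S : GPStructure ch).
Hypothesis HC : has_finite_distributive_phased_biproducts C.

#[local] Instance gp_base_properS (A B : GP S) :
  Proper (@heq (GP S) A B ==> @heq C (gbase A) (gbase B)) (@gp_base C A B).
Proof. intros f g e. exact (gp_base_proper HC e). Qed.

Lemma GP_tensE (A A' B B' : GP S) (f : Hom A A') (g : Hom B B') :
  ch_c ch A' B' ∘ gmor (f ⊠ g) ≈ (gmor f ⊠ gmor g) ∘ ch_c ch A B.
Proof. apply (proj2 (gp_tens_unique S f g _)). reflexivity. Qed.

Lemma GP_tens_uniq (A A' B B' : GP S) (f : Hom A A') (g : Hom B B') (h : Hom (A ⊗ B) (A' ⊗ B')) :
  ch_c ch A' B' ∘ gmor h ≈ (gmor f ⊠ gmor g) ∘ ch_c ch A B -> h ≈ f ⊠ g.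
Proof. exact (proj1 (gp_tens_unique S f g h)). Qed.

Lemma GP_alphaE (A B E : GP S) :
  (idm ((A : GPObj C) : C) ⊠ ch_c ch B E) ∘ ch_c ch A (ch_tens ch B E) ∘ gmor (alpha A B E)
  ≈ alpha ((A : GPObj C) : C) ((B : GPObj C) : C) ((E : GPObj C) : C)
    ∘ (ch_c ch A B ⊠ idm ((E : GPObj C) : C)) ∘ ch_c ch (ch_tens ch A B) E.
Proof. apply (proj2 (gp_asc_unique S _)). reflexivity. Qed.

Lemma GP_tens_base (A A' B B' : GP S) (f : Hom A A') (g : Hom B B') :
  @heq C (gbase A ⊗ gbase B) (gbase A' ⊗ gbase B') (gp_base (f ⊠ g)) (gp_base f ⊠ gp_base g).
Proof.
apply (@gp_base_eq C HC (ch_tens ch A B) (ch_tens ch A' B') (f ⊠ g) (gp_base f ⊠ gp_base g)).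
apply (split_mono_cancel (ch_c_split HC ch A' B')).
refine (transitivity _ (transitivity (tens_square (gp_baseE f) (gp_baseE g)
  (ch_c_base ch A B) (ch_c_base ch A' B')) _)).
- exact (transitivity (compA _ _ _) (comp_proper (GP_tensE f g) (reflexivity _))).
- exact (symmetry (compA _ _ _)).
Qed.

Lemma GP_alpha_base (A B E : GP S) :
  @heq C (gbase A ⊗ gbase B ⊗ gbase E) (gbase A ⊗ (gbase B ⊗ gbase E))
    (gp_base (alpha A B E)) (alpha (gbase A) (gbase B) (gbase E)).
Proof.
apply (@gp_base_eq C HC (ch_tens ch (ch_tens ch A B) E) (ch_tens ch A (ch_tens ch B E))
  (alpha A B E) (alpha (gbase A) (gbase B) (gbase E))).
apply (split_mono_cancel (ch_c_assoc_split HC ch A B E)).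
refine (transitivity _ (transitivity (alpha_square (ch_c_base ch A B) (ch_c_base ch B E)
  (ch_c_base ch (ch_tens ch A B) E) (ch_c_base ch A (ch_tens ch B E))) _)).
- exact (transitivity (compA _ _ _) (comp_proper (GP_alphaE A B E) (reflexivity _))).
- exact (symmetry (compA _ _ _)).
Qed.

Lemma GP_biproducts : has_finite_distributive_biproducts (GP S).
Proof.
pose proof HC as (zero & [zP [zl zr]] & bP & _).
exists (gp_zero HC zero). split; [split; [|split]|split].
- exact (gp_zero_arrows HC zP bP).
- intros A A' B B' f. apply (gp_zeroE HC zP bP).
  refine (transitivity (GP_tens_base _ _) _).
  now rewrite (gp_zero_base HC zero A A'), zl.
- intros A A' B B' f. apply (gp_zeroE HC zP bP).
  refine (transitivity (GP_tens_base _ _) _).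
  now rewrite (gp_zero_base HC zero B B'), zr.
- exact (gp_finite_biproducts HC zP bP).
- intros E. split; apply gp_strongly_preserves; try exact HC; intros A B T k1 k2 HT.
  + refine (@pcoprod2_proper C (gbase E ⊗ gbase A) (gbase E ⊗ gbase B) (gbase E ⊗ gbase T)
      _ _ _ _ _ _ (dist_l HC (gbase E) HT)); symmetry;
    refine (transitivity (GP_tens_base (idm E) _) (tens_cong _ (reflexivity _)));
    apply (gp_base_idN HC).
  + refine (@pcoprod2_proper C (gbase A ⊗ gbase E) (gbase B ⊗ gbase E) (gbase T ⊗ gbase E)
      _ _ _ _ _ _ (dist_r HC (gbase E) HT)); symmetry;
    refine (transitivity (GP_tens_base _ (idm E)) (tens_cong (reflexivity _) _));
    apply (gp_base_idN HC).
Qed.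

Lemma GP_phasesE (u : scalar (GP S)) : GP_phases S u <-> gp_base u ≈ idm (munit : C).
Proof. exact (gp_base_phase HC (A := ch_unit ch) u). Qed.

Let base_id_conj (A B : GP S) (f : Hom A B) (g : Hom B A) (U : Hom B B) :
  g ∘ f ≈ idm A -> gp_base U ≈ idm (gbase B) -> gp_base (g ∘ U ∘ f) ≈ idm (gbase A).
Proof.
intros e eU. rewrite !(gp_base_compN HC), eU, comp_idr, <- (gp_base_compN HC), e.
apply (gp_base_idN HC).
Qed.

Lemma lscale_base (u : scalar (GP S)) (A B : GP S) (f : Hom A B) :
  GP_phases S u -> gp_base (lscale u f) ≈ gp_base f.
Proof.
intros Hu. apply GP_phasesE in Hu.
rewrite <- (lscale_id f) at 2. unfold lscale. rewrite !(gp_base_compN HC).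
apply comp_proper; [|reflexivity]. apply comp_proper; [reflexivity|].
refine (transitivity (GP_tens_base u f) (symmetry (transitivity (GP_tens_base _ f) _))).
apply tens_cong; [|reflexivity].
rewrite (gp_base_idN HC). now symmetry.
Qed.

(** The unitor carries the phase to the tensor of the unit with [A], and [c] carries it on to
    [(I ∔ I) ⊗ (A ∔ I)], where by strong distributivity it comes from a phase of [I ∔ I]. *)
Lemma phase_lscale (A : GP S) (U : Hom A A) :
  gp_base U ≈ idm (gbase A) -> exists u : scalar (GP S), GP_phases S u /\ U ≈ lscale u (idm A).
Proof.
intros HU. pose (V := lam_inv A ∘ U ∘ lam A).
assert (HV : gp_base V ≈ idm (gbase (munit ⊗ A : GP S))) by exact (base_id_conj (lamK A) HU).
apply (gp_base_phase HC) in HV.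
destruct (phase_transport HC (f := ch_c ch (ch_unit ch) A) (g := idm munit ⊠ kbase A)
  (h := (idm munit ⊠ kunit A) ∘ rho_inv munit) (U := gmor V) (gp_pcoprod (ch_tens ch (ch_unit ch) A))
  (dist_r HC A (gp_pcoprod (ch_unit ch)))) as [W [HW eW]].
- refine (transitivity (ch_c_base ch (ch_unit ch) A) _).
  refine (symmetry (transitivity (tensM _ _ _ _) _)).
  exact (tens_cong (comp_idr _) (comp_idl _)).
- rewrite ch_c_unit, compA, tensM. now rewrite comp_idl, comp_idr.
- assumption.
- destruct (dist_r_phase HC (gp_pcoprod (ch_unit ch)) HW) as [u0 [Hu0 eu0]].
  pose proof (proj1 (is_phase2E _ _ _) Hu0) as [u1 u2].
  assert (u1' : u0 ∘ kbase (ch_unit ch) ≈ kbase (ch_unit ch) ∘ idm munit).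
  { refine (transitivity u1 (symmetry _)). apply comp_idr. }
  exists (@gp_mk C (ch_unit ch) (ch_unit ch) u0 (idm munit) u1' u2). split; [exact Hu0|].
  assert (eV : V ≈ (@gp_mk C (ch_unit ch) (ch_unit ch) u0 (idm munit) u1' u2 : scalar (GP S)) ⊠ idm A).
  { apply GP_tens_uniq. rewrite eW, eu0. reflexivity. }
  unfold lscale. rewrite <- eV. unfold V.
  rewrite <- !compA, (comp_cancel (lam_invK A)), lam_invK. now rewrite comp_idr.
Qed.

Lemma phase_rscale (A : GP S) (U : Hom A A) :
  gp_base U ≈ idm (gbase A) -> exists u : scalar (GP S), GP_phases S u /\ U ≈ rscale (idm A) u.
Proof.
intros HU. pose (V := rho_inv A ∘ U ∘ rho A).
assert (HV : gp_base V ≈ idm (gbase (A ⊗ munit : GP S))) by exact (base_id_conj (rhoK A) HU).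
apply (gp_base_phase HC) in HV.
destruct (phase_transport HC (f := ch_c ch A (ch_unit ch)) (g := kbase A ⊠ idm munit)
  (h := (kunit A ⊠ idm munit) ∘ rho_inv munit) (U := gmor V) (gp_pcoprod (ch_tens ch A (ch_unit ch)))
  (dist_l HC A (gp_pcoprod (ch_unit ch)))) as [W [HW eW]].
- refine (transitivity (ch_c_base ch A (ch_unit ch)) _).
  refine (symmetry (transitivity (tensM _ _ _ _) _)).
  exact (tens_cong (comp_idl _) (comp_idr _)).
- rewrite ch_c_unit, compA, tensM. now rewrite comp_idl, comp_idr.
- assumption.
- destruct (dist_l_phase HC (gp_pcoprod (ch_unit ch)) HW) as [u0 [Hu0 eu0]].
  pose proof (proj1 (is_phase2E _ _ _) Hu0) as [u1 u2].
  assert (u1' : u0 ∘ kbase (ch_unit ch) ≈ kbase (ch_unit ch) ∘ idm munit).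
  { refine (transitivity u1 (symmetry _)). apply comp_idr. }
  exists (@gp_mk C (ch_unit ch) (ch_unit ch) u0 (idm munit) u1' u2). split; [exact Hu0|].
  assert (eV : V ≈ idm A ⊠ (@gp_mk C (ch_unit ch) (ch_unit ch) u0 (idm munit) u1' u2 : scalar (GP S))).
  { apply GP_tens_uniq. rewrite eW, eu0. reflexivity. }
  unfold rscale. rewrite <- eV. unfold V.
  rewrite <- !compA, (comp_cancel (rho_invK A)), rho_invK. now rewrite comp_idr.
Qed.

(* On the biproduct of [A] and the unit the phase [u] acts on the left as some [v]
   acts on the right; restricting to the unit gives [u ≈ v]. *)
Lemma GP_phase_central (u : scalar (GP S)) : GP_phases S u -> central u.
Proof.
intros Hu A B f. rewrite lscale_comp_idl, rscale_comp_idl. apply comp_proper; [reflexivity|].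
pose proof HC as (zero & [zP _] & bP & _).
destruct (gp_cospan_ex HC A (munit : GP S)) as (T & k1 & k2 & HT).
destruct (gp_strict_biprod2_ex HC zP bP HT) as (p1 & p2 & H).
destruct (@phase_rscale T (lscale u (idm T))) as (v & Hv & ev).
{ rewrite (lscale_base _ Hu). apply (gp_base_idN HC). }
assert (key : forall (X : GP S) (k : Hom X T) (p : Hom T X), p ∘ k ≈ idm X ->
  lscale u (idm X) ≈ rscale (idm X) v).
{ intros X k p e. apply (split_mono_cancel (f := k)); [now exists p|].
  rewrite <- lscale_comp_idl, lscaleE, ev, <- rscale_comp_idr. apply rscale_comp_idl. }
assert (uv : u ≈ v).
{ rewrite <- (lscale_unit u), <- (rscale_unit v). exact (key munit k2 p2 (sb_BB H)). }
rewrite (key A k1 p1 (sb_AA H)). unfold rscale. now rewrite uv.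
Qed.

Lemma GP_global_phases : is_global_phases (GP_phases S).
Proof.
split.
- intros u v e. now rewrite !GP_phasesE, e.
- intros u Hu. apply GP_phasesE in Hu. apply gp_iso.
  exact (iso_proper (symmetry Hu) (iso_id _)).
- exact GP_phase_central.
- apply GP_phasesE. apply (gp_base_idN HC).
- intros u v Hu Hv. apply GP_phasesE in Hu, Hv. apply GP_phasesE.
  rewrite (gp_base_compN HC), Hu, Hv. apply comp_idl.
- intros u v Hu [e _]. apply GP_phasesE in Hu. apply GP_phasesE.
  refine (transitivity (symmetry (comp_idr (gp_base v))) _).
  refine (transitivity (comp_proper (reflexivity _) (symmetry Hu)) _).
  refine (transitivity (symmetry (gp_base_compN HC v u)) _).
  exact (transitivity (gp_base_proper HC e) (gp_base_idN HC _)).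
Qed.

Definition GP_base_functor : Functor (quotient GP_global_phases) C.
Proof.
refine {| fobj := (fun A : GPObj C => gbase A) : quotient GP_global_phases -> C;
          fmap := fun A B f => gp_base (f : GPHom A B) |}.
- intros A B f g (u & Hu & e).
  refine (transitivity (gp_base_proper HC e) _). exact (lscale_base g Hu).
- intros A. exact (gp_base_id HC A).
- intros A B E g f. exact (gp_base_comp HC g f).
Defined.

Lemma GP_base_equivalence : is_equivalence GP_base_functor.
Proof.
apply equivalence_of_ff.
- intros A B g. exact (gp_ex HC g).
- intros A B f g e. destruct (gp_phaseN HC (symmetry e)) as (U & HU & eU).
  destruct (phase_lscale (A := A) HU) as (u & Hu & eu).
  exists u. split; [assumption|].
  rewrite lscale_comp_idl, <- eu. exact eU.
- intros B. destruct (gp_sum_ex HC B) as [T <-]. exists T, (idm _). apply iso_id.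
Qed.

(** The base of a tensor is by construction the tensor of the bases, and the base of the unit is
    [I]. So the comparison is the identity, and only the bases of [f ⊠ g] and of the associator have
    to be known. *)
Lemma GP_quotient_equivalent : monoidally_equivalent (quotient GP_global_phases) C.
Proof.
destruct (@monfunctor_of_semi (quotient GP_global_phases) C GP_base_functor
  (fun A B => idm (gbase A ⊗ gbase B))) as [F eF].
- intros A B. apply iso_id.
- intros A A' B B' f g. refine (transitivity (comp_idl _) (transitivity _ (symmetry (comp_idr _)))).
  exact (symmetry (GP_tens_base f g)).
- intros A B E.
  assert (e : forall X Y Z : C, idm X ⊠ idm (Y ⊗ Z) ≈ idm (X ⊗ (Y ⊗ Z))) by (intros; apply tens_id).
  assert (e' : forall X Y Z : C, idm (X ⊗ Y) ⊠ idm Z ≈ idm (X ⊗ Y ⊗ Z)) by (intros; apply tens_id).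
  refine (transitivity (comp_proper (comp_idr _) (e' _ _ _)) _).
  refine (transitivity (comp_idr _) _).
  refine (transitivity (GP_alpha_base A B E) _). symmetry.
  refine (transitivity (comp_proper (comp_idl _) (reflexivity _)) _).
  refine (transitivity (comp_proper (e _ _ _) (reflexivity _)) _). apply comp_idl.
- exists (idm munit). apply iso_id.
- exists F. rewrite eF. exact GP_base_equivalence.
Qed.

End GPMonoidal.

(** * Functoriality of the quotient *)

Lemma ups_is_iso (M N : MonCat) (F : MonFunctor M N) : is_iso (ups F).
Proof. exists (ups_inv F). apply ups_iso. Qed.

Lemma fmap_lscale (M N : MonCat) (F : MonFunctor M N) (u : scalar M) (A B : M) (f : Hom A B) :
  fmap F (lscale u f) ≈ lscale (ups_inv F ∘ fmap F u ∘ ups F) (fmap F f).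
Proof.
apply (iso_epi (lam_iso (F A))).
transitivity (lam (F B) ∘ ((ups_inv F ∘ fmap F u ∘ ups F) ⊠ fmap F f)).
2: { unfold lscale. rewrite <- (compA _ (lam_inv _) (lam _)), lamK. now rewrite comp_idr. }
unfold lscale. rewrite !fmap_comp, <- !mu_lam, <- !compA.
rewrite (compA (fmap F (lam_inv A))), <- fmap_comp, lamK, fmap_id, comp_idl.
apply comp_proper; [reflexivity|].
rewrite (compA (fmap F (u ⊠ f))), <- mu_nat, <- !compA, !tensM, comp_idl, comp_idr.
now rewrite (comp_cancel (proj2 (ups_iso F))).
Qed.

Lemma mu_unit (M N : MonCat) (F : MonFunctor M N) :
  mu F munit munit ∘ (ups F ⊠ ups F) ∘ rho_inv munit ≈ fmap F (rho_inv munit) ∘ ups F.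
Proof.
apply (split_mono_cancel (iso_split_mono (iso_fmap F (rho_iso munit)))).
rewrite (compA _ (fmap F (rho_inv munit))), <- fmap_comp, rho_invK, fmap_id, comp_idl.
transitivity (rho (F munit) ∘ (ups F ⊠ idm munit) ∘ rho_inv munit).
- rewrite <- mu_rho, <- !compA, (comp_pull (tensM _ _ _ _)). now rewrite comp_idl, comp_idr.
- rewrite rho_natural, <- compA, rho_invK. apply comp_idr.
Qed.

Section QuotientFunctor.
Variables (D : MonCat) (P : scalar D -> Prop) (HP : is_global_phases P)
          (D' : MonCat) (P' : scalar D' -> Prop) (HP' : is_global_phases P').
Variable F : MonFunctor D D'.
Hypothesis HF : is_equivalence F.
Hypothesis FP : forall u, P u <-> P' (ups_inv F ∘ fmap F u ∘ ups F).

Definition quotient_functor : Functor (quotient HP) (quotient HP').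
Proof.
refine (@Build_Functor (quotient HP) (quotient HP') (fun A : D => F A)
  (fun A B f => fmap F f) _ _ _).
- intros A B f g (u & Hu & e). exists (ups_inv F ∘ fmap F u ∘ ups F).
  split; [now apply FP|]. now rewrite e, fmap_lscale.
- intros A. exact (qeq_heq HP' (fmap_id F A)).
- intros A B E g f. exact (qeq_heq HP' (fmap_comp F g f)).
Defined.

Lemma iso_quotient (A B : D') (f : Hom A B) : is_iso f -> @is_iso (quotient HP') A B f.
Proof. intros [g [e e']]. exists g. exact (conj (qeq_heq HP' e) (qeq_heq HP' e')). Qed.

Lemma quotient_functor_equivalence : is_equivalence quotient_functor.
Proof.
apply equivalence_of_ff.
- intros A B g. destruct (equivalence_full HF g) as [f e].
  exists f. exact (qeq_heq HP' e).
- intros A B f g (v & Hv & e).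
  (* Faithfulness modulo phases needs every scalar in [P'] to be the transport of one in [P]:
     fullness provides the scalar, and [FP] read backwards its membership. *)
  destruct (equivalence_full HF (ups F ∘ v ∘ ups_inv F)) as [u eu].
  assert (uv : ups_inv F ∘ fmap F u ∘ ups F ≈ v).
  { rewrite eu, <- !compA, (proj1 (ups_iso F)), comp_idr.
    now rewrite (comp_cancel (proj1 (ups_iso F))). }
  exists u. split.
  + apply FP. now apply (gph_proper HP' uv).
  + apply (equivalence_faithful HF). rewrite fmap_lscale.
    change (@heq D' (F A) (F B) (fmap F f) (lscale v (fmap F g))) in e.
    rewrite e. now apply lscale_ext.
- intros B. destruct (equivalence_ess_surj HF B) as (A & f & Hf).
  exists A, f. exact (iso_quotient Hf).
Qed.

Lemma quotient_equivalent : monoidally_equivalent (quotient HP) (quotient HP').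
Proof.
destruct (@monfunctor_of_semi (quotient HP) (quotient HP') quotient_functor (fun A B => mu F A B))
  as [G eG].
- intros A B. exact (iso_quotient (mu_iso F A B)).
- intros A A' B B' f g. exact (qeq_heq HP' (mu_nat F f g)).
- intros A B E. exact (qeq_heq HP' (mu_assoc F A B E)).
- exists (ups F). exact (iso_quotient (ups_is_iso F)).
- exists G. rewrite eG. exact quotient_functor_equivalence.
Qed.

End QuotientFunctor.

(** * Functoriality of [GP] *)

Lemma equivalence_pcoprod2 (C D : Category) (F : Functor C D) (A B S : C) (kA : Hom A S)
    (kB : Hom B S) :
  is_equivalence F -> is_phased_coproduct2 kA kB ->
  is_phased_coproduct2 (fmap F kA) (fmap F kB).
Proof.
intros HF HS. apply pcoprod2_intro.
- intros X f g. destruct (equivalence_ess_surj HF X) as (Y & e & e' & e1 & e2).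
  destruct (equivalence_full HF (e' ∘ f)) as [f0 ef].
  destruct (equivalence_full HF (e' ∘ g)) as [g0 eg].
  destruct (pcoprod2_ex HS f0 g0) as (h & h1 & h2).
  exists (e ∘ fmap F h). rewrite <- !compA, <- !fmap_comp, h1, h2, ef, eg.
  now rewrite !(comp_cancel e2).
- intros X h h' eA eB. destruct (equivalence_ess_surj HF X) as (Y & e & e' & e1 & e2).
  destruct (equivalence_full HF (e' ∘ h)) as [h0 eh].
  destruct (equivalence_full HF (e' ∘ h')) as [h0' eh'].
  destruct (@pcoprod2_uniq _ _ _ _ _ _ HS Y h0 h0') as [U [HU eU]].
  + apply (equivalence_faithful HF). now rewrite !fmap_comp, eh, eh', <- !compA, eA.
  + apply (equivalence_faithful HF). now rewrite !fmap_comp, eh, eh', <- !compA, eB.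
  + apply is_phase2E in HU as [U1 U2]. exists (fmap F U).
    rewrite <- !fmap_comp, U1, U2. split; [reflexivity|]. split; [reflexivity|].
    rewrite <- (comp_idl h'), <- e2, <- compA, <- eh', eU, fmap_comp, eh.
    now rewrite (compA e), (comp_cancel e2).
Qed.

Lemma conj_id (C : Category) (X Y : C) (a : Hom X Y) (a' : Hom Y X) (y : Hom Y Y) :
  a' ∘ a ≈ idm X -> a ∘ a' ≈ idm Y -> a' ∘ y ∘ a ≈ idm X <-> y ≈ idm Y.
Proof.
intros e e'. split; intros ey.
- assert (ey' : y ∘ a ≈ a).
  { rewrite <- (comp_idr a) at 2. rewrite <- ey, <- !compA. now rewrite (comp_cancel e'). }
  rewrite <- (comp_idr y), <- e', compA. now rewrite ey'.
- now rewrite ey, comp_idr.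
Qed.

(** The unit isomorphism obtained from [monfunctor_of_semi] is not explicit. Being a phase does not
    depend on it, since having an identity base is invariant under conjugation. *)
Lemma GP_phases_conj (C : MonCat) (ch : GPChoice C) (S : GPStructure ch) (X : GP S)
    (w : Hom munit X) (w' : Hom X munit) (x : Hom X X) :
  has_finite_distributive_phased_biproducts C -> inverse_pair w w' ->
  GP_phases S (w' ∘ x ∘ w) <-> gp_base x ≈ idm (gbase X).
Proof.
intros HC [e e'].
assert (b1 : gp_base w' ∘ gp_base w ≈ idm _).
{ refine (transitivity (symmetry (gp_base_compN HC w' w)) _).
  exact (transitivity (gp_base_proper HC e) (gp_base_idN HC _)). }
assert (b2 : gp_base w ∘ gp_base w' ≈ idm _).
{ refine (transitivity (symmetry (gp_base_compN HC w w')) _).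
  exact (transitivity (gp_base_proper HC e') (gp_base_idN HC _)). }
assert (b3 : gp_base (w' ∘ x ∘ w) ≈ gp_base w' ∘ gp_base x ∘ gp_base w).
{ refine (transitivity (gp_base_compN HC (w' ∘ x) w) _).
  exact (comp_proper (gp_base_compN HC w' x) (reflexivity _)). }
rewrite (GP_phasesE HC), <- (conj_id (gp_base x) b1 b2).
split; intros ex; [exact (transitivity (symmetry b3) ex)|exact (transitivity b3 ex)].
Qed.

(** Five commuting faces of a cube force the sixth when the last edge [d2] is a split monomorphism.
    This gives naturality of a lifted comparison; associativity follows likewise from
    [hexagon_cancel], the two prisms tracing each side back to the comparison being lifted. *)
Lemma cube_cancel (C : Category) (P1 P2 Q1 Q2 R1 R2 S1 S2 : C) (m1 : Hom P1 Q1) (m2 : Hom P2 Q2)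
    (t : Hom P1 P2) (t' : Hom Q1 Q2) (d1 : Hom Q1 R1) (d2 : Hom Q2 R2) (c1 : Hom P1 S1)
    (c2 : Hom P2 S2) (n1 : Hom S1 R1) (n2 : Hom S2 R2) (s : Hom S1 S2) (s' : Hom R1 R2) :
  split_mono d2 -> d1 ∘ m1 ≈ n1 ∘ c1 -> d2 ∘ m2 ≈ n2 ∘ c2 -> c2 ∘ t ≈ s ∘ c1 ->
  d2 ∘ t' ≈ s' ∘ d1 -> n2 ∘ s ≈ s' ∘ n1 -> m2 ∘ t ≈ t' ∘ m1.
Proof.
intros H e1 e2 e3 e4 e5. apply (split_mono_cancel H).
rewrite !compA, e2, e4, <- !compA, e3, e1, !compA. now rewrite e5.
Qed.

Lemma prism_r (M : MonCat) (P0 Q0 R0 S0 E P1 Q1 U O V : M) (d : Hom Q0 R0) (m0 : Hom P0 Q0)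
    (n0 : Hom S0 R0) (c0 : Hom P0 S0) (dd : Hom Q1 U) (m1 : Hom P1 Q1) (nQ : Hom (Q0 ⊗ E) U)
    (c1 : Hom P1 (Q0 ⊗ E)) (dE : Hom U V) (nR : Hom (R0 ⊗ E) V) (n1 : Hom O P1)
    (c1' : Hom O (P0 ⊗ E)) :
  d ∘ m0 ≈ n0 ∘ c0 -> dd ∘ m1 ≈ nQ ∘ c1 -> nR ∘ (d ⊠ idm E) ≈ dE ∘ nQ ->
  c1 ∘ n1 ≈ (m0 ⊠ idm E) ∘ c1' ->
  dE ∘ dd ∘ (m1 ∘ n1) ≈ nR ∘ (n0 ⊠ idm E) ∘ ((c0 ⊠ idm E) ∘ c1').
Proof.
intros e0 e1 e2 e3.
rewrite <- !compA, (comp_pull e1), <- compA, e3, (comp_pull (symmetry e2)), <- !compA.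
apply comp_proper; [reflexivity|]. rewrite !compA, !tensM, e0. now rewrite !comp_idl.
Qed.

Lemma prism_l (M : MonCat) (P0 Q0 R0 S0 E P1 Q1 U O V : M) (d : Hom Q0 R0) (m0 : Hom P0 Q0)
    (n0 : Hom S0 R0) (c0 : Hom P0 S0) (dd : Hom Q1 U) (m1 : Hom P1 Q1) (nQ : Hom (E ⊗ Q0) U)
    (c1 : Hom P1 (E ⊗ Q0)) (dE : Hom U V) (nR : Hom (E ⊗ R0) V) (n1 : Hom O P1)
    (c1' : Hom O (E ⊗ P0)) :
  d ∘ m0 ≈ n0 ∘ c0 -> dd ∘ m1 ≈ nQ ∘ c1 -> nR ∘ (idm E ⊠ d) ≈ dE ∘ nQ ->
  c1 ∘ n1 ≈ (idm E ⊠ m0) ∘ c1' ->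
  dE ∘ dd ∘ (m1 ∘ n1) ≈ nR ∘ (idm E ⊠ n0) ∘ ((idm E ⊠ c0) ∘ c1').
Proof.
intros e0 e1 e2 e3.
rewrite <- !compA, (comp_pull e1), <- compA, e3, (comp_pull (symmetry e2)), <- !compA.
apply comp_proper; [reflexivity|]. rewrite !compA, !tensM, e0. now rewrite !comp_idl.
Qed.

Lemma hexagon_cancel (C : Category) (O1 O2 P1 P2 Q1 Q2 V W X1 X2 : C) (a : Hom Q1 Q2)
    (m1 : Hom P1 Q1) (n1 : Hom O1 P1) (m2 : Hom P2 Q2) (n2 : Hom O2 P2) (a' : Hom O1 O2)
    (y : Hom Q2 W) (z : Hom Q1 V) (b : Hom V W) (f1 : Hom X1 V) (x1 : Hom O1 X1)
    (f2 : Hom X2 W) (x2 : Hom O2 X2) (b' : Hom X1 X2) :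
  split_mono y -> y ∘ a ≈ b ∘ z -> z ∘ (m1 ∘ n1) ≈ f1 ∘ x1 -> y ∘ (m2 ∘ n2) ≈ f2 ∘ x2 ->
  x2 ∘ a' ≈ b' ∘ x1 -> b ∘ f1 ≈ f2 ∘ b' -> a ∘ m1 ∘ n1 ≈ m2 ∘ n2 ∘ a'.
Proof.
intros H e1 e2 e3 e4 e5. apply (split_mono_cancel H).
rewrite (compA y (m2 ∘ n2)), e3, <- !compA, e4, (comp_pull e1), <- compA, e2.
now rewrite !compA, e5.
Qed.

(** * The functor [GP(F)] induced by a monoidal equivalence [F] *)

Section GPFunctor.
Variables (C C' : MonCat).
Hypothesis HC : has_finite_distributive_phased_biproducts C.
Hypothesis HC' : has_finite_distributive_phased_biproducts C'.
Variable F : MonFunctor C C'.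
Hypothesis HF : is_equivalence F.

(** Precomposing with [ups F] makes the second summand the unit of [C'] itself rather than [F I]. *)
Lemma gpf_pcoprod (A : GPObj C) :
  is_phased_coproduct2 (fmap F (kbase A)) (fmap F (kunit A) ∘ ups F).
Proof.
apply (pcoprod2_transport (f := idm _) (g := idm _) (h := ups_inv F)
  (equivalence_pcoprod2 HF (gp_pcoprod A))).
- now rewrite comp_idl, comp_idr.
- now rewrite comp_idl, <- compA, (proj2 (ups_iso F)), comp_idr.
- apply iso_id.
- apply iso_id.
- exists (ups F). destruct (ups_iso F). now split.
Qed.

Definition gpf_obj (A : GPObj C) : GPObj C' :=
  {| gsum := Build_SumWithUnit (gpf_pcoprod A) |}.

Lemma gpf_base (A B : GPObj C) (f : GPHom A B) :
  fmap F (gmor f) ∘ kbase (gpf_obj A) ≈ kbase (gpf_obj B) ∘ fmap F (gp_base f).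
Proof. unfold kbase at 1 2. cbn. rewrite <- !fmap_comp. now rewrite gp_baseE. Qed.

Lemma gpf_unit (A B : GPObj C) (f : GPHom A B) :
  fmap F (gmor f) ∘ kunit (gpf_obj A) ≈ kunit (gpf_obj B).
Proof. unfold kunit. cbn. rewrite compA, <- fmap_comp. now rewrite (gmor_unit f). Qed.

Definition gpf_hom (A B : GPObj C) (f : GPHom A B) : GPHom (gpf_obj A) (gpf_obj B) :=
  @gp_mk C' (gpf_obj A) (gpf_obj B) (fmap F (gmor f)) (fmap F (gp_base f))
    (gpf_base f) (gpf_unit f).

Lemma gpf_hom_base (A B : GPObj C) (f : GPHom A B) :
  gp_base (gpf_hom f) ≈ fmap F (gp_base f).
Proof. exact (gp_base_eq HC' (f := gpf_hom f) (gpf_base f)). Qed.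

Section Monoidal.
Variables (ch : GPChoice C) (S : GPStructure ch) (ch' : GPChoice C') (S' : GPStructure ch').

Definition gpf_functor : Functor (GP S) (GP S').
Proof.
refine (@Build_Functor (GP S) (GP S') gpf_obj gpf_hom _ _ _).
- intros A B f g e. exact (fmap_proper F e).
- intros A. exact (fmap_id F _).
- intros A B E g f. exact (fmap_comp F _ _).
Defined.

Lemma gpf_equivalence : is_equivalence gpf_functor.
Proof.
apply equivalence_of_ff.
- intros A B m.
  destruct (equivalence_full HF (gmor (m : GPHom (gpf_obj A) (gpf_obj B)))) as [m0 e0].
  destruct (equivalence_full HF (gp_base (m : GPHom (gpf_obj A) (gpf_obj B)))) as [g0 e1].
  assert (h1 : m0 ∘ kbase A ≈ kbase B ∘ g0).
  { apply (equivalence_faithful HF). rewrite !fmap_comp, e0, e1.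
    exact (gp_baseE (m : GPHom (gpf_obj A) (gpf_obj B))). }
  assert (h2 : m0 ∘ kunit A ≈ kunit B).
  { apply (equivalence_faithful HF). apply (iso_epi (ups_is_iso F)).
    rewrite fmap_comp, e0, <- compA. exact (gmor_unit (m : GPHom (gpf_obj A) (gpf_obj B))). }
  exists (@gp_mk C A B m0 g0 h1 h2). exact e0.
- intros A B f g e. exact (equivalence_faithful HF e).
- intros B. destruct (equivalence_ess_surj HF (gbase B)) as (X & e & He).
  destruct (gp_sum_ex HC X) as [T <-].
  destruct (@gp_iso_ex C' HC' (gpf_obj T) B e He) as (f & Hf & _).
  exists T, f. exact Hf.
Qed.

(** [F] preserves the splitting of [c], so the comparison is the lift of [mu] through the image of
    [c]. Its base is again [mu], whence invertibility. *)
Lemma gpf_mu_ex (A B : GPObj C) :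
  exists h : GPHom (ch_tens ch' (gpf_obj A) (gpf_obj B)) (gpf_obj (ch_tens ch A B)),
    fmap F (ch_c ch A B) ∘ gmor h ≈ mu F (A : C) (B : C) ∘ ch_c ch' (gpf_obj A) (gpf_obj B)
    /\ @is_iso (gp_cat C') _ _ h.
Proof.
assert (Fc : split_mono (fmap F (ch_c ch A B))) by apply split_mono_fmap, (ch_c_split HC).
assert (eb : mu F (A : C) (B : C) ∘ ch_c ch' (gpf_obj A) (gpf_obj B)
    ∘ kbase (ch_tens ch' (gpf_obj A) (gpf_obj B))
  ≈ fmap F (ch_c ch A B) ∘ kbase (gpf_obj (ch_tens ch A B)) ∘ mu F (gbase A) (gbase B)).
{ refine (transitivity (symmetry (compA _ _ _)) _).
  refine (transitivity (comp_proper (reflexivity _) (ch_c_base ch' (gpf_obj A) (gpf_obj B))) _).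
  refine (transitivity (mu_nat F (kbase A) (kbase B)) _).
  apply comp_proper; [|reflexivity].
  refine (transitivity (fmap_proper F (symmetry (ch_c_base ch A B))) _).
  apply fmap_comp. }
destruct (@gp_lift C' (ch_tens ch' (gpf_obj A) (gpf_obj B)) (gpf_obj (ch_tens ch A B)) _
  (mu F (A : C) (B : C) ∘ ch_c ch' (gpf_obj A) (gpf_obj B)) (fmap F (ch_c ch A B))
  (mu F (gbase A) (gbase B)) eb) as [h eh].
- rewrite <- compA, ch_c_unit.
  change (kunit (gpf_obj A)) with (fmap F (kunit A) ∘ ups F).
  change (kunit (gpf_obj B)) with (fmap F (kunit B) ∘ ups F).
  change (kunit (gpf_obj (ch_tens ch A B))) with (fmap F (kunit (ch_tens ch A B)) ∘ ups F).
  change (stot (gsum (gpf_obj (ch_tens ch A B)))) with (F (stot (gsum (ch_tens ch A B)))).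
  rewrite <- tensM, <- compA, (comp_pull (mu_nat F _ _)), (compA (fmap F (ch_c ch A B))), <- fmap_comp, ch_c_unit.
  rewrite fmap_comp, <- !compA. apply comp_proper; [reflexivity|].
  rewrite compA. apply mu_unit.
- exists h. split; [exact eh|]. apply gp_iso.
  apply (iso_proper (f := mu F (gbase A) (gbase B))); [|apply mu_iso].
  symmetry. apply (@gp_base_eq C' HC' _ _ h (mu F (gbase A) (gbase B))).
  apply (split_mono_cancel Fc). rewrite compA, eh. refine (transitivity eb _).
  exact (symmetry (compA _ _ _)).
Qed.

Lemma gpf_equivalent : global_phase_equivalent (GP_phases S) (GP_phases S').
Proof.
pose (m := fun A B => constructive_indefinite_description _ (gpf_mu_ex A B)).
assert (mE : forall A B, fmap F (ch_c ch A B) ∘ gmor (proj1_sig (m A B))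
  ≈ mu F (A : C) (B : C) ∘ ch_c ch' (gpf_obj A) (gpf_obj B)).
{ intros A B. exact (proj1 (proj2_sig (m A B))). }
destruct (@monfunctor_of_semi (GP S) (GP S') gpf_functor (fun A B => proj1_sig (m A B)))
  as [G eG].
- intros A B. exact (proj2 (proj2_sig (m A B))).
- intros A A' B B' f g.
  refine (cube_cancel _ (mE A B) (mE A' B') (GP_tensE (S := S') (gpf_hom f) (gpf_hom g)) _
    (mu_nat F (gmor f) (gmor g))).
  + apply split_mono_fmap, (ch_c_split HC).
  + refine (transitivity (symmetry (fmap_comp F _ _)) (transitivity _ (fmap_comp F _ _))).
    exact (fmap_proper F (GP_tensE f g)).
- intros A B E.
  refine (hexagon_cancel (y := fmap F (idm (A : C) ⊠ ch_c ch B E) ∘ fmap F (ch_c ch A (ch_tens ch B E)))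
    (z := fmap F (ch_c ch A B ⊠ idm (E : C)) ∘ fmap F (ch_c ch (ch_tens ch A B) E))
    (b := fmap F (alpha (A : C) (B : C) (E : C)))
    _ _
    (prism_r (mE A B) (mE (ch_tens ch A B) E) _ (GP_tensE (S := S') (proj1_sig (m A B)) (gp_id (gpf_obj E))))
    (prism_l (mE B E) (mE A (ch_tens ch B E)) _ (GP_tensE (S := S') (gp_id (gpf_obj A)) (proj1_sig (m B E))))
    (transitivity (GP_alphaE (S := S') (gpf_obj A) (gpf_obj B) (gpf_obj E)) (symmetry (compA _ _ _)))
    (transitivity (compA _ _ _) (mu_assoc F (A : C) (B : C) (E : C)))).
  + apply split_mono_comp; apply split_mono_fmap; [|apply (ch_c_split HC)].
    apply split_mono_tens; [apply iso_split_mono, iso_id|apply (ch_c_split HC)].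
  + refine (transitivity _ (transitivity (fmap_proper F (GP_alphaE (S := S) A B E)) _)).
    * rewrite !fmap_comp. reflexivity.
    * now rewrite !fmap_comp, compA.
  + rewrite <- (fmap_id F). apply mu_nat.
  + rewrite <- (fmap_id F). apply mu_nat.
- destruct (@gp_iso_ex C' HC' (ch_unit ch') (gpf_obj (ch_unit ch)) (ups F) (ups_is_iso F))
    as (v & Hv & _).
  exists v. exact Hv.
- exists G. split; [rewrite eG; exact gpf_equivalence|].
  intros u. rewrite (GP_phases_conj _ HC' (ups_iso G)), (GP_phasesE HC).
  rewrite eG. split; intros e.
  + exact (transitivity (gpf_hom_base u) (transitivity (fmap_proper F e) (fmap_id F _))).
  + apply (equivalence_faithful HF).
    exact (transitivity (symmetry (gpf_hom_base u)) (transitivity e (symmetry (fmap_id F _)))).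
Qed.


End Monoidal.
End GPFunctor.

(** * Phased biproducts in the quotient by global phases *)

Section QuotientBiproducts.
Variables (D : MonCat) (P : scalar D -> Prop) (HP : is_global_phases P).
#[local] Notation Q := (quotient HP).

(** Agreement on coprojections in the quotient allows a different scalar on each summand. The
    copairing of [u · kA] and [v · kB] is the phase that absorbs both. *)
Lemma pcoprod2_quotient (A B S : D) (kA : Hom A S) (kB : Hom B S) :
  (forall (X : D) (f : Hom A X) (g : Hom B X), exists h, h ∘ kA ≈ f /\ h ∘ kB ≈ g) ->
  (forall (X : D) (h h' : Hom S X), h ∘ kA ≈ h' ∘ kA -> h ∘ kB ≈ h' ∘ kB -> h ≈ h') ->
  @is_phased_coproduct2 Q A B S kA kB.
Proof.
intros ex epi. apply pcoprod2_intro.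
- intros X f g. destruct (ex X f g) as (h & h1 & h2).
  exists h. split; now apply (qeq_heq HP).
- intros X h h' eA eB.
  destruct (symmetry eA : qeq P _ _) as (u & Hu & eu).
  destruct (symmetry eB : qeq P _ _) as (v & Hv & ev).
  destruct (ex S (lscale u kA) (lscale v kB)) as (U & U1 & U2).
  exists U. split; [now exists u|]. split; [now exists v|].
  apply (qeq_heq HP (f := h') (g := @comp D _ _ _ h U)). apply epi.
  + rewrite <- (@compA D), U1, lscale_comp_r. exact eu.
  + rewrite <- (@compA D), U2, lscale_comp_r. exact ev.
Qed.

(** Phases of the quotient are diagonal matrices of scalars from [P], whether seen from the
    coprojections or from the projections: [p j ∘ k i] vanishes off the diagonal, so scaling it by
    [u i] or by [u j] gives the same. Decidability of [J] separates the two cases. *)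
Lemma biprod_quotient (zero : forall A B : D, Hom A B) (J : Type) (X : J -> D) (A : D)
    (k : forall i, Hom (X i) A) (p : forall i, Hom A (X i)) :
  (forall i j : J, {i = j} + {i <> j}) -> is_zero_arrows zero -> strict_biprod zero k p ->
  @is_phased_biproduct Q J X A zero k p.
Proof.
intros dec zP H.
assert (pk : forall (u : J -> scalar D) i j, lscale (u i) (p j ∘ k i) ≈ lscale (u j) (p j ∘ k i)).
{ intros u i j. destruct (dec j i) as [->|ne]; [reflexivity|].
  assert (z : forall v : scalar D, lscale v (p j ∘ k i) ≈ zero _ _).
  { intros v. rewrite (lscale_ext (reflexivity v) (sbn_zero H ne)), lscaleE. apply (zero_r zP). }
  now rewrite !z. }
split; [|split; [|split; [|split]]].
- intros i. apply (qeq_heq HP), (sbn_id H).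
- intros i j ne. apply (qeq_heq HP), (sbn_zero H ne).
- split.
  + intros B f. destruct (sbn_copair H f) as [h Hh].
    exists h. intros i. apply (qeq_heq HP), Hh.
  + intros B h h' e.
    assert (e' : forall i, {u : scalar D | P u /\
      @heq D (X i) B (@comp D _ _ _ h' (k i)) (lscale u (@comp D _ _ _ h (k i)))}).
    { intros i. apply constructive_indefinite_description. exact (symmetry (e i) : qeq P _ _). }
    destruct (sbn_copair H (fun i => lscale (proj1_sig (e' i)) (k i))) as [U HU].
    exists U. split.
    * intros i. exists (proj1_sig (e' i)). split; [apply (proj2_sig (e' i))|apply HU].
    * apply (qeq_heq HP (f := h') (g := @comp D _ _ _ h U)). apply (sbn_epi H). intros i.
      rewrite <- (@compA D), HU, lscale_comp_r. apply (proj2_sig (e' i)).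
- split.
  + intros B f. destruct (sbn_pair H f) as [h Hh].
    exists h. intros i. apply (qeq_heq HP), Hh.
  + intros B h h' e.
    assert (e' : forall i, {u : scalar D | P u /\
      @heq D B (X i) (@comp D _ _ _ (p i) h') (lscale u (@comp D _ _ _ (p i) h))}).
    { intros i. apply constructive_indefinite_description. exact (symmetry (e i) : qeq P _ _). }
    destruct (sbn_pair H (fun i => lscale (proj1_sig (e' i)) (p i))) as [U HU].
    exists U. split.
    * intros i. exists (proj1_sig (e' i)). split; [apply (proj2_sig (e' i))|apply HU].
    * apply (qeq_heq HP (f := h') (g := @comp D _ _ _ U h)). apply (sbn_mono H). intros i.
      rewrite (@compA D), HU, lscale_comp_l. apply (proj2_sig (e' i)).
- intros U. split; intros HU.
  + assert (e : forall i, {u : scalar D | P u /\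
      @heq D (X i) A (@comp D _ _ _ U (k i)) (lscale u (k i))}).
    { intros i. apply constructive_indefinite_description. exact (HU i). }
    intros j. exists (proj1_sig (e j)). split; [apply (proj2_sig (e j))|].
    change (@heq D A (X j) (@comp D _ _ _ (p j) U) (lscale (proj1_sig (e j)) (p j))).
    apply (sbn_epi H). intros i.
    rewrite <- (@compA D), (proj2 (proj2_sig (e i))), lscale_comp_r, lscale_comp_l.
    exact (pk (fun i => proj1_sig (e i)) i j).
  + assert (e : forall i, {u : scalar D | P u /\
      @heq D A (X i) (@comp D _ _ _ (p i) U) (lscale u (p i))}).
    { intros i. apply constructive_indefinite_description. exact (HU i). }
    intros i. exists (proj1_sig (e i)). split; [apply (proj2_sig (e i))|].
    change (@heq D (X i) A (@comp D _ _ _ U (k i)) (lscale (proj1_sig (e i)) (k i))).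
    apply (sbn_mono H). intros j.
    rewrite (@compA D), (proj2 (proj2_sig (e j))), lscale_comp_r, lscale_comp_l.
    symmetry. exact (pk (fun i => proj1_sig (e i)) i j).
Qed.

Hypothesis HD : has_finite_distributive_biproducts D.

Lemma coproduct_ex (A B : D) : exists (S : D) (kA : Hom A S) (kB : Hom B S) (pA : Hom S A) (pB : Hom S B),
  pA ∘ kA ≈ idm A /\ pB ∘ kB ≈ idm B /\
  (forall (X : D) (f : Hom A X) (g : Hom B X), exists h, h ∘ kA ≈ f /\ h ∘ kB ≈ g) /\
  (forall (X : D) (h h' : Hom S X), h ∘ kA ≈ h' ∘ kA -> h ∘ kB ≈ h' ∘ kB -> h ≈ h').
Proof.
destruct HD as (zero & _ & bP & _).
destruct (bP 2 (fin2 A B)) as (S & k & p & H). apply is_biproduct_strict in H.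
pose (F1 := Fin.F1 : Fin.t 2). pose (F2 := Fin.FS Fin.F1 : Fin.t 2).
exists S, (k F1), (k F2), (p F1), (p F2).
split; [exact (sbn_id H F1)|]. split; [exact (sbn_id H F2)|]. split.
- intros X f g. destruct (sbn_copair H (fin2_rect (P := fun Y => Hom Y X) f g)) as [h Hh].
  exists h. split; [exact (Hh F1)|exact (Hh F2)].
- intros X h h' e e'. apply (sbn_epi H). now apply fin2_ind.
Qed.

(** Centrality lets the scalar pass from the right of [f] to its left. *)
Lemma lscale_tens_l (u : scalar D) (A A' B B' : D) (f : Hom A A') (g : Hom B B') :
  P u -> f ⊠ lscale u g ≈ lscale u (f ⊠ g).
Proof.
intros Hu. rewrite lscale_tensr, <- (gph_central HP Hu f). apply lscale_tensl.
Qed.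

Lemma phase_tens_l (E A S : D) (U : Hom S S) (k : Hom A S) (u : scalar D) :
  P u -> U ∘ k ≈ lscale u k -> (idm E ⊠ U) ∘ (idm E ⊠ k) ≈ lscale u (idm E ⊠ k).
Proof. intros Hu e. rewrite tensM, e, comp_idl. now apply lscale_tens_l. Qed.

Lemma phase_tens_r (E A S : D) (U : Hom S S) (k : Hom A S) (u : scalar D) :
  U ∘ k ≈ lscale u k -> (U ⊠ idm E) ∘ (k ⊠ idm E) ≈ lscale u (k ⊠ idm E).
Proof. intros e. rewrite tensM, e, comp_idl. apply lscale_tensl. Qed.

Lemma quotient_biproducts : has_finite_distributive_phased_biproducts Q.
Proof.
pose proof HD as (zero & [[z1 z2] [z3 z4]] & bP & dP).
exists zero. split; [split; [split|split]|split].
- intros A B E f. apply (qeq_heq HP), z1.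
- intros A B E f. apply (qeq_heq HP), z2.
- intros A A' B B' f. apply (qeq_heq HP), z3.
- intros A A' B B' f. apply (qeq_heq HP), z4.
- intros n X. destruct (bP n X) as (A & k & p & H). exists A, k, p.
  apply is_biproduct_strict in H. apply biprod_quotient; [apply Fin.eq_dec|now split|exact H].
- intros E.
  (* The hypothesis only speaks of phased coproducts. Here the phases of the image come from phases
     of [S], which are trivial, so honest coproducts are preserved as such. *)
  assert (triv : forall (A B S : D) (kA : Hom A S) (kB : Hom B S) (G : Functor D D),
    (forall (X : D) (f : Hom A X) (g : Hom B X), exists h, h ∘ kA ≈ f /\ h ∘ kB ≈ g) ->
    (forall (X : D) (h h' : Hom S X), h ∘ kA ≈ h' ∘ kA -> h ∘ kB ≈ h' ∘ kB -> h ≈ h') ->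
    strongly_preserves_phased_coproducts G ->
    (forall (X : D) (f : Hom (G A) X) (g : Hom (G B) X), exists h, h ∘ fmap G kA ≈ f /\ h ∘ fmap G kB ≈ g) /\
    (forall (X : D) (h h' : Hom (G S) X), h ∘ fmap G kA ≈ h' ∘ fmap G kA ->
       h ∘ fmap G kB ≈ h' ∘ fmap G kB -> h ≈ h')).
  { intros A B S kA kB G ex epi HG.
    destruct (HG A B S kA kB (pcoprod2_of_coproduct ex epi)) as [HGS HV].
    split; [exact (pcoprod2_ex HGS)|]. intros X h h' e e'.
    destruct (pcoprod2_uniq HGS e e') as [V [HVp eV]].
    destruct (HV V HVp) as [U [HU eU]]. apply is_phase2E in HU as [U1 U2].
    assert (Uid : U ≈ idm S) by (apply epi; now rewrite comp_idl).
    now rewrite eV, eU, Uid, fmap_id, comp_idr. }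
  split; apply strongly_preserves_of_one; intros A B;
    destruct (coproduct_ex A B) as (S & kA & kB & _ & _ & _ & _ & ex & epi); exists S, kA, kB.
  + destruct (triv _ _ _ _ _ _ ex epi (proj1 (dP E))) as [ex' epi'].
    split; [now apply pcoprod2_quotient|]. split; [exact (pcoprod2_quotient ex' epi')|].
    intros V HV. apply is_phase2E in HV as [(u & Hu & eu) (v & Hv & ev)].
    (* [V] rescales the tensored coprojections by [u] and [v]; the endomorphism of [S] rescaling
       [kA] and [kB] in the same way induces it. *)
    destruct (ex S (lscale u kA) (lscale v kB)) as (U & U1 & U2).
    exists U. split; [apply is_phase2E; split; [now exists u|now exists v]|].
    apply (qeq_heq HP). apply epi'.
    * exact (@heq_trans D _ _ _ _ _ eu (symmetry (phase_tens_l E Hu U1))).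
    * exact (@heq_trans D _ _ _ _ _ ev (symmetry (phase_tens_l E Hv U2))).
  + destruct (triv _ _ _ _ _ _ ex epi (proj2 (dP E))) as [ex' epi'].
    split; [now apply pcoprod2_quotient|]. split; [exact (pcoprod2_quotient ex' epi')|].
    intros V HV. apply is_phase2E in HV as [(u & Hu & eu) (v & Hv & ev)].
    destruct (ex S (lscale u kA) (lscale v kB)) as (U & U1 & U2).
    exists U. split; [apply is_phase2E; split; [now exists u|now exists v]|].
    apply (qeq_heq HP). apply epi'.
    * exact (@heq_trans D _ _ _ _ _ eu (symmetry (phase_tens_r E U1))).
    * exact (@heq_trans D _ _ _ _ _ ev (symmetry (phase_tens_r E U2))).
Qed.

End QuotientBiproducts.

(** * Recovering [D] from its quotient *)

(** Variant with the comparison reversed, the direction in which [gp_lift] produces morphisms: into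
    a tensor of [GP], by lifting through [c]. *)
Lemma monfunctor_of_cosemi (M N : MonCat) (F : Functor M N)
    (n : forall A B : M, Hom (F (A ⊗ B)) (F A ⊗ F B)) :
  (forall A B, is_iso (n A B)) ->
  (forall (A A' B B' : M) (f : Hom A A') (g : Hom B B'),
     (fmap F f ⊠ fmap F g) ∘ n A B ≈ n A' B' ∘ fmap F (f ⊠ g)) ->
  (forall A B E : M, (idm (F A) ⊠ n B E) ∘ n A (B ⊗ E) ∘ fmap F (alpha A B E)
     ≈ alpha (F A) (F B) (F E) ∘ (n A B ⊠ idm (F E)) ∘ n (A ⊗ B) E) ->
  (exists v : Hom munit (F munit), is_iso v) -> exists G : MonFunctor M N, mfun G = F.
Proof.
intros nI nN nA Hv.
pose (m := fun A B => constructive_indefinite_description _ (nI A B)).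
assert (mn : forall A B, proj1_sig (m A B) ∘ n A B ≈ idm _) by (intros; apply (proj2_sig (m A B))).
assert (nm : forall A B, n A B ∘ proj1_sig (m A B) ≈ idm _) by (intros; apply (proj2_sig (m A B))).
apply (@monfunctor_of_semi M N F (fun A B => proj1_sig (m A B))); [| | |exact Hv].
- intros A B. exists (n A B). now split.
- intros A A' B B' f g. apply (iso_epi (nI A B)).
  rewrite <- !compA, nN, mn, comp_idr. now rewrite (comp_cancel (mn A' B')).
- intros A B E.
  apply (iso_epi (f := (n A B ⊠ idm (F E)) ∘ n (A ⊗ B) E)).
  { apply iso_comp; [|apply nI]. apply iso_tens; [apply nI|apply iso_id]. }
  rewrite <- !compA, (compA (alpha (F A) (F B) (F E))), <- nA.
  rewrite <- !compA, (compA (idm (F A) ⊠ proj1_sig _)), tensM, mn, comp_idl, tens_id, comp_idl.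
  rewrite (comp_cancel (mn A (B ⊗ E))).
  rewrite (compA (_ ⊠ idm _)), tensM, mn, comp_idl, tens_id, comp_idl, mn.
  now rewrite comp_idr.
Qed.

Lemma cosquare_cancel (C : Category) (P1 P2 Q1 Q2 S1 S2 : C) (n1 : Hom P1 Q1) (n2 : Hom P2 Q2)
    (t : Hom Q1 Q2) (t' : Hom P1 P2) (c1 : Hom Q1 S1) (c2 : Hom Q2 S2) (s : Hom S1 S2)
    (x1 : Hom P1 S1) (x2 : Hom P2 S2) :
  split_mono c2 -> c2 ∘ t ≈ s ∘ c1 -> c1 ∘ n1 ≈ x1 -> c2 ∘ n2 ≈ x2 -> s ∘ x1 ≈ x2 ∘ t' ->
  t ∘ n1 ≈ n2 ∘ t'.
Proof.
intros H e1 e2 e3 e4. apply (split_mono_cancel H).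
rewrite !compA, e1, e3, <- !compA, e2. exact e4.
Qed.

Lemma cohexagon_cancel (C : Category) (O1 O2 P1 P2 Q1 Q2 V W : C) (t : Hom O1 O2)
    (n1 : Hom O2 P2) (n2 : Hom P2 Q2) (m1 : Hom O1 P1) (m2 : Hom P1 Q1) (a : Hom Q1 Q2)
    (y : Hom Q2 W) (z : Hom Q1 V) (b : Hom V W) (w : Hom O2 W) (w' : Hom O1 V) :
  split_mono y -> y ∘ a ≈ b ∘ z -> y ∘ (n2 ∘ n1) ≈ w -> z ∘ (m2 ∘ m1) ≈ w' ->
  w ∘ t ≈ b ∘ w' -> n2 ∘ n1 ∘ t ≈ a ∘ m2 ∘ m1.
Proof.
intros H e1 e2 e3 e4. apply (split_mono_cancel H).
rewrite (compA y), e2, e4, <- !compA, (comp_pull e1), <- compA. now rewrite e3.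
Qed.

Lemma coprism_l (M : MonCat) (E X Y Z P R O : M) (c : Hom Y Z) (n : Hom X Y) (x : Hom X Z)
    (c' : Hom P (E ⊗ Y)) (n2 : Hom R P) (c'' : Hom R (E ⊗ X)) (n1 : Hom O R) (x' : Hom O (E ⊗ X)) :
  c ∘ n ≈ x -> c' ∘ n2 ≈ (idm E ⊠ n) ∘ c'' -> c'' ∘ n1 ≈ x' ->
  (idm E ⊠ c) ∘ c' ∘ (n2 ∘ n1) ≈ (idm E ⊠ x) ∘ x'.
Proof.
intros e1 e2 e3.
now rewrite <- !compA, (comp_pull e2), <- compA, e3, compA, tensM, e1, comp_idl.
Qed.

Lemma coprism_r (M : MonCat) (E X Y Z P R O : M) (c : Hom Y Z) (n : Hom X Y) (x : Hom X Z)
    (c' : Hom P (Y ⊗ E)) (n2 : Hom R P) (c'' : Hom R (X ⊗ E)) (n1 : Hom O R) (x' : Hom O (X ⊗ E)) :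
  c ∘ n ≈ x -> c' ∘ n2 ≈ (n ⊠ idm E) ∘ c'' -> c'' ∘ n1 ≈ x' ->
  (c ⊠ idm E) ∘ c' ∘ (n2 ∘ n1) ≈ (x ⊠ idm E) ∘ x'.
Proof.
intros e1 e2 e3.
now rewrite <- !compA, (comp_pull e2), <- compA, e3, compA, tensM, e1, comp_idl.
Qed.

(** A chosen [A ⊕ I], kept as data since it is the object part of the functor from [D] to [GP] of
    its quotient. *)
Record SplitSum (D : MonCat) (A : D) := {
  ss : D;
  ssk : Hom A ss;
  ssu : Hom munit ss;
  ssp : Hom ss A;
  ssq : Hom ss munit;
  ssp_k : ssp ∘ ssk ≈ idm A;
  ssq_u : ssq ∘ ssu ≈ idm munit;
  ss_copair : forall (X : D) (f : Hom A X) (g : Hom munit X), exists h, h ∘ ssk ≈ f /\ h ∘ ssu ≈ g;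
  ss_epi : forall (X : D) (h h' : Hom ss X), h ∘ ssk ≈ h' ∘ ssk -> h ∘ ssu ≈ h' ∘ ssu -> h ≈ h'
}.

(** * The functor [A ↦ A ⊕ I] from [D] to [GP] of its quotient *)

Section Recover.
Variables (D : MonCat) (P : scalar D -> Prop) (HP : is_global_phases P).
Hypothesis HD : has_finite_distributive_biproducts D.
Variable sm : forall A : D, SplitSum A.

#[local] Notation s A := (ss (sm A)).
#[local] Notation k A := (ssk (sm A)).
#[local] Notation u A := (ssu (sm A)).

Let fd_ex (A B : D) (f : Hom A B) : exists h : Hom (s A) (s B), h ∘ k A ≈ k B ∘ f /\ h ∘ u A ≈ u B.
Proof. apply ss_copair. Qed.

Let fd (A B : D) (f : Hom A B) : Hom (s A) (s B) :=
  proj1_sig (constructive_indefinite_description _ (fd_ex f)).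

Let fd_k (A B : D) (f : Hom A B) : fd f ∘ k A ≈ k B ∘ f.
Proof. exact (proj1 (proj2_sig (constructive_indefinite_description _ (fd_ex f)))). Qed.

Let fd_u (A B : D) (f : Hom A B) : fd f ∘ u A ≈ u B.
Proof. exact (proj2 (proj2_sig (constructive_indefinite_description _ (fd_ex f)))). Qed.

Let s_epi (A X : D) (h h' : Hom (s A) X) : h ∘ k A ≈ h' ∘ k A -> h ∘ u A ≈ h' ∘ u A -> h ≈ h'.
Proof. apply ss_epi. Qed.

Let fd_proper (A B : D) (f g : Hom A B) : f ≈ g -> fd f ≈ fd g.
Proof. intros e. apply s_epi; now rewrite ?fd_k, ?fd_u, ?e. Qed.

Let fd_id (A : D) : fd (idm A) ≈ idm (s A).
Proof. apply s_epi; now rewrite ?fd_k, ?fd_u, ?comp_idl, ?comp_idr. Qed.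

Let fd_comp (A B E : D) (g : Hom B E) (f : Hom A B) : fd (g ∘ f) ≈ fd g ∘ fd f.
Proof.
apply s_epi.
- now rewrite <- compA, !fd_k, (comp_pull (fd_k g)), compA.
- now rewrite <- compA, !fd_u.
Qed.

Let fd_faithful (A B : D) (f g : Hom A B) : fd f ≈ fd g -> f ≈ g.
Proof.
intros e. apply (split_mono_cancel (f := k B)); [exists (ssp (sm B)); apply ssp_k|].
now rewrite <- !fd_k, e.
Qed.

(** The counterpart of [c] in [D] itself, where coproducts are strict: naturality and associativity
    hold before passing to the quotient, and the comparison of the functor is lifted from it. *)
Let d_ex (A B : D) : exists h : Hom (s (A ⊗ B)) (s A ⊗ s B),
  h ∘ k (A ⊗ B) ≈ k A ⊠ k B /\ h ∘ u (A ⊗ B) ≈ ins (u A) (u B).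
Proof. apply ss_copair. Qed.

Let d (A B : D) : Hom (s (A ⊗ B)) (s A ⊗ s B) :=
  proj1_sig (constructive_indefinite_description _ (d_ex A B)).

Let d_k (A B : D) : d A B ∘ k (A ⊗ B) ≈ k A ⊠ k B.
Proof. exact (proj1 (proj2_sig (constructive_indefinite_description _ (d_ex A B)))). Qed.

Let d_u (A B : D) : d A B ∘ u (A ⊗ B) ≈ ins (u A) (u B).
Proof. exact (proj2 (proj2_sig (constructive_indefinite_description _ (d_ex A B)))). Qed.

Let d_nat (A A' B B' : D) (f : Hom A A') (g : Hom B B') :
  (fd f ⊠ fd g) ∘ d A B ≈ d A' B' ∘ fd (f ⊠ g).
Proof.
apply s_epi; rewrite <- !compA.
- now rewrite d_k, fd_k, compA, d_k, !tensM, !fd_k.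
- now rewrite d_u, fd_u, d_u, tens_ins, !fd_u.
Qed.

Let d_assoc (A B E : D) :
  (idm (s A) ⊠ d B E) ∘ d A (B ⊗ E) ∘ fd (alpha A B E)
  ≈ alpha (s A) (s B) (s E) ∘ ((d A B ⊠ idm (s E)) ∘ d (A ⊗ B) E).
Proof.
rewrite (compA (alpha _ _ _)). apply s_epi.
- rewrite (alpha_square (d_k A B) (d_k B E) (d_k (A ⊗ B) E) (d_k A (B ⊗ E))).
  now rewrite <- !compA, fd_k.
- rewrite <- !compA, fd_u, !d_u, !tens_ins, !comp_idl, !d_u.
  unfold ins at 3. now rewrite compA, alpha_ins, ins_comp.
Qed.

#[local] Notation Q := (quotient HP).

Let HQ : has_finite_distributive_phased_biproducts Q := quotient_biproducts HP HD.

Let sumP (A : D) : @is_phased_coproduct2 Q A munit (s A) (k A) (u A).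
Proof. exact (pcoprod2_quotient HP (@ss_copair D A (sm A)) (@ss_epi D A (sm A))). Qed.

Let gq_obj (A : D) : GPObj Q := {| gsum := @Build_SumWithUnit Q A (s A) (k A) (u A) (sumP A) |}.

Let gq_hom (A B : D) (f : Hom A B) : GPHom (gq_obj A) (gq_obj B) :=
  @gp_mk Q (gq_obj A) (gq_obj B) (fd f) f (qeq_heq HP (fd_k f)) (qeq_heq HP (fd_u f)).

Let gq_base (A B : D) (f : Hom A B) : @heq Q A B (gp_base (gq_hom f)) f.
Proof. exact (gp_base_eq HQ (f := gq_hom f) (qeq_heq HP (fd_k f))). Qed.

Variables (ch : GPChoice Q) (S : GPStructure ch).

Let gq_functor : Functor D (GP S).
Proof.
refine (@Build_Functor D (GP S) gq_obj gq_hom _ _ _).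
- intros A B f g e. exact (qeq_heq HP (fd_proper e)).
- intros A. exact (qeq_heq HP (fd_id A)).
- intros A B E g f. exact (qeq_heq HP (fd_comp g f)).
Defined.

Let gq_equivalence : is_equivalence gq_functor.
Proof.
apply equivalence_of_ff.
- intros A B m.
  (* A representative of [m] scales the unit coprojection by [x] and the base by [y]. Dividing by
     [x] normalises the unit part and leaves [x⁻¹ y] on the base. *)
  destruct (gmor_unit (m : GPHom (gq_obj A) (gq_obj B))) as (x & Px & ex).
  destruct (gp_baseE (m : GPHom (gq_obj A) (gq_obj B))) as (y & Py & ey).
  destruct (gph_iso HP Px) as [x' Hx].
  pose (g := gp_base (m : GPHom (gq_obj A) (gq_obj B)) : @Hom D A B).
  exists (lscale (x' ∘ y) g).
  refine (symmetry (_ : @heq Q _ _ (gmor (m : GPHom (gq_obj A) (gq_obj B))) (fd (lscale (x' ∘ y) g)))).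
  exists x. split; [assumption|].
  apply s_epi.
  + refine (@heq_trans D _ _ _ _ _ ey _).
    change (lscale y (k B ∘ g) ≈ lscale x (fd (lscale (x' ∘ y) g)) ∘ k A).
    rewrite lscale_comp_l, fd_k, lscale_comp_r, lscale_lscale.
    apply lscale_ext; [|reflexivity].
    rewrite compA, (proj2 Hx). now rewrite comp_idl.
  + refine (@heq_trans D _ _ _ _ _ ex _).
    change (lscale x (u B) ≈ lscale x (fd (lscale (x' ∘ y) g)) ∘ u A).
    now rewrite lscale_comp_l, fd_u.
- intros A B f g (x & Px & ex). apply fd_faithful.
  (* Both [fd f] and [fd g] preserve the unit coprojection, which is split; so the scalar relating
     them is the identity. *)
  assert (xid : x ≈ idm munit).
  { assert (e : u B ≈ lscale x (u B)).
    { change (fd f ≈ lscale x (fd g)) in ex.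
      transitivity (fd f ∘ u A); [now rewrite fd_u|].
      now rewrite ex, lscale_comp_l, fd_u. }
    transitivity (ssq (sm B) ∘ lscale x (u B)).
    - now rewrite lscale_comp_r, ssq_u, lscale_unit.
    - rewrite <- e. apply ssq_u. }
  refine (@heq_trans D _ _ _ _ _ ex _).
  change (lscale x (fd g) ≈ fd g).
  rewrite (lscale_ext xid (reflexivity (fd g))). apply lscale_id.
- intros B. destruct (@gp_iso_ex Q HQ (gq_obj (gbase B)) B (idm (gbase B)) (iso_id _)) as (f & Hf & _).
  exists (gbase B), f. exact Hf.
Qed.

Let n_ex (A B : D) : exists h : GPHom (gq_obj (A ⊗ B)) (ch_tens ch (gq_obj A) (gq_obj B)),
  @heq Q _ _ (ch_c ch (gq_obj A) (gq_obj B) ∘ gmor h) (d A B) /\ @is_iso (gp_cat Q) _ _ h.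
Proof.
assert (e : @heq Q _ _ ((d A B : @Hom Q (s (A ⊗ B)) (s A ⊗ s B)) ∘ kbase (gq_obj (A ⊗ B)))
  (ch_c ch (gq_obj A) (gq_obj B) ∘ kbase (ch_tens ch (gq_obj A) (gq_obj B)))).
{ refine (@heq_trans Q _ _ _ _ _ (qeq_heq HP (d_k A B)) (@heq_sym Q _ _ _ _ _)).
  exact (ch_c_base ch (gq_obj A) (gq_obj B)). }
destruct (@gp_lift Q (gq_obj (A ⊗ B)) (ch_tens ch (gq_obj A) (gq_obj B)) _ (d A B)
  (ch_c ch (gq_obj A) (gq_obj B)) (idm _)) as [h eh].
- exact (@heq_trans Q _ _ _ _ _ e (@heq_sym Q _ _ _ _ (comp_idr _))).
- refine (@heq_trans Q _ _ _ _ _ (qeq_heq HP (d_u A B)) (@heq_sym Q _ _ _ _ _)).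
  exact (ch_c_unit_ins ch (gq_obj A) (gq_obj B)).
- exists h. split; [exact eh|]. apply gp_iso.
  refine (iso_proper (symmetry _) (iso_id _)).
  apply (@gp_base_eq Q HQ _ _ h (idm _)).
  apply (split_mono_cancel (ch_c_split HQ ch (gq_obj A) (gq_obj B))).
  refine (@heq_trans Q _ _ _ _ _ (compA _ _ _) _).
  refine (@heq_trans Q _ _ _ _ _ (comp_proper eh (reflexivity _)) _).
  refine (@heq_trans Q _ _ _ _ _ e _).
  exact (comp_proper (reflexivity _) (@heq_sym Q _ _ _ _ (comp_idr _))).
Qed.

Lemma recover_equivalent : global_phase_equivalent P (GP_phases S).
Proof.
pose (n := fun A B => constructive_indefinite_description _ (n_ex A B)).
assert (nE : forall A B, @heq Q _ _ (ch_c ch (gq_obj A) (gq_obj B) ∘ gmor (proj1_sig (n A B))) (d A B)).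
{ intros A B. exact (proj1 (proj2_sig (n A B))). }
destruct (@monfunctor_of_cosemi D (GP S) gq_functor (fun A B => proj1_sig (n A B))) as [G eG].
- intros A B. exact (proj2 (proj2_sig (n A B))).
- intros A A' B B' f g.
  exact (cosquare_cancel (ch_c_split HQ ch (gq_obj A') (gq_obj B'))
    (GP_tensE (S := S) (gq_hom f) (gq_hom g)) (nE A B) (nE A' B') (qeq_heq HP (d_nat f g))).
- intros A B E.
  exact (cohexagon_cancel (ch_c_assoc_split HQ ch (gq_obj A) (gq_obj B) (gq_obj E))
    (@heq_trans Q _ _ _ _ _ (GP_alphaE (S := S) (gq_obj A) (gq_obj B) (gq_obj E)) (@heq_sym Q _ _ _ _ (compA _ _ _)))
    (coprism_l (nE B E) (GP_tensE (S := S) (gp_id (gq_obj A)) (proj1_sig (n B E))) (nE A (B ⊗ E)))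
    (coprism_r (nE A B) (GP_tensE (S := S) (proj1_sig (n A B)) (gp_id (gq_obj E))) (nE (A ⊗ B) E))
    (qeq_heq HP (d_assoc A B E))).
- destruct (@gp_iso_ex Q HQ (ch_unit ch) (gq_obj munit) (idm _) (iso_id _)) as (v & Hv & _).
  exists v. exact Hv.
- exists G. split; [rewrite eG; exact gq_equivalence|].
  intros x. rewrite (GP_phases_conj _ HQ (ups_iso G)), eG.
  (* Equality of a scalar [x] with the identity in the quotient means [x = y · 1 = y] for some [y]
     in [P]. *)
  assert (e : @heq Q _ _ x (idm munit) <-> P x).
  { split.
    - intros (y & Py & ey). apply (gph_proper HP (y := y)); [|exact Py].
      exact (@heq_trans D _ _ _ _ _ ey (lscale_unit y)).
    - intros Px. exists x. split; [assumption|]. exact (@heq_sym D _ _ _ _ (lscale_unit x)). }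
  rewrite <- e. split; intros ex.
  + exact (@heq_trans Q _ _ _ _ _ (gq_base x) ex).
  + exact (@heq_trans Q _ _ _ _ _ (@heq_sym Q _ _ _ _ (gq_base x)) ex).
Qed.

End Recover.

Lemma SplitSum_inhabited (D : MonCat) (A : D) :
  has_finite_distributive_biproducts D -> inhabited (SplitSum A).
Proof.
intros HD. destruct (coproduct_ex HD A munit) as (S & kA & kB & pA & pB & e1 & e2 & ex & epi).
exact (inhabits (Build_SplitSum e1 e2 ex epi)).
Qed.

(** A bijection up to equivalence: the first two clauses say that the assignments are well-typed and
    mutually inverse, the last two that each respects equivalence. As [GP] is taken for arbitrary
    choices and structures, the third clause also covers independence of these choices. *)
Theorem corollary6p4 :
  (forall C : MonCat, has_finite_distributive_phased_biproducts C ->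
     inhabited (GPChoice C) /\
     forall ch : GPChoice C,
       inhabited (GPStructure ch) /\
       forall S : GPStructure ch,
         has_finite_distributive_biproducts (GP S) /\
         exists HP : is_global_phases (GP_phases S),
           monoidally_equivalent (quotient HP) C)
  /\
  (forall (D : MonCat) (P : scalar D -> Prop) (HP : is_global_phases P),
     has_finite_distributive_biproducts D ->
     has_finite_distributive_phased_biproducts (quotient HP) /\
     forall (ch : GPChoice (quotient HP)) (S : GPStructure ch),
       global_phase_equivalent P (GP_phases S))
  /\
  (forall C C' : MonCat,
     has_finite_distributive_phased_biproducts C ->
     has_finite_distributive_phased_biproducts C' ->
     monoidally_equivalent C C' ->
     forall (ch : GPChoice C) (S : GPStructure ch) (ch' : GPChoice C') (S' : GPStructure ch'),
       global_phase_equivalent (GP_phases S) (GP_phases S'))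
  /\
  (forall (D : MonCat) (P : scalar D -> Prop) (HP : is_global_phases P)
          (D' : MonCat) (P' : scalar D' -> Prop) (HP' : is_global_phases P'),
     has_finite_distributive_biproducts D ->
     has_finite_distributive_biproducts D' ->
     global_phase_equivalent P P' ->
     monoidally_equivalent (quotient HP) (quotient HP')).
Proof.
split; [|split; [|split]].
- intros C HC. split; [exact (GPChoice_inhabited HC)|].
  intros ch. split; [exact (GPStructure_inhabited HC ch)|].
  intros S. split; [exact (GP_biproducts S HC)|].
  exists (GP_global_phases S HC). apply GP_quotient_equivalent.
- intros D P HP HD. split; [exact (quotient_biproducts HP HD)|].
  intros ch S. apply (recover_equivalent HD).
  intros A. apply (fun H => proj1_sig (constructive_indefinite_description (fun _ : SplitSum A => True) H)).
  destruct (SplitSum_inhabited A HD) as [sA]. now exists sA.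
- intros C C' HC HC' [F HF] ch S ch' S'. exact (gpf_equivalent HC HC' HF S S').
- intros D P HP D' P' HP' HD HD' (F & HF & FP). exact (quotient_equivalent HP HP' HF FP).
Qed.
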